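(* Let $\{x_j\}_{j\in\mathbb{Z}}\subset\mathbb{R}$ be a complete interpolating sequence and let $\{\phi_\alpha\}_{\alpha\in\Lambda}$ be a regular family of interpolators. There is a constant $C$, independent of $f$, $\alpha$ and $x$, such that for every $f\in PW_\pi$, every $\alpha\in\Lambda$ and every $x\in\mathbb{R}$, $$\big|f(x)-I_\alpha f(x)\big|\le C\left\|T_\alpha\hat f\right\|_{L^2([-\pi,\pi])},\qquad\text{where } T_\alpha g(\xi)=\frac{m_\alpha}{\hat\phi_\alpha(\xi)}\,g(\xi)\ \text{ for } |\xi|\le\pi .$$ Consequently, for every $f\in PW_\pi$, $\lim_{\alpha\to\infty}I_\alpha f(x)=f(x)$ uniformly on $\mathbb{R}$ (limit along $\alpha\in\Lambda$).
   Context: Fourier transform: $\hat g(\xi)=(2\pi)^{-1/2}\int_{\mathbb{R}}g(x)e^{-ix\xi}\,dx$ for $g\in L^1(\mathbb{R})$, extended in the usual way (in particular to $L^2(\mathbb{R})$). $PW_\pi=\{f\in L^2(\mathbb{R}):\operatorname{supp}(\hat f)\subset[-\pi,\pi]\}$; each $f\in PW_\pi$ is identified with its continuous representative, so pointwise values make sense. A sequence $\{x_j\}_{j\in\mathbb{Z}}\subset\mathbb{R}$ is a complete interpolating sequence (CIS) if $\{e^{-ix_j\xi}\}_{j\in\mathbb{Z}}$ is a Riesz basis for $L^2([-\pi,\pi])$, i.e. its linear span is dense in $L^2([-\pi,\pi])$ and there is $C>0$ with $C^{-1}\|\{a_j\}\|_{l^2(\mathbb{Z})}\le\|\sum_j a_je^{-ix_j\xi}\|_{L^2([-\pi,\pi])}\le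 C\|\{a_j\}\|_{l^2(\mathbb{Z})}$ for all $\{a_j\}\in l^2(\mathbb{Z})$. Conditions (A1)-(A3) on a real-valued function $\phi$ on $\mathbb{R}$: (A1) $\phi,\hat\phi\in L^1(\mathbb{R})$ ($\phi$ is identified with its continuous representative); (A2) $\hat\phi(\xi)\ge 0$ for all $\xi\in\mathbb{R}$, and there is $\delta>0$ with $\hat\phi(\xi)\ge\delta$ on $[-\pi,\pi]$; (A3) with $M_j=\sup_{|\xi|\le\pi}\hat\phi(\xi+2\pi j)$, $\{M_j\}\in l^1(\mathbb{Z})$. Let $\Lambda\subset(0,\infty)$ be an unbounded set (discrete or continuous). A family $\{\phi_\alpha\}_{\alpha\in\Lambda}$ of real-valued functions is a regular family of interpolators if: (H1) each $\phi_\alpha$ satisfies (A1)-(A3); (H2) there is $C$ independent of $\alpha$ with $\sum_{j\ne0}M_j(\alpha)\le C m_\alpha$ for all $\alpha\in\Lambda$, where $M_j(\alpha)=\sup_{|\xi|\le\pi}\hat\phi_\alpha(\xi+2\pi j)$ and $m_\alpha=\inf_{|\xi|\le\pi}\hat\phi_\alpha(\xi)$; (H3) for almost every $|\xi|\le\pi$, $\lim_{\alpha\to\infty} m_\alpha/\hat\phi_\alpha(\xi)=0$. For $f\in PW_\pi$ and $\alpha\in\Lambda$, $I_\alpha f(x)=\sum_{j\in\mathbb{Z}}a_j\phi_\alpha(x-x_j)$, where $\{a_j\}\in l^2(\mathbb{Z})$ (depending on $\alpha$ and $f$) is the unique $l^2(\mathbb{Z})$ sequence such that $I_\alpha f(x_n)=f(x_n)$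 for all $n\in\mathbb{Z}$ (such a sequence exists and is unique, and $I_\alpha f$ is continuous and in $L^2(\mathbb{R})$). *)

(* Defs.v *)
From HB Require Import structures.
From mathcomp Require Import all_boot all_order all_algebra.
From mathcomp Require Import finmap complex.
From mathcomp Require Import all_classical all_reals all_analysis.
From mathcomp Require summability.

Set Implicit Arguments.
Unset Strict Implicit.
Unset Printing Implicit Defensive.

Import Order.TTheory GRing.Theory Num.Theory.
Import numFieldNormedType.Exports.
Import Normc.

Local Open Scope classical_set_scope.
Local Open Scope complex_scope.
Local Open Scope ring_scope.

Definition cmeasurable (R : realType) (D : set R) (g : R -> R[i]) : Prop :=
  measurable_fun D (fun t => complex.Re (g t)) /\
  measurable_fun D (fun t => complex.Im (g t)).

Definition ccontinuous (R : realType) (g : R -> R[i]) : Prop :=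
  continuous (fun t => complex.Re (g t) : R) /\
  continuous (fun t => complex.Im (g t) : R).

Definition in_L1 (R : realType) (g : R -> R[i]) : Prop :=
  lebesgue_measure.-integrable [set: R] (fun t => (complex.Re (g t))%:E) /\
  lebesgue_measure.-integrable [set: R] (fun t => (complex.Im (g t))%:E).

Definition L2norm (R : realType) (D : set R) (g : R -> R[i]) : \bar R :=
  Lnorm lebesgue_measure 2%:E ((fun t => (normc (g t))%:E) \_ D).

Definition in_L2 (R : realType) (D : set R) (g : R -> R[i]) : Prop :=
  cmeasurable D g /\ (L2norm D g < +oo)%E.

(* Support of an almost-everywhere class: the complement of the largest open
   set on which g vanishes almost everywhere. *)
Definition supp (R : realType) (g : R -> R[i]) : set R :=
  ~` \bigcup_(U in [set U : set R | open U /\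
       {ae lebesgue_measure, forall t : R, U t -> g t = 0}]) U.

Definition cintegral (R : realType) (g : R -> R[i]) : R[i] :=
  Rintegral lebesgue_measure [set: R] (fun t => complex.Re (g t)) +i*
  Rintegral lebesgue_measure [set: R] (fun t => complex.Im (g t)).

Definition expi (R : realType) (t : R) : R[i] := cos t +i* sin t.

Definition fourier (R : realType) (g : R -> R[i]) (xi : R) : R[i] :=
  ((Num.sqrt (2 * pi))^-1)%:C * cintegral (fun t => g t * expi (- (t * xi))).

(* [ghat] represents the L2 Fourier transform of [g]: the extension by
   continuity of [fourier] from L1 /\ L2 to L2. *)
Definition is_fourier_L2 (R : realType) (g ghat : R -> R[i]) : Prop :=
  [/\ in_L2 setT g, in_L2 setT ghat &
   exists u : nat -> R -> R[i],
     [/\ forall n, in_L1 (u n) /\ in_L2 setT (u n),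
         L2norm setT (fun t => u n t - g t) @[n --> \oo] --> 0%E &
         L2norm setT (fun xi => fourier (u n) xi - ghat xi) @[n --> \oo]
           --> 0%E]].

Definition Ipi (R : realType) : set R := `[- pi, pi]%classic.
Arguments Ipi : clear implicits.

(* The transform is only determined almost everywhere, but [supp] does not
   depend on the representative; the continuity assumption selects the
   continuous representative of f. *)
Definition PW (R : realType) (f : R -> R[i]) : Prop :=
  [/\ in_L2 setT f, ccontinuous f &
   exists2 fhat, is_fourier_L2 f fhat & supp fhat `<=` Ipi R].

Definition l2norm (R : realType) (a : int -> R[i]) : \bar R :=
  poweR (\esum_(j in [set: int]) ((normc (a j)) ^+ 2)%:E) (2^-1).

Definition in_l2 (R : realType) (a : int -> R[i]) : Prop :=
  (l2norm a < +oo)%E.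

(* Series indexed by the integers are summed unconditionally: [totally] is the
   filter of finite sets of indices ordered by inclusion. *)
Definition is_L2sum (R : realType) (D : set R) (u : int -> R -> R[i])
    (S : R -> R[i]) : Prop :=
  in_L2 D S /\
  L2norm D (fun t => \sum_(j <- enum_fset A) u j t - S t)
    @[A --> (@summability.totally int)] --> 0%E.

(* [sum] is the limit along [totally]; its value is arbitrary when the series
   diverges. *)
Definition csum (R : realType) (u : int -> R[i]) : R[i] :=
  @summability.sum int R R^o (fun j => complex.Re (u j)) +i*
  @summability.sum int R R^o (fun j => complex.Im (u j)).

Definition node_exp (R : realType) (x : int -> R) (j : int) (xi : R) : R[i] :=
  expi (- (x j * xi)).

Definition CIS (R : realType) (x : int -> R) : Prop :=
  (forall g : R -> R[i], in_L2 (Ipi R) g -> forall eps : R, 0 < eps ->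
     exists (A : {fset int}) (c : int -> R[i]),
       (L2norm (Ipi R)
          (fun xi => (g xi - \sum_(j <- enum_fset A) c j * node_exp x j xi)%R)
          < eps%:E)%E)
  /\
  (exists2 C : R, 0 < C & forall a : int -> R[i], in_l2 a ->
     exists2 S : R -> R[i],
       is_L2sum (Ipi R) (fun j xi => a j * node_exp x j xi) S &
       ((C^-1)%:E * l2norm a <= L2norm (Ipi R) S)%E /\
       (L2norm (Ipi R) S <= C%:E * l2norm a)%E).

Definition rfourier (R : realType) (phi : R -> R) : R -> R[i] :=
  fourier (fun t => (phi t)%:C).

(* Under [A2] the transform is real, so [Re] below loses nothing. *)
Definition Mj (R : realType) (phi : R -> R) (j : int) : \bar R :=
  ereal_sup [set (complex.Re (rfourier phi (xi + 2 * pi * j%:~R)))%:E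
            | xi in Ipi R].

Definition mphi (R : realType) (phi : R -> R) : R :=
  inf [set complex.Re (rfourier phi xi) | xi in Ipi R].

(* Continuity of phi selects the continuous representative. *)
Definition A1 (R : realType) (phi : R -> R) : Prop :=
  [/\ in_L1 (fun t => (phi t)%:C), in_L1 (rfourier phi) & continuous phi].

(* The order of R[i]: z <= w means that w - z is a nonnegative real. *)
Definition A2 (R : realType) (phi : R -> R) : Prop :=
  (forall xi, 0 <= rfourier phi xi) /\
  (exists2 delta : R, 0 < delta &
     forall xi, Ipi R xi -> delta%:C <= rfourier phi xi).

Definition A3 (R : realType) (phi : R -> R) : Prop :=
  (\esum_(j in [set: int]) Mj phi j < +oo)%E.

Definition regular_family (R : realType) (Lambda : set R) (phi : R -> R -> R)
    : Prop :=
  [/\ forall alpha, Lambda alpha ->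
        [/\ A1 (phi alpha), A2 (phi alpha) & A3 (phi alpha)],
      exists C : R, forall alpha, Lambda alpha ->
        (\esum_(j in [set j : int | (j != 0)%R]) Mj (phi alpha) j
           <= (C * mphi (phi alpha))%:E)%E &
      {ae lebesgue_measure, forall xi : R, Ipi R xi ->
        mphi (phi alpha) / complex.Re (rfourier (phi alpha) xi)
          @[alpha --> within Lambda (pinfty_nbhs R)] --> (0 : R)}].

Definition translates_sum (R : realType) (x : int -> R) (phi : R -> R)
    (a : int -> R[i]) (t : R) : R[i] :=
  csum (fun j => a j * (phi (t - x j))%:C).

(* The unique square-summable sequence whose sum of translates interpolates f
   at the nodes. The default value 0 is only used if there is no such sequence,
   which does not happen when x is a complete interpolating sequence, phi
   satisfies A1-A3 and f is in PW. *)
Definition interp_coef (R : realType) (x : int -> R) (phi : R -> R)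
    (f : R -> R[i]) : int -> R[i] :=
  xget (fun=> 0) [set a | in_l2 a /\
                    forall n, translates_sum x phi a (x n) = f (x n)].

Definition interpolant (R : realType) (x : int -> R) (phi : R -> R)
    (f : R -> R[i]) : R -> R[i] :=
  translates_sum x phi (interp_coef x phi f).

Definition Tmul (R : realType) (phi : R -> R) (g : R -> R[i]) (xi : R) : R[i] :=
  (mphi phi)%:C / rfourier phi xi * g xi.

(* Main.v *)
(* Write D = [-pi, pi], e_t(xi) = exp(-i t xi), h for the Fourier transform of
   phi_alpha and m for its infimum over D. By Fourier inversion, for a finite
   combination S = sum_j c_j e_(x_j) the error f(t) - sum_j c_j phi_alpha(t - x_j)
   is, up to a constant, the integral of (fhat - h S) exp(i t xi) over D minus the
   integral of h S exp(i t xi) outside D.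

   Translating by 2 pi k only multiplies the coefficients of S by unimodular
   factors, so the integral of |S|^2 over D + 2 pi k is comparable to |c|^2 and
   (H2) bounds the integral of h |S|^2 outside D by a constant times m |S|^2.
   When the combination interpolates f at the nodes, r = fhat - h S satisfies
   <r, e_(x_n)> = <h S, e_(x_n)> outside D for all n. Hence, by density of the
   exponentials, |r| <= K m |S|, and <r, S> >= 0. Pairing
   (m / h) fhat = m S + (m / h) r with r then gives m |S| <= (2 + K) |T fhat|, and
   the error is at most a constant times m |S|. An infinite combination is treated
   by truncation, with an error term that tends to 0. The interpolating sequence
   exists because the finite sections of the system are positive definite with
   uniformly bounded solutions. The limit follows by dominated convergence. *)
Require Import Defs.
From HB Require Import structures.
From mathcomp Require Import all_boot all_order all_algebra.
From mathcomp Require Import finmap complex.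
From mathcomp Require Import all_classical all_reals all_analysis.
From mathcomp Require Import measurable_realfun ring lra.
From mathcomp Require summability.

Set Implicit Arguments.
Unset Strict Implicit.
Unset Printing Implicit Defensive.

Import Order.TTheory GRing.Theory Num.Theory.
Import numFieldNormedType.Exports.
Import Normc.
Local Open Scope classical_set_scope.
Local Open Scope complex_scope.
Local Open Scope ring_scope.

(** * Square-integrable complex functions *)

(** All pairings are real: the coefficient d in [d * node t] ranges over the complex numbers, so
    real pairings determine complex values. Only finite exponential sums are formed. A truncated
    interpolating sequence no longer solves its equations, so the estimate is proved for sums whose
    errors at the nodes have l2 norm at most eps, a condition stated by duality.

    The L2 transform is given through approximating functions only. Plancherel's theorem is replaced
    by the multiplication formula against two even weights, the Abel factor exp(-e |x|) and the
    indicator of D, whose cosine transforms are the Poisson and the sinc kernels.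

    The sign <r, S> >= 0 holds because S is itself a test sum and its pairing with h S outside D is
    nonnegative. The crude bound |(m / h) r| <= |r| <= K m |S| would require K < 1. Instead, m / h
    <= 1 gives |(m / h) r|^2 <= <(m / h) r, r>, and the resulting quadratic inequality for m |S|
    yields the factor 2 + K for every K. *)

Section complex_dot.
Variable R : realType.
Implicit Types (z u v : R[i]) (a : R).

(* The real part of z * u^*: with the real inner product below, all integrals are
   integrals of real functions. *)
Definition dotc z u : R := complex.Re z * complex.Re u + complex.Im z * complex.Im u.
Definition sqc z : R := dotc z z.

Lemma dotcC z u : dotc z u = dotc u z.
Proof. by rewrite /dotc; ring. Qed.

Lemma dotcDl z u v : dotc (z + u) v = dotc z v + dotc u v.
Proof. by case: z u v => [a b] [c d] [e f]; rewrite /dotc /=; ring. Qed.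

Lemma dotcBl z u v : dotc (z - u) v = dotc z v - dotc u v.
Proof. by case: z u v => [a b] [c d] [e f]; rewrite /dotc /=; ring. Qed.

Lemma dotcZl a z u : dotc (a%:C * z) u = a * dotc z u.
Proof. by case: z u => [c d] [e f]; rewrite /dotc /=; ring. Qed.

Lemma dotcM v z u : dotc (v * z) (v * u) = sqc v * dotc z u.
Proof. by case: v z u => [a b] [c d] [e f]; rewrite /sqc /dotc /=; ring. Qed.

Lemma sqc_ge0 z : 0 <= sqc z.
Proof. by rewrite /sqc /dotc addr_ge0// -expr2 sqr_ge0. Qed.

Lemma sqcM z u : sqc (z * u) = sqc z * sqc u.
Proof. exact: dotcM. Qed.

Lemma sqcE z : sqc z = normc z ^+ 2.
Proof. by case: z => a b; rewrite /sqc /dotc /= sqr_sqrtr ?addr_ge0 ?sqr_ge0 ?expr2. Qed.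

Lemma normc_sqrt z : normc z = Num.sqrt (sqc z).
Proof. by case: z => a b; rewrite /sqc /dotc /= !expr2. Qed.

Lemma normc_nonneg z : 0 <= normc z.
Proof. by rewrite normc_sqrt sqrtr_ge0. Qed.

Lemma sqcD_le z u : sqc (z + u) <= 2 * (sqc z + sqc u).
Proof.
case: z u => [a b] [c d]; rewrite /sqc /dotc /= -subr_ge0.
set X := (X in 0 <= X); have -> : X = (a - c) ^+ 2 + (b - d) ^+ 2 by rewrite /X; ring.
by rewrite addr_ge0// sqr_ge0.
Qed.

Lemma normr_dotc_le z u : `|dotc z u| <= sqc z + sqc u.
Proof.
case: z u => [a b] [c d]; rewrite /sqc /dotc /= ler_norml; apply/andP; split.
  by have := sqr_ge0 (a + c); have := sqr_ge0 (b + d); rewrite !expr2; nra.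
by have := sqr_ge0 (a - c); have := sqr_ge0 (b - d); rewrite !expr2; nra.
Qed.

Lemma dotc_le_normc z u : `|dotc z u| <= normc z * normc u.
Proof.
rewrite -(@ler_pXn2r _ 2)// ?nnegrE ?mulr_ge0 ?normc_nonneg// exprMn -!sqcE real_normK
  ?num_real//.
case: z u => [a b] [c d]; rewrite /sqc /dotc /= -subr_ge0.
set X := (X in 0 <= X); have -> : X = (a * d - b * c) ^+ 2 by rewrite /X; ring.
by rewrite sqr_ge0.
Qed.

Lemma sqc_expi a : sqc (expi a) = 1.
Proof. by rewrite /sqc /dotc /= -!expr2 cos2Dsin2. Qed.

Lemma dotc_expi z u a : dotc (z * expi a) (u * expi a) = dotc z u.
Proof. by rewrite ![_ * expi a]mulrC dotcM sqc_expi mul1r. Qed.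

Lemma expiD (a b : R) : expi (a + b) = expi a * expi b.
Proof. by apply/eqP; rewrite eq_complex /= cosD sinD; apply/andP; split; apply/eqP; ring. Qed.

Lemma dotc_sum I (s : seq I) (F : I -> R[i]) u :
  dotc (\sum_(i <- s) F i) u = \sum_(i <- s) dotc (F i) u.
Proof.
elim: s => [|i s IH]; last by rewrite !big_cons dotcDl IH.
by rewrite !big_nil /dotc /= !mul0r addr0.
Qed.

End complex_dot.

Section weighted_L2.
Variable R : realType.
Notation mu := (@lebesgue_measure R).
Implicit Types (w : R -> R) (f g h : R -> R[i]).

Lemma cmeasurableD f g : cmeasurable setT f -> cmeasurable setT g ->
  cmeasurable setT (fun t => f t + g t).
Proof.
move=> [fr fi] [gr gi]; split.
  apply: (eq_measurable_fun (fun t => complex.Re (f t) + complex.Re (g t)));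
    last exact: measurable_funD.
  by move=> t _; case: (f t) (g t) => [? ?] [].
apply: (eq_measurable_fun (fun t => complex.Im (f t) + complex.Im (g t)));
  last exact: measurable_funD.
by move=> t _; case: (f t) (g t) => [? ?] [].
Qed.

Lemma cmeasurableM f g : cmeasurable setT f -> cmeasurable setT g ->
  cmeasurable setT (fun t => f t * g t).
Proof.
move=> [fr fi] [gr gi]; split.
  apply: (eq_measurable_fun (fun t => complex.Re (f t) * complex.Re (g t) - complex.Im (f t) *
    complex.Im (g t))).
    by move=> t _; case: (f t) (g t) => [? ?] [].
  by apply: measurable_funB; exact: measurable_funM.
apply: (eq_measurable_fun (fun t => complex.Re (f t) * complex.Im (g t) + complex.Im (f t) *
  complex.Re (g t))).
  by move=> t _; case: (f t) (g t) => [? ?] [].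
by apply: measurable_funD; exact: measurable_funM.
Qed.

Lemma cmeasurable_cst (c : R[i]) : cmeasurable setT (fun _ : R => c).
Proof. by split; exact: measurable_cst. Qed.

Lemma cmeasurable_real w : measurable_fun setT w -> cmeasurable setT (fun t => (w t)%:C).
Proof. by move=> mw; split => //; exact: measurable_cst. Qed.

Lemma measurable_dotc f g : cmeasurable setT f -> cmeasurable setT g ->
  measurable_fun setT (fun t => dotc (f t) (g t)).
Proof.
by move=> [fr fi] [gr gi]; apply: measurable_funD; exact: measurable_funM.
Qed.

(** One L2 theory serves all the densities in play: the constant 1, the indicator of [-pi, pi], the
    transform of phi, its part outside that interval, and the kernels. *)
Definition weight w := measurable_fun setT w /\ forall t, 0 <= w t.

Definition L2w w f := cmeasurable setT f /\
  mu.-integrable setT (fun t => (w t * sqc (f t))%:E).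

Definition ip w f g : R := \int[mu]_t (w t * dotc (f t) (g t)).
Definition nrm w f : R := Num.sqrt (ip w f f).

Lemma integrable_le (F G : R -> R) : measurable_fun setT F ->
  (forall t, `|F t| <= G t) -> mu.-integrable setT (EFin \o G) ->
  mu.-integrable setT (EFin \o F).
Proof.
move=> mF FG iG; apply: (le_integrable _ _ _ iG) => //; first exact/measurable_EFinP.
move=> t _ /=; rewrite lee_fin (le_trans (FG t))// ler_norm//.
Qed.

Lemma integrableRD (F G : R -> R) : mu.-integrable setT (EFin \o F) ->
  mu.-integrable setT (EFin \o G) ->
  mu.-integrable setT (EFin \o (fun t => F t + G t)).
Proof. by move=> iF iG; exact: (integrableD measurableT iF iG). Qed.

Lemma integrableRB (F G : R -> R) : mu.-integrable setT (EFin \o F) ->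
  mu.-integrable setT (EFin \o G) ->
  mu.-integrable setT (EFin \o (fun t => F t - G t)).
Proof. by move=> iF iG; exact: (integrableB measurableT iF iG). Qed.

Lemma integrableRZ (a : R) (F : R -> R) : mu.-integrable setT (EFin \o F) ->
  mu.-integrable setT (EFin \o (fun t => a * F t)).
Proof. by move=> iF; exact: (integrableZl measurableT a iF). Qed.

Lemma ip_integrable w f g : weight w -> L2w w f -> L2w w g ->
  mu.-integrable setT (EFin \o (fun t => w t * dotc (f t) (g t))).
Proof.
move=> [mw w0] [mf If] [mg Ig].
apply: (@integrable_le _ (fun t => w t * sqc (f t) + w t * sqc (g t))).
- by apply: measurable_funM => //; exact: measurable_dotc.
- by move=> t; rewrite normrM ger0_norm// -mulrDr ler_wpM2l// normr_dotc_le.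
- exact: integrableRD.
Qed.

Lemma L2wD w f g : weight w -> L2w w f -> L2w w g -> L2w w (fun t => f t + g t).
Proof.
move=> [mw w0] [mf If] [mg Ig]; split; first exact: cmeasurableD.
apply: (@integrable_le _ (fun t => 2 * (w t * sqc (f t) + w t * sqc (g t)))).
- by apply: measurable_funM => //; apply: measurable_dotc; exact: cmeasurableD.
- move=> t; rewrite normrM ger0_norm// [X in _ * X]ger0_norm ?sqc_ge0//.
  by rewrite -mulrDr mulrCA ler_wpM2l// sqcD_le.
- by apply: integrableRZ; exact: integrableRD.
Qed.

Lemma L2wM w f g a : weight w -> cmeasurable setT g ->
  (forall t, sqc (g t) <= a) -> L2w w f -> L2w w (fun t => g t * f t).
Proof.
move=> [mw w0] mg ga [mf If]; split; first exact: cmeasurableM.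
apply: (@integrable_le _ (fun t => a * (w t * sqc (f t)))).
- by apply: measurable_funM => //; apply: measurable_dotc; exact: cmeasurableM.
- move=> t; rewrite normrM ger0_norm// ger0_norm ?sqc_ge0// sqcM mulrCA.
  by rewrite ler_wpM2r// mulr_ge0 ?sqc_ge0.
- exact: integrableRZ.
Qed.

Lemma L2wZ w f (c : R[i]) : weight w -> L2w w f -> L2w w (fun t => c * f t).
Proof. by move=> ww; apply: (@L2wM _ _ _ (sqc c)) => //; exact: cmeasurable_cst. Qed.

Lemma L2wB w f g : weight w -> L2w w f -> L2w w g -> L2w w (fun t => f t - g t).
Proof.
move=> ww Lf Lg; under eq_fun do rewrite -mulN1r.
by apply: L2wD => //; exact: L2wZ.
Qed.

Lemma ipC w f g : ip w f g = ip w g f.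
Proof. by apply: eq_Rintegral => t _; rewrite dotcC. Qed.

Lemma ipDl w f g h : weight w -> L2w w f -> L2w w g -> L2w w h ->
  ip w (fun t => f t + g t) h = ip w f h + ip w g h.
Proof.
move=> ww Lf Lg Lh; rewrite -RintegralD//; [|exact: ip_integrable..].
by apply: eq_Rintegral => t _; rewrite dotcDl mulrDr.
Qed.

Lemma ipBl w f g h : weight w -> L2w w f -> L2w w g -> L2w w h ->
  ip w (fun t => f t - g t) h = ip w f h - ip w g h.
Proof.
move=> ww Lf Lg Lh; rewrite -RintegralB//; [|exact: ip_integrable..].
by apply: eq_Rintegral => t _; rewrite dotcBl mulrBr.
Qed.

Lemma ipZl w f h a : weight w -> L2w w f -> L2w w h ->
  ip w (fun t => a%:C * f t) h = a * ip w f h.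
Proof.
move=> ww Lf Lh; rewrite -RintegralZl//; last exact: ip_integrable.
by apply: eq_Rintegral => t _; rewrite dotcZl mulrCA.
Qed.

Lemma ipDr w f g h : weight w -> L2w w f -> L2w w g -> L2w w h ->
  ip w h (fun t => f t + g t) = ip w h f + ip w h g.
Proof. by move=> ww Lf Lg Lh; rewrite ipC ipDl// ipC [ip w g h]ipC. Qed.

Lemma ipBr w f g h : weight w -> L2w w f -> L2w w g -> L2w w h ->
  ip w h (fun t => f t - g t) = ip w h f - ip w h g.
Proof. by move=> ww Lf Lg Lh; rewrite ipC ipBl// ipC [ip w g h]ipC. Qed.

Lemma ipZr w f h a : weight w -> L2w w f -> L2w w h ->
  ip w h (fun t => a%:C * f t) = a * ip w h f.
Proof. by move=> ww Lf Lh; rewrite ipC ipZl// ipC. Qed.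

Lemma ip_ge0 w f : weight w -> 0 <= ip w f f.
Proof.
by move=> [mw w0]; apply: Rintegral_ge0 => t _; rewrite mulr_ge0// sqc_ge0.
Qed.

Lemma L2w0 w : L2w w (fun _ => 0).
Proof.
split; first exact: cmeasurable_cst.
under eq_fun do rewrite /sqc /dotc /= mul0r addr0 mulr0.
exact: integrable0.
Qed.

Lemma L2w_sum w I (s : seq I) (F : I -> R -> R[i]) : weight w ->
  (forall i, L2w w (F i)) -> L2w w (fun t => \sum_(i <- s) F i t).
Proof.
move=> ww LF; elim: s => [|i s IH].
  by under eq_fun do rewrite big_nil; exact: L2w0.
by under eq_fun do rewrite big_cons; exact: L2wD.
Qed.

Lemma ip_suml w I (s : seq I) (F : I -> R -> R[i]) h : weight w ->
  (forall i, L2w w (F i)) -> L2w w h ->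
  ip w (fun t => \sum_(i <- s) F i t) h = \sum_(i <- s) ip w (F i) h.
Proof.
move=> ww LF Lh; elim: s => [|i s IH].
  rewrite big_nil /ip; under eq_Rintegral do rewrite big_nil /dotc /= !mul0r addr0 mulr0.
  by rewrite /Rintegral integral0.
rewrite big_cons -IH -ipDl//; last exact: L2w_sum.
by apply: eq_Rintegral => t _; rewrite big_cons.
Qed.

Lemma cauchy_schwarz_sqr w f g : weight w -> L2w w f -> L2w w g ->
  (ip w f g) ^+ 2 <= ip w f f * ip w g g.
Proof.
move=> ww Lf Lg.
have Q (a b : R) : 0 <= a ^+ 2 * ip w f f + (2 * a * b) * ip w f g + b ^+ 2 * ip w g g.
  have La := L2wZ a%:C ww Lf; have Lb := L2wZ b%:C ww Lg.
  have Lab := L2wD ww La Lb.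
  have := ip_ge0 (fun t => a%:C * f t + b%:C * g t) ww.
  rewrite ipDl// !ipDr// !ipZl// !ipZr// [ip w g f]ipC.
  by congr (_ <= _); ring.
(* At this point the quadratic form equals G * (F * G - X ^+ 2), which settles the case G > 0. The
   form at a = 1 is kept for G = 0, where it is affine in b. *)
have := Q (ip w g g) (- ip w f g); have {}Q := Q 1.
have := ip_ge0 f ww; have := ip_ge0 g ww.
move: (ip w f f) (ip w g g) (ip w f g) Q => F G X Q.
rewrite le_eqVlt => /orP[/eqP G0|G0] F0; last first.
  rewrite (_ : _ + _ = G * (F * G - X ^+ 2)); last by ring.
  by rewrite pmulr_rge0// subr_ge0.
move=> _; rewrite -G0 mulr0; have [->|X0] := eqVneq X 0; first by rewrite expr0n.
(* This b gives the affine form the value -1. *)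
have := Q (- (F + 1) / (2 * X)); rewrite -G0 mulr0 addr0.
rewrite (_ : _ + _ = -1); last by field.
by rewrite oppr_ge0 ler10.
Qed.

Lemma cauchy_schwarz w f g : weight w -> L2w w f -> L2w w g ->
  `|ip w f g| <= nrm w f * nrm w g.
Proof.
move=> ww Lf Lg; rewrite -sqrtrM ?ip_ge0// -sqrtr_sqr.
by rewrite ler_wsqrtr// cauchy_schwarz_sqr.
Qed.

Lemma nrm_ge0 w f : 0 <= nrm w f.
Proof. exact: sqrtr_ge0. Qed.

Lemma sqr_nrm w f : weight w -> nrm w f ^+ 2 = ip w f f.
Proof. by move=> ww; rewrite sqr_sqrtr// ip_ge0. Qed.

Lemma nrmD w f g : weight w -> L2w w f -> L2w w g ->
  nrm w (fun t => f t + g t) <= nrm w f + nrm w g.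
Proof.
move=> ww Lf Lg; rewrite -(@ler_pXn2r _ 2)// ?nnegrE ?addr_ge0 ?nrm_ge0//.
have Lfg := L2wD ww Lf Lg.
rewrite sqrrD !sqr_nrm// ipDl// !ipDr// [ip w g f]ipC.
have := cauchy_schwarz ww Lf Lg; have := ler_norm (ip w f g); lra.
Qed.

Lemma nrmB w f g : weight w -> L2w w f -> L2w w g ->
  nrm w (fun t => f t - g t) <= nrm w f + nrm w g.
Proof.
move=> ww Lf Lg; rewrite -(@ler_pXn2r _ 2)// ?nnegrE ?addr_ge0 ?nrm_ge0//.
have Lfg := L2wB ww Lf Lg.
rewrite sqrrD !sqr_nrm// ipBl// !ipBr// [ip w g f]ipC.
have := cauchy_schwarz ww Lf Lg; have := ler_norm (- ip w f g); rewrite normrN; lra.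
Qed.

End weighted_L2.

Section ae.
Variable R : realType.
Notation mu := (@lebesgue_measure R).

Lemma ae_imp (P Q : R -> Prop) : (forall t, P t -> Q t) ->
  {ae mu, forall t, P t} -> {ae mu, forall t, Q t}.
Proof.
move=> PQ [N [mN N0 NP]]; exists N; split => //.
by apply: subset_trans NP; apply: subsetC => t; exact: PQ.
Qed.

End ae.

(** * From extended-valued L2 norms to real weighted norms *)

Section L2norm_bridge.
Variable R : realType.
Notation mu := (@lebesgue_measure R).
Implicit Types (w : R -> R) (f g h : R -> R[i]) (D : set R).

Lemma weight_indic D : measurable D -> weight (\1_D : R -> R).
Proof. by move=> mD; split; [exact: measurable_indic|move=> t; rewrite indicE]. Qed.

Lemma weight1 : weight (fun _ : R => 1 : R).
Proof. by split; [exact: measurable_cst|move=> t; exact: ler01]. Qed.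

Lemma L2normE D g : L2norm D g =
  poweR (\int[mu]_t (\1_D t * sqc (g t))%:E) 2^-1.
Proof.
rewrite /L2norm unlock; congr poweR; apply: eq_integral => t _.
rewrite /patch indicE; case: (t \in D) => /=.
  rewrite mul1r sqcE powR_mulrn//.
  by rewrite real_normK// num_real.
by rewrite normr0 mul0r powR0.
Qed.

Lemma integral_ip w f : weight w -> L2w w f ->
  (\int[mu]_t (w t * sqc (f t))%:E = (ip w f f)%:E)%E.
Proof. by move=> ww [_ If]; rewrite fineK//; exact: integrable_fin_num. Qed.

Lemma L2norm_nrm D g : measurable D -> L2w \1_D g ->
  L2norm D g = (nrm \1_D g)%:E.
Proof.
move=> mD Lg; have wD := weight_indic mD.
by rewrite L2normE integral_ip// poweR_EFin powR12_sqrt// ip_ge0.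
Qed.

Lemma L2w_L2norm D g : measurable D -> cmeasurable setT g ->
  (L2norm D g < +oo)%E -> L2w \1_D g.
Proof.
move=> mD mg; rewrite L2normE => oo; split => //.
apply/integrableP; split.
  apply/measurable_EFinP; apply: measurable_funM; first exact: measurable_indic.
  exact: measurable_dotc.
under eq_integral.
  move=> t _; rewrite gee0_abs; first over.
  by rewrite lee_fin mulr_ge0 ?sqc_ge0// indicE.
by apply: lty_poweRy oo; rewrite invr_eq0.
Qed.

Lemma L2w_sub w w' f : weight w -> weight w' -> (forall t, w t <= w' t) ->
  L2w w' f -> L2w w f.
Proof.
move=> [mw w0] [mw' w0'] ww' [mf If]; split => //.
apply: (@integrable_le _ _ (fun t => w' t * sqc (f t))) => //.
  by apply: measurable_funM => //; exact: measurable_dotc.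
by move=> t; rewrite normrM ger0_norm// ger0_norm ?sqc_ge0// ler_wpM2r ?sqc_ge0.
Qed.

Lemma in_L2_L2w D g : measurable D -> in_L2 setT g -> L2w \1_D g.
Proof.
move=> mD [mg oo].
apply: (@L2w_sub _ \1_[set: R]).
- exact: weight_indic.
- by apply: weight_indic; exact: measurableT.
- by move=> t; rewrite !indicE in_setT; case: (_ \in _); rewrite /= ?lexx ?ler01.
- exact: L2w_L2norm.
Qed.

Lemma L2w_cst1 f : L2w (\1_[set: R] : R -> R) f -> L2w (fun=> 1) f.
Proof.
apply: L2w_sub; first exact: weight1.
  by apply: weight_indic; exact: measurableT.
by move=> t; rewrite indicE in_setT.
Qed.

Lemma le_RintegralT (F G : R -> R) : mu.-integrable setT (EFin \o F) ->
  mu.-integrable setT (EFin \o G) -> (forall t, F t <= G t) ->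
  \int[mu]_t F t <= \int[mu]_t G t.
Proof. by move=> iF iG FG; apply: le_Rintegral => //. Qed.

Lemma ip_sub w w' f : weight w -> weight w' -> (forall t, w t <= w' t) ->
  L2w w' f -> ip w f f <= ip w' f f.
Proof.
move=> ww ww' le Lf; apply: le_RintegralT; [|exact: ip_integrable|].
  by apply: ip_integrable => //; exact: L2w_sub Lf.
by move=> t; rewrite ler_wpM2r// sqc_ge0.
Qed.

Lemma ipZw (a : R) w f g : weight w -> L2w w f -> L2w w g ->
  ip (fun t => a * w t) f g = a * ip w f g.
Proof.
move=> ww Lf Lg; rewrite -RintegralZl//; last exact: ip_integrable.
by apply: eq_Rintegral => t _; rewrite mulrA.
Qed.

Lemma weightM w w' : weight w -> weight w' -> weight (fun t => w t * w' t).
Proof.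
move=> [mw w0] [mw' w0']; split; first exact: measurable_funM.
by move=> t; rewrite mulr_ge0.
Qed.

Lemma weightZ (a : R) w : 0 <= a -> weight w -> weight (fun t => a * w t).
Proof.
move=> a0 [mw w0]; split; first by apply: measurable_funM => //; exact: measurable_cst.
by move=> t; rewrite mulr_ge0.
Qed.

Lemma L2w_bounded w f (a : R) : weight w -> mu.-integrable setT (EFin \o w) ->
  cmeasurable setT f -> (forall t, sqc (f t) <= a) -> L2w w f.
Proof.
move=> [mw w0] iw mf fa; split => //.
apply: (@integrable_le _ _ (fun t => a * w t)); last exact: integrableRZ.
  by apply: measurable_funM => //; exact: measurable_dotc.
by move=> t; rewrite normrM ger0_norm// ger0_norm ?sqc_ge0// mulrC ler_wpM2r.
Qed.

Lemma nrm_bounded w f (a : R) : weight w -> mu.-integrable setT (EFin \o w) ->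
  cmeasurable setT f -> (forall t, sqc (f t) <= a) ->
  ip w f f <= a * \int[mu]_t w t.
Proof.
move=> ww iw mf fa; rewrite -RintegralZl//; apply: le_RintegralT.
- by apply: ip_integrable => //; exact: L2w_bounded fa.
- exact: integrableRZ.
by case: ww => _ w0 t; rewrite mulrC; exact: ler_wpM2r (w0 t) _ _ (fa t).
Qed.

End L2norm_bridge.

(** * The Poisson and sinc kernels *)

Section kernels.
Variable R : realType.
Notation mu := (@lebesgue_measure R).

(** The improper fundamental theorem of calculus on the half-line, doubled by symmetry. The
    antiderivative belongs to g, which agrees with f for x >= 0 only: f may then contain an absolute
    value. *)
Lemma even_integral (f g F : R -> R) (l : R) : (forall x, 0 <= f x) ->
  continuous f -> (forall x, f (- x) = f x) -> (forall x, 0 <= x -> f x = g x) ->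
  (forall x : R, is_derive x 1 F (g x)) -> F x @[x --> +oo] --> l ->
  mu.-integrable setT (EFin \o f) /\ \int[mu]_x f x = 2 * (l - F 0).
Proof.
move=> f0 cf ef fg dF Fl.
have mf : measurable_fun setT f by exact: continuous_measurable_fun.
have E : (\int[mu]_x (f x)%:E = (2 * (l - F 0))%:E)%E.
  rewrite ge0_symfun_integralT//; last by move=> x /=; rewrite ef.
  rewrite -set_itvcy (@ge0_continuous_FTC2y _ f F 0 l)//.
  - by apply: continuous_subspaceT.
  - by apply: cvg_at_right_filter; apply: differentiable_continuous; apply/derivable1_diffP.
  - move=> x; rewrite in_itv/= andbT => x0; rewrite derive1E derive_val fg//; exact: ltW.
split; last by rewrite /Rintegral E.
apply/integrableP; split; first exact/measurable_EFinP.
under eq_integral do rewrite /= ger0_norm//.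
by rewrite E ltry.
Qed.

(** The cosine transform of exp(-e |t|). Its mass is 2 pi for every e, which the square of [kappa]
    cancels. *)
Definition poisson_kernel (e x : R) : R := 2 * e / (e ^+ 2 + x ^+ 2).

Lemma poisson_kernel_den (e x : R) : 0 < e -> 0 < e ^+ 2 + x ^+ 2.
Proof. by move=> e0; rewrite ltr_pwDl ?exprn_gt0 ?sqr_ge0. Qed.

Lemma poisson_kernel_ge0 (e x : R) : 0 < e -> 0 <= poisson_kernel e x.
Proof. by move=> e0; rewrite divr_ge0 ?mulr_ge0 ?(ltW e0)// ltW// poisson_kernel_den. Qed.

Lemma continuous_poisson_kernel (e : R) : 0 < e -> continuous (poisson_kernel e).
Proof.
move=> e0 x; apply: cvgM; first exact: cvg_cst.
apply: cvgV; first by rewrite gt_eqF// poisson_kernel_den.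
by apply: cvgD; [exact: cvg_cst|exact: exprn_continuous].
Qed.

Lemma integral_poisson_kernel (e : R) : 0 < e ->
  mu.-integrable setT (EFin \o poisson_kernel e) /\ \int[mu]_x poisson_kernel e x = 2 * pi.
Proof.
move=> e0.
have := @even_integral (poisson_kernel e) (poisson_kernel e) (fun x => 2 * atan (e^-1 * x)) pi.
rewrite mulr0 atan0 mulr0 subr0; apply => //.
- by move=> x; exact: poisson_kernel_ge0.
- exact: continuous_poisson_kernel.
- by move=> x; rewrite /poisson_kernel sqrrN.
- move=> x; apply: is_derive_eq.
  rewrite /GRing.scale /= /poisson_kernel; field; rewrite !gt_eqF//= ?poisson_kernel_den//.
- rewrite [X in _ --> X](_ : pi = 2 * (pi / 2)); last by field.
  apply: cvgM; first exact: cvg_cst.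
  apply: (@cvg_comp _ _ _ _ _ _ (pinfty_nbhs R)); last exact: cvgy_atan.
  by apply: gt0_cvgMry; [rewrite invr_gt0|exact: cvg_id].
Qed.

(** The Abel convergence factor: integrable, at most 1, and tending to 1 pointwise as e tends to
    0. *)
Definition exp_kernel (e x : R) : R := expR (- (e * `|x|)).

Lemma continuous_exp_kernel (e : R) : continuous (exp_kernel e).
Proof.
move=> x; apply: continuous_comp; last exact: continuous_expR.
by apply: cvgN; apply: cvgM; [exact: cvg_cst|exact: norm_continuous].
Qed.

(* The improper fundamental theorem of calculus needs a nonnegative integrand,
   whence the summand 1. *)
Lemma integral_exp_kernel_cos (e s : R) : 0 < e ->
  mu.-integrable setT (EFin \o (fun x => exp_kernel e x * (1 + cos (s * x)))) /\
  \int[mu]_x (exp_kernel e x * (1 + cos (s * x))) = 2 / e + poisson_kernel e s.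
Proof.
move=> e0.
have D0 : e ^+ 2 + s ^+ 2 != 0 by rewrite gt_eqF// poisson_kernel_den.
(* An antiderivative of exp(-e x) (1 + cos(s x)), found by two integrations by parts. *)
pose F x := expR ((- e) * x) * (- e^-1 + (e ^+ 2 + s ^+ 2)^-1 * (s * sin (s * x) - e * cos (s *
  x))).
have -> : 2 / e + poisson_kernel e s = 2 * (0 - F 0).
  by rewrite /F /poisson_kernel !mulr0 expR0 sin0 cos0; field; rewrite D0 gt_eqF.
apply: (@even_integral _ (fun x => expR ((- e) * x) * (1 + cos (s * x)))) => //.
- move=> x; rewrite mulr_ge0// ?expR_ge0//; have := cos_geN1 (s * x); lra.
- move=> x; apply: cvgM; first exact: continuous_exp_kernel.
  apply: cvgD; first exact: cvg_cst.
  apply: continuous_comp; last exact: continuous_cos.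
  by apply: cvgM; [exact: cvg_cst|exact: cvg_id].
- by move=> x; rewrite /exp_kernel normrN mulrN cosN.
- by move=> x x0; rewrite /exp_kernel ger0_norm// mulNr.
- move=> x; apply: is_derive_eq.
  rewrite /GRing.scale /=; field; by rewrite D0 gt_eqF.
- pose H := e^-1 + (e ^+ 2 + s ^+ 2)^-1 * (`|s| + e).
  have Fle x : `|F x| <= H * expR (- (e * x)).
    rewrite /F normrM ger0_norm ?expR_ge0// mulNr [leLHS]mulrC ler_wpM2r ?expR_ge0//.
    have ei0 : 0 <= e^-1 by rewrite invr_ge0 ltW.
    have Di0 : 0 <= (e ^+ 2 + s ^+ 2)^-1 by rewrite invr_ge0 ltW// poisson_kernel_den.
    rewrite (le_trans (ler_normD _ _))// /H normrN (ger0_norm ei0) lerD2l.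
    rewrite normrM (ger0_norm Di0) ler_wpM2l//.
    rewrite (le_trans (ler_normB _ _))// !normrM lerD//.
      by rewrite -[leRHS]mulr1 ler_wpM2l// sin_max.
    by rewrite (gtr0_norm e0) -[leRHS]mulr1 ler_wpM2l ?(ltW e0)// cos_max.
  have G0 : H * expR (- (e * x)) @[x --> +oo] --> 0.
    rewrite -[X in _ --> X](mulr0 H); apply: cvgM; first exact: cvg_cst.
    apply: (@cvg_comp _ _ _ (fun x => e * x) (fun x => expR (- x)) _ (pinfty_nbhs R));
      last exact: cvgr_expR.
    by apply: gt0_cvgMry => //; exact: cvg_id.
  apply: norm_cvg0; apply: (@squeeze_cvgr _ _ _ _ (cst 0) (fun x => H * expR (- (e * x)))) =>
    //; last exact: cvg_cst.
  by near=> x; rewrite normr_ge0 Fle.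
Unshelve. all: by end_near. Qed.

Lemma integrable_exp_kernel (e : R) : 0 < e -> mu.-integrable setT (EFin \o exp_kernel e).
Proof.
(* For s = 0 the integrand is twice the kernel. *)
move=> e0; have [I _] := integral_exp_kernel_cos 0 e0.
have := integrableRZ 2^-1 I; apply: eq_integrable => // x _ /=.
by rewrite mul0r cos0; congr EFin; field.
Qed.

Lemma exp_kernel_gt0 (e x : R) : 0 < exp_kernel e x. Proof. exact: expR_gt0. Qed.

Lemma exp_kernel_le1 (e x : R) : 0 < e -> exp_kernel e x <= 1.
Proof. by move=> e0; rewrite /exp_kernel -expR0 ler_expR oppr_le0 mulr_ge0// ltW. Qed.

Lemma weight_exp_kernel (e : R) : weight (exp_kernel e).
Proof.
split; last by move=> x; rewrite ltW// exp_kernel_gt0.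
by apply: continuous_measurable_fun; exact: continuous_exp_kernel.
Qed.

Lemma weight_poisson_kernel (e : R) : 0 < e -> weight (poisson_kernel e).
Proof.
move=> e0; split; last by move=> x; rewrite poisson_kernel_ge0.
by apply: continuous_measurable_fun; exact: continuous_poisson_kernel.
Qed.

Lemma integrable_wM (w g : R -> R) : weight w -> mu.-integrable setT (EFin \o w) ->
  measurable_fun setT g -> (forall x, `|g x| <= 1) ->
  mu.-integrable setT (EFin \o (fun x => w x * g x)).
Proof.
move=> [mw w0] iw mg g1; apply: (@integrable_le _ _ w) => //.
  exact: measurable_funM.
by move=> x; rewrite normrM (ger0_norm (w0 x)) ler_piMr.
Qed.

Lemma measurable_cosM (s : R) : measurable_fun setT (fun x : R => cos (s * x)).
Proof.
apply: continuous_measurable_fun => x; apply: continuous_comp; last exact: continuous_cos.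
by apply: cvgM; [exact: cvg_cst|exact: cvg_id].
Qed.

Lemma measurable_sinM (s : R) : measurable_fun setT (fun x : R => sin (s * x)).
Proof.
apply: continuous_measurable_fun => x; apply: continuous_comp; last exact: continuous_sin.
by apply: cvgM; [exact: cvg_cst|exact: cvg_id].
Qed.

Lemma exp_kernel_cos (e s : R) : 0 < e -> \int[mu]_x (exp_kernel e x * cos (s * x)) =
  poisson_kernel e s.
Proof.
move=> e0; have [I0 E0] := integral_exp_kernel_cos 0 e0;
  have [I E] := integral_exp_kernel_cos s e0.
have Ik := integrable_exp_kernel e0.
have D : \int[mu]_x exp_kernel e x = 2 / e.
  rewrite (_ : 2 / e = 2^-1 * (2 / e + poisson_kernel e 0)); last first.
    by rewrite /poisson_kernel; field; rewrite gt_eqF//= expr0n addr0 expf_neq0// gt_eqF.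
  rewrite -E0 -RintegralZl//; apply: eq_Rintegral => x _.
  by rewrite mul0r cos0; field.
have := E; under eq_Rintegral do rewrite mulrDr mulr1.
rewrite RintegralD// ?D; first by move/addrI.
by apply: integrable_wM => //; [exact: weight_exp_kernel|exact: measurable_cosM|move=> x;
  exact: cos_max].
Qed.

Lemma integral_half (G : R -> R) : (forall x, 0 <= G x) -> continuous G ->
  (\int[mu]_x (G x)%:E = \int[mu]_(x in `[0%R, +oo[) (G x)%:E +
    \int[mu]_(x in `[0%R, +oo[) (G (- x)%R)%:E)%E.
Proof.
move=> G0 cG.
have mG : measurable_fun [set: R] G by exact: continuous_measurable_fun.
have mposnums : measurable [set x : R | 0 <= x]%R by rewrite -set_itvcy.
rewrite -(setUv [set x : R | 0 <= x]%R) ge0_integral_setU//= ; last 4 first.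
  exact: measurableC.
  by apply/measurable_EFinP; rewrite setUv.
  by move=> x _; rewrite lee_fin.
  exact/disj_setPCl.
rewrite -set_itvcy//; congr +%E; rewrite setCitvr.
rewrite integral_itv_bndo_bndc; last exact/measurable_EFinP/measurable_funTS.
rewrite -{1}oppr0 ge0_integration_by_substitutionNy//.
exact: continuous_subspaceT.
Qed.

(** Reflection exchanges the two half-line integrals of [integral_half]. *)
Lemma integral_reflect (G : R -> R) : (forall x, 0 <= G x) -> continuous G ->
  \int[mu]_x G (- x) = \int[mu]_x G x.
Proof.
move=> G0 cG; rewrite /Rintegral [in RHS]integral_half// integral_half//.
  by under [X in (_ + X)%E]eq_integral do rewrite opprK; rewrite addeC.
by move=> x; apply: continuous_comp; [exact: opp_continuous|exact: cG].
Qed.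

(** The sine is odd, but [integral_reflect] wants a nonnegative integrand, so it is applied to 1 +
    sin. The two sides then differ only in the sign of the sine integral. *)
Lemma exp_kernel_sin (e s : R) : 0 < e -> \int[mu]_x (exp_kernel e x * sin (s * x)) = 0.
Proof.
move=> e0; have Ik := integrable_exp_kernel e0.
have Is : mu.-integrable setT (EFin \o (fun x => exp_kernel e x * sin (s * x))).
  by apply: integrable_wM => //; [exact: weight_exp_kernel|exact: measurable_sinM|move=> x;
    exact: sin_max].
have A : \int[mu]_x (exp_kernel e x * (1 + sin (s * x))) =
    \int[mu]_x exp_kernel e x + \int[mu]_x (exp_kernel e x * sin (s * x)).
  by rewrite -RintegralD//; apply: eq_Rintegral => x _; rewrite mulrDr mulr1.
have B : \int[mu]_x (exp_kernel e (- x) * (1 + sin (s * - x))) =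
    \int[mu]_x exp_kernel e x - \int[mu]_x (exp_kernel e x * sin (s * x)).
  rewrite -RintegralB//; apply: eq_Rintegral => x _.
  by rewrite mulrN sinN mulrBr mulr1 /exp_kernel normrN.
have : \int[mu]_x (exp_kernel e (- x) * (1 + sin (s * - x))) =
    \int[mu]_x (exp_kernel e x * (1 + sin (s * x))).
  apply: (@integral_reflect (fun x => exp_kernel e x * (1 + sin (s * x)))) => x.
    by rewrite mulr_ge0 ?(ltW (exp_kernel_gt0 _ _))//; have := sin_geN1 (s * x); lra.
  apply: cvgM; first exact: continuous_exp_kernel.
  apply: cvgD; first exact: cvg_cst.
  apply: continuous_comp; last exact: continuous_sin.
  by apply: cvgM; [exact: cvg_cst|exact: cvg_id].
by rewrite A B; lra.
Qed.

Lemma itv_integral (g F : R -> R) (a b : R) : a < b -> continuous g ->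
  (forall x : R, is_derive x 1 F (g x)) ->
  \int[mu]_x (\1_`[a, b]%classic x * g x) = F b - F a.
Proof.
move=> ab cg dF.
have cF : continuous F.
  by move=> x; apply: differentiable_continuous; apply/derivable1_diffP.
transitivity (\int[mu]_(x in `[a, b]) g x).
  rewrite [RHS]Rintegral_mkcond; apply: eq_Rintegral => x _.
  by rewrite /patch indicE; case: ifP => _; rewrite ?mul1r ?mul0r.
rewrite /Rintegral (@continuous_FTC2 _ g F)//.
- exact: continuous_subspaceT.
- split; first by move=> x _.
  + by apply: cvg_at_right_filter; exact: cF.
  + by apply: cvg_at_left_filter; exact: cF.
- by move=> x _; rewrite derive1E derive_val.
Qed.

Lemma measurable_Ipi : measurable (Ipi R).
Proof. exact: measurable_itv. Qed.

(** For s nonzero this is 2 sin(pi s) / s. *)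
Definition sincint (s : R) : R := \int[mu]_x (\1_(Ipi R) x * cos (s * x)).

Lemma integrable_Ipi : mu.-integrable setT (EFin \o (\1_(Ipi R) : R -> R)).
Proof. exact: integrable_indic_itv. Qed.

Lemma weight_Ipi : weight (\1_(Ipi R) : R -> R).
Proof. by apply: weight_indic; exact: measurable_Ipi. Qed.

Lemma integral_Ipi : \int[mu]_x (\1_(Ipi R) x : R) = 2 * pi.
Proof.
have := @itv_integral (cst 1) id (- pi) pi.
under eq_Rintegral do rewrite mulr1.
move=> ->.
- by rewrite opprK mulr2n mulrDl mul1r.
- by rewrite gtrN// pi_gt0.
- by move=> x; exact: cvg_cst.
Qed.

Lemma Ipi_sin (s : R) : \int[mu]_x (\1_(Ipi R) x * sin (s * x)) = 0.
Proof.
have [->|s0] := eqVneq s 0.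
  under eq_Rintegral do rewrite mul0r sin0 mulr0.
  by rewrite /Rintegral integral0.
have dF (x : R) : is_derive x 1 (fun x => - s^-1 * cos (s * x)) (sin (s * x)).
  by apply: is_derive_eq; rewrite /GRing.scale /=; field.
rewrite (@itv_integral _ (fun x => - s^-1 * cos (s * x)))//.
- by rewrite mulrN cosN subrr.
- by rewrite gtrN// pi_gt0.
- move=> x; apply: continuous_comp; last exact: continuous_sin.
  by apply: cvgM; [exact: cvg_cst|exact: cvg_id].
Qed.

(** The sum of |sincint s| <= 2 pi and |s * sincint s| <= 2, both squared. It puts the square of the
    sinc kernel below a multiple of [poisson_kernel 1], hence makes the sinc kernel square
    integrable. *)
Lemma sincint_le (s : R) : (1 + s ^+ 2) * sincint s ^+ 2 <= 4 * pi ^+ 2 + 4.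
Proof.
rewrite mulrDl mul1r; apply: lerD.
  rewrite (_ : 4 * pi ^+ 2 = (2 * pi) ^+ 2 :> R); last by ring.
  rewrite -[X in X <= _]real_normK ?num_real// lerXn2r ?nnegrE// ?mulr_ge0 ?pi_ge0//.
  have I : mu.-integrable setT (EFin \o (fun x => \1_(Ipi R) x * cos (s * x))).
    apply: integrable_wM; [exact: weight_Ipi|exact: integrable_Ipi|exact: measurable_cosM|move=>
      x; exact: cos_max].
  rewrite (le_trans (le_normr_Rintegral _ I))// -integral_Ipi; apply: le_RintegralT.
  - exact: integrable_norm.
  - exact: integrable_Ipi.
  - by move=> x; rewrite normrM indicE ger0_norm// ler_piMr// cos_max.
have [->|s0] := eqVneq s 0; first by rewrite expr0n mul0r.
have dF (x : R) : is_derive x 1 (fun x => s^-1 * sin (s * x)) (cos (s * x)).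
  by apply: is_derive_eq; rewrite /GRing.scale /=; field.
rewrite /sincint (@itv_integral _ (fun x => s^-1 * sin (s * x)))//.
- rewrite mulrN sinN -exprMn.
  rewrite (_ : s * (s^-1 * sin (s * pi) - s^-1 * - sin (s * pi)) = 2 * sin (s * pi));
    last by field.
  rewrite exprMn (_ : 2 ^+ 2 = 4 :> R); last by ring.
  by rewrite -[leRHS]mulr1 ler_pM2l//.
- by rewrite gtrN// pi_gt0.
- move=> x; apply: continuous_comp; last exact: continuous_cos.
  by apply: cvgM; [exact: cvg_cst|exact: cvg_id].
Qed.

End kernels.

(** * Fourier inversion *)

Section parameter_integrals.
Variable R : realType.
Notation mu := (@lebesgue_measure R).

(** Tonelli's theorem makes the integrals of the positive and negative parts measurable; their
    difference is composed with [fine]. *)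
Lemma measurable_param (F : R * R -> R) : measurable_fun setT F ->
  measurable_fun setT (fun x => \int[mu]_y F (x, y)).
Proof.
move=> mF; have mE : measurable_fun setT (EFin \o F) by exact/measurable_EFinP.
have A1 := @measurable_fun_fubini_tonelli_F _ _ _ _ _ mu _ (measurable_funepos mE)
  (fun z => funepos_ge0 _ z).
have A2 := @measurable_fun_fubini_tonelli_F _ _ _ _ _ mu _ (measurable_funeneg mE)
  (fun z => funeneg_ge0 _ z).
apply: (measurableT_comp (@fine_measurable R setT measurableT)).
apply: eq_measurable_fun (emeasurable_funB A1 A2) => x _; rewrite [RHS]integralE /=.
by congr (_ - _)%E; apply: eq_integral => y _; rewrite ?funeposE ?funenegE.
Qed.

Lemma Rintegral_Fubini (F : R * R -> R) :
  (mu \x mu)%E.-integrable setT (EFin \o F) ->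
  (forall x, mu.-integrable setT (EFin \o (fun y => F (x, y)))) ->
  (forall y, mu.-integrable setT (EFin \o (fun x => F (x, y)))) ->
  \int[mu]_x \int[mu]_y F (x, y) = \int[mu]_y \int[mu]_x F (x, y).
Proof.
move=> IF I1 I2; rewrite /Rintegral; congr fine.
transitivity (\int[mu]_x \int[mu]_y (EFin \o F) (x, y))%E.
  apply: eq_integral => x _; rewrite fineK//.
  by have := integrable_fin_num measurableT (I1 x).
rewrite Fubini//; apply: eq_integral => x _; rewrite fineK//.
by have := integrable_fin_num measurableT (I2 x).
Qed.

End parameter_integrals.

(** * The multiplication formula for integrable functions *)

Section fourier_multiplication.
Variable R : realType.
Notation mu := (@lebesgue_measure R).
Implicit Types (u : R -> R[i]) (d : R[i]) (k : R -> R).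

Definition kappa : R := (Num.sqrt (2 * pi))^-1.

Lemma twopi_gt0 : 0 < 2 * pi :> R.
Proof. by rewrite mulr_gt0// pi_gt0. Qed.

Lemma kappa_gt0 : 0 < kappa.
Proof. by rewrite invr_gt0 sqrtr_gt0 twopi_gt0. Qed.

Lemma kappa_sqr : kappa ^+ 2 * (2 * pi) = 1.
Proof.
by rewrite exprVn sqr_sqrtr ?mulVf// ?gt_eqF ?twopi_gt0// ltW// twopi_gt0.
Qed.

(** [in_L1] treats real and imaginary parts separately, so this norm is the majorant it provides
    directly. *)
Definition norm1c (z : R[i]) : R := `|complex.Re z| + `|complex.Im z|.

Lemma dotc_le_norm1c (z d : R[i]) : `|dotc z d| <= norm1c z * norm1c d.
Proof.
case: z d => [a b] [x y]; rewrite /dotc /norm1c /=.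
rewrite (le_trans (ler_normD _ _))// !normrM mulrDl !mulrDr.
rewrite -addrA lerD2l addrA lerDr addr_ge0// mulr_ge0//.
Qed.

(** Only the difference of the two frequencies enters, through a cosine and a sine. Integration in
    xi against an even weight removes the sine and leaves a cosine transform. *)
Lemma dotc_twist (z d : R[i]) (y t xi : R) :
  dotc (z * expi (- (y * xi))) (d * expi (- (t * xi))) =
  cos ((y - t) * xi) * dotc z d + sin ((y - t) * xi) * dotc z ('i%C * d).
Proof.
have -> : expi (- (y * xi)) = expi (- ((y - t) * xi)) * expi (- (t * xi)).
  by rewrite -expiD; congr expi; ring.
rewrite mulrA dotc_expi; case: z d => [a b] [p q].
by rewrite /dotc /= cosN sinN; ring.
Qed.

Lemma dotc_twist_le (z d : R[i]) (y t xi : R) :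
  `|dotc (z * expi (- (y * xi))) (d * expi (- (t * xi)))| <= 2 * norm1c z * norm1c d.
Proof.
rewrite dotc_twist (le_trans (ler_normD _ _))// !normrM.
rewrite (_ : 2 * norm1c z * norm1c d = norm1c z * norm1c d + norm1c z * norm1c d); last by ring.
have E : norm1c ('i%C * d) = norm1c d.
  by case: d => a b; rewrite /norm1c /= !mul0r !mul1r sub0r normrN add0r addrC.
apply: lerD.
  by rewrite (le_trans _ (dotc_le_norm1c z d))// ler_piMl// cos_max.
have := dotc_le_norm1c z ('i%C * d); rewrite E => h.
by rewrite (le_trans _ h)// ler_piMl// sin_max.
Qed.

Lemma integrable_norm1c u : in_L1 u -> mu.-integrable setT (EFin \o (fun t => norm1c (u t))).
Proof. by move=> [Ir Ii]; apply: integrableRD; exact: integrable_norm. Qed.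

Lemma cmeasurable_L1 u : in_L1 u -> cmeasurable setT u.
Proof.
by move=> [/integrableP[/measurable_EFinP ? _] /integrableP[/measurable_EFinP ? _]].
Qed.

Lemma measurable_expi (f : R -> R) : measurable_fun setT f ->
  cmeasurable setT (fun t => expi (f t)).
Proof.
move=> mf; split; apply: measurableT_comp => //; apply: continuous_measurable_fun.
  exact: continuous_cos.
exact: continuous_sin.
Qed.

Lemma cmeasurable_node d (t : R) : cmeasurable setT (fun xi => d * expi (- (t * xi))).
Proof.
apply: cmeasurableM; first exact: cmeasurable_cst.
by apply: measurable_expi; apply: measurable_funN; exact: measurable_funM.
Qed.

Lemma integrable_twist u d (xi : R) : in_L1 u ->
  mu.-integrable setT (EFin \o (fun y => dotc (u y * expi (- (y * xi))) d)).
Proof.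
move=> Lu; apply: (@integrable_le _ _ (fun y => 2 * norm1c (u y) * norm1c d)).
- apply: measurable_dotc; last exact: cmeasurable_cst.
  apply: cmeasurableM; first exact: cmeasurable_L1.
  by apply: measurable_expi; apply: measurable_funN; exact: measurable_funM.
- move=> y; have := dotc_twist_le (u y) d y 0 xi.
  by rewrite mul0r oppr0 (_ : expi 0 = 1) ?mulr1// /expi cos0 sin0.
- have := integrableRZ (2 * norm1c d) (integrable_norm1c Lu).
  by apply: eq_integrable => // y _ /=; congr EFin; ring.
Qed.

Lemma dotc_fourier u d (xi : R) : in_L1 u ->
  dotc (fourier u xi) d = kappa * \int[mu]_y dotc (u y * expi (- (y * xi))) d.
Proof.
move=> Lu; rewrite /fourier dotcZl; congr (_ * _).
have Ir := integrable_twist 1 xi Lu; have Ii := integrable_twist 'i%C xi Lu.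
have {}Ir : mu.-integrable setT (EFin \o (fun y => complex.Re (u y * expi (- (y * xi))))).
  by apply: eq_integrable Ir => // y _; rewrite /dotc /= mulr0 mulr1 addr0.
have {}Ii : mu.-integrable setT (EFin \o (fun y => complex.Im (u y * expi (- (y * xi))))).
  by apply: eq_integrable Ii => // y _; rewrite /dotc /= mulr0 mulr1 add0r.
rewrite [LHS]/dotc /=.
rewrite -RintegralZr// -RintegralZr// -RintegralD//.
- have := integrableRZ (complex.Re d) Ir.
  by apply: eq_integrable => // y _ /=; rewrite mulrC.
- have := integrableRZ (complex.Im d) Ii.
  by apply: eq_integrable => // y _ /=; rewrite mulrC.
Qed.

Definition fourier_bound u : R := kappa * (2 * \int[mu]_y norm1c (u y)).

Lemma dotc_fourier_le u d (xi : R) : in_L1 u -> `|dotc (fourier u xi) d| <= fourier_bound u *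
  norm1c d.
Proof.
move=> Lu; rewrite dotc_fourier// normrM (gtr0_norm kappa_gt0) /fourier_bound -mulrA ler_pM2l
  ?kappa_gt0//.
have I := integrable_twist d xi Lu.
rewrite (le_trans (le_normr_Rintegral _ I))//.
rewrite mulrAC -RintegralZl//; last exact: integrable_norm1c.
apply: le_RintegralT.
- exact: integrable_norm.
- by apply: integrableRZ; exact: integrable_norm1c.
move=> y; have := dotc_twist_le (u y) d y 0 xi.
by rewrite mul0r oppr0 (_ : expi 0 = 1) ?mulr1 ?[2 * norm1c d * _]mulrAC// /expi cos0 sin0.
Qed.

Lemma sqc_fourier_le u (xi : R) : in_L1 u -> sqc (fourier u xi) <= 2 * fourier_bound u ^+ 2.
Proof.
move=> Lu; have := dotc_fourier_le 1 xi Lu; have := dotc_fourier_le 'i%C xi Lu.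
case: (fourier u xi) => a b; rewrite /norm1c /sqc /dotc /=.
rewrite !mulr0 !mulr1 !normr0 !normr1 !addr0 !add0r mulr1.
rewrite !ler_norml => /andP[? ?] /andP[? ?]; rewrite expr2; nra.
Qed.

Lemma measurable_twist u d (t : R) : cmeasurable setT u ->
  measurable_fun setT (fun p : R * R =>
    dotc (u p.2 * expi (- (p.2 * p.1))) (d * expi (- (t * p.1)))).
Proof.
move=> mu_.
have msnd d' : measurable_fun setT (fun p : R * R => dotc (u p.2) d').
  apply: (measurableT_comp (measurable_dotc mu_ (cmeasurable_cst d'))).
  exact: measurable_snd.
have mlin : measurable_fun setT (fun p : R * R => (p.2 - t) * p.1).
  apply: measurable_funM; last exact: measurable_fst.
  by apply: measurable_funB; [exact: measurable_snd|exact: measurable_cst].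
under eq_fun do rewrite dotc_twist.
apply: measurable_funD; apply: measurable_funM => //; apply: measurableT_comp => //.
  by apply: continuous_measurable_fun; exact: continuous_cos.
by apply: continuous_measurable_fun; exact: continuous_sin.
Qed.

Lemma cmeasurable_fourier u : in_L1 u -> cmeasurable setT (fourier u).
Proof.
move=> Lu.
have H d : measurable_fun setT (fun xi => dotc (fourier u xi) d).
  under eq_fun do rewrite dotc_fourier//.
  apply: measurable_funM => //.
  have := measurable_param (measurable_twist d 0 (cmeasurable_L1 Lu)).
  apply: eq_measurable_fun => xi _; apply: eq_Rintegral => y _ /=.
  by rewrite mul0r oppr0 (_ : expi 0 = 1) ?mulr1// /expi cos0 sin0.
split.
- apply: eq_measurable_fun (H 1) => xi _.
  by rewrite /dotc /= mulr1 mulr0 addr0.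
- apply: eq_measurable_fun (H 'i%C) => xi _.
  by rewrite /dotc /= mulr1 mulr0 add0r.
Qed.

Definition cos_transform k (s : R) : R := \int[mu]_x (k x * cos (s * x)).

Lemma L2w_fourier u k : in_L1 u -> weight k -> mu.-integrable setT (EFin \o k) ->
  L2w k (fourier u).
Proof.
move=> Lu wk Ik; apply: (@L2w_bounded _ _ _ (2 * fourier_bound u ^+ 2)) => //.
  exact: cmeasurable_fourier.
by move=> t; exact: sqc_fourier_le.
Qed.

(* The multiplication formula against k * node, for an even weight k. *)
Lemma ip_fourier u k d (t : R) : in_L1 u -> weight k ->
  mu.-integrable setT (EFin \o k) ->
  (forall s, \int[mu]_x (k x * sin (s * x)) = 0) ->
  ip k (fourier u) (fun xi => d * expi (- (t * xi))) =
  kappa * \int[mu]_y (dotc (u y) d * cos_transform k (y - t)).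
Proof.
move=> Lu wk Ik ks0; have [mk k0] := wk.
pose G (p : R * R) := k p.1 * dotc (u p.2 * expi (- (p.2 * p.1))) (d * expi (- (t * p.1))).
have mG : measurable_fun setT G.
  apply: measurable_funM; last exact: (measurable_twist d t (cmeasurable_L1 Lu)).
  by apply: measurableT_comp mk _; exact: measurable_fst.
have GE p : G p = k p.1 * cos ((p.2 - t) * p.1) * dotc (u p.2) d +
    k p.1 * sin ((p.2 - t) * p.1) * dotc (u p.2) ('i%C * d).
  by rewrite /G dotc_twist mulrDr !mulrA.
have Gle p : `|G p| <= k p.1 * (2 * norm1c (u p.2) * norm1c d).
  by rewrite /G normrM (ger0_norm (k0 _)) ler_wpM2l// dotc_twist_le.
have Iu := integrable_norm1c Lu.
have I1 x : mu.-integrable setT (EFin \o (fun y => G (x, y))).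
  exact: (integrableRZ (k x) (integrable_twist (d * expi (- (t * x))) x Lu)).
have Ic s : mu.-integrable setT (EFin \o (fun x => k x * cos (s * x))).
  by apply: integrable_wM => //; [exact: measurable_cosM|move=> x; exact: cos_max].
have Is s : mu.-integrable setT (EFin \o (fun x => k x * sin (s * x))).
  by apply: integrable_wM => //; [exact: measurable_sinM|move=> x; exact: sin_max].
have I2 y : mu.-integrable setT (EFin \o (fun x => G (x, y))).
  have := integrableRD (integrableRZ (dotc (u y) d) (Ic (y - t)))
    (integrableRZ (dotc (u y) ('i%C * d)) (Is (y - t))).
  apply: eq_integrable => // x _ /=; rewrite GE /=; congr EFin; ring.
(* The majorant of [Gle] is a product of an integrable function of x and one of y, which gives joint
   integrability. *)
have IG : (mu \x mu)%E.-integrable setT (EFin \o G).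
  apply/integrable12ltyP; first exact/measurable_EFinP.
  pose A := \int[mu]_y (2 * norm1c d * norm1c (u y)).
  have IA : mu.-integrable setT (EFin \o (fun y => 2 * norm1c d * norm1c (u y))) by exact:
    integrableRZ.
  apply: (@le_lt_trans _ _ (\int[mu]_x (A * k x)%:E)%E).
    apply: ge0_le_integral => //.
    - by move=> x _; apply: integral_ge0.
    - have H : measurable_fun setT (abse \o (EFin \o G)).
        by apply: measurableT_comp => //; exact/measurable_EFinP.
      exact: (@measurable_fun_fubini_tonelli_F _ _ _ _ _ mu _ H (fun z => abse_ge0 _)).
    - by apply/measurable_EFinP; apply: measurable_funM.
    move=> x _; apply: (@le_trans _ _ (\int[mu]_y (k x * (2 * norm1c d * norm1c (u y)))%:E)%E).
      apply: ge0_le_integral => //.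
      - by apply: measurableT_comp => //; apply/measurable_EFinP;
        case/integrableP: (I1 x) => /measurable_EFinP.
      - by have /integrableP[] := integrableRZ (k x) IA.
      by move=> y _; rewrite lee_fin (le_trans (Gle (x, y)))//= [2 * _ * norm1c d]mulrAC.
    have /integrable_fin_num F : mu.-integrable setT (EFin \o (fun y => k x * (2 * norm1c d *
      norm1c (u y)))).
      exact: integrableRZ.
    rewrite -[leLHS]fineK ?F// lee_fin.
    rewrite -[fine _]/(\int[mu]_y (k x * (2 * norm1c d * norm1c (u y)))) RintegralZl//.
    by rewrite mulrC.
  by have /integrable_lty := integrableRZ A Ik; exact.
transitivity (kappa * \int[mu]_x \int[mu]_y G (x, y)).
  rewrite -RintegralZl//; last first.
    apply: eq_integrable (integrable_fubini_F IG) => // x _ /=.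
    by rewrite fineK//; exact: integrable_fin_num (I1 x).
  apply: eq_Rintegral => x _; rewrite dotc_fourier// mulrCA; congr (_ * _).
  by rewrite /G /= RintegralZl//; exact: integrable_twist.
rewrite Rintegral_Fubini//; congr (_ * _); apply: eq_Rintegral => y _.
under eq_Rintegral do rewrite GE /= -![_ * dotc _ _]mulrC.
rewrite RintegralD//; [|exact: integrableRZ..].
by rewrite !RintegralZl// ks0 mulr0 addr0.
Qed.

End fourier_multiplication.

(** * Translation invariance and the Poisson approximate identity *)

Section approximate_identity.
Variable R : realType.
Notation mu := (@lebesgue_measure R).

Lemma shift_preimage_itv (a x y : R) :
  (fun t : R => t + a) @^-1` `]x, y] = `]x - a, y - a]%classic.
Proof. by apply/seteqP; split => t /=; rewrite !in_itv /= ltrBlDr lerBrDr. Qed.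

Lemma measurable_shift (a : R) : measurable_fun setT (fun t : R => t + a).
Proof. by apply: measurable_funD => //; exact: measurable_cst. Qed.

(** The pushforward by a translation gives half-open intervals their length, so uniqueness of
    Lebesgue measure applies. *)
Lemma lebesgue_shift (a : R) (A : set R) : measurable A ->
  mu ((fun t : R => t + a) @^-1` A) = mu A.
Proof.
move=> mA; apply/esym.
have ms : @measurable_fun _ _ (measurableTypeR R) (measurableTypeR R) setT (fun t : R => t + a)
  by exact: measurable_shift.
have := @lebesgue_measure_unique R
  (measure_function_pushforward__canonical__measure_function_Measure mu ms).
apply => // _ [[x y] _ <-] /=.
rewrite /pushforward shift_preimage_itv.
rewrite !lebesgue_measure_itv /= !lte_fin ltrD2r; case: ifP => // _.
by rewrite !EFinN -!EFinB; congr EFin; ring.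
Qed.

Lemma integral_shift (f : R -> \bar R) (a : R) : measurable_fun setT f ->
  (forall t, 0 <= f t)%E -> (\int[mu]_t f (t + a)%R = \int[mu]_t f t)%E.
Proof.
have ms : @measurable_fun _ _ (measurableTypeR R) (measurableTypeR R) setT (fun t : R => t + a)
  by exact: measurable_shift.
move=> mf f0; have := @ge0_integral_pushforward _ _ (measurableTypeR R) (measurableTypeR R) R _
  ms mu setT f measurableT mf (fun y _ => f0 y).
rewrite preimage_setT => <-; apply: eq_measure_integral => A mA _.
by rewrite /= /pushforward lebesgue_shift.
Qed.

Lemma dominated_cvg_R (f_ : nat -> R -> R) (f g : R -> R) :
  (forall n, measurable_fun setT (f_ n)) -> measurable_fun setT f ->
  {ae mu, forall x, f_ n x @[n --> \oo] --> f x} ->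
  mu.-integrable setT (EFin \o g) -> (forall n x, `|f_ n x| <= g x) ->
  \int[mu]_x f_ n x @[n --> \oo] --> \int[mu]_x f x.
Proof.
move=> mf_ mf cf ig fg.
have cE : {ae mu, forall x, setT x -> (f_ n x)%:E @[n --> \oo] --> (f x)%:E}.
  by apply: ae_imp cf => x c _; apply: cvg_EFin => //; exact: nearW.
have m1 n : measurable_fun setT (EFin \o f_ n) by exact/measurable_EFinP.
have m2 : measurable_fun setT (EFin \o f) by exact/measurable_EFinP.
have dE : {ae mu, forall x (n : nat), setT x -> (`|(EFin \o f_ n) x| <= (EFin \o g) x)%E}.
  by apply: aeW => x n _; rewrite lee_fin.
have [i1 _ c1] := @dominated_convergence _ (measurableTypeR R) R mu setT measurableT
  (fun n => EFin \o f_ n) (EFin \o f) (EFin \o g) m1 m2 cE ig dE.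
apply: fine_cvg; rewrite fineK//.
exact: integrable_fin_num i1.
Qed.

Lemma Rintegral_shift (f : R -> R) (a : R) : measurable_fun setT f ->
  (forall t, 0 <= f t) -> \int[mu]_t f (t + a) = \int[mu]_t f t.
Proof.
move=> mf f0; congr fine; apply: (@integral_shift (EFin \o f)).
  exact/measurable_EFinP.
by move=> t; rewrite lee_fin.
Qed.

Lemma integrable_shift (f : R -> R) (a : R) : measurable_fun setT f ->
  (forall t, 0 <= f t) -> mu.-integrable setT (EFin \o f) ->
  mu.-integrable setT (EFin \o (fun t => f (t + a))).
Proof.
move=> mf f0 /integrableP[_ oo]; apply/integrableP; split.
  by apply/measurable_EFinP; apply: measurableT_comp mf _; exact: measurable_shift.
rewrite (integral_shift (f := fun t => `|(f t)%:E|%E))//.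
by apply: measurableT_comp => //; exact/measurable_EFinP.
Qed.

(** Dominated convergence runs along sequences; the values stay at most 1, as the comparisons with
    [poisson_kernel 1] require. *)
Definition eps_seq (n : nat) : R := n.+1%:R^-1.

Lemma eps_seq_gt0 n : 0 < eps_seq n. Proof. by rewrite invr_gt0. Qed.

Lemma eps_seq_le1 n : eps_seq n <= 1.
Proof. by rewrite invf_le1// ler1n. Qed.

Lemma cvg_eps_seq : eps_seq n @[n --> \oo] --> 0.
Proof. exact: cvg_harmonic. Qed.

Lemma measurable_poisson_kernel_shift (e t : R) : 0 < e -> measurable_fun setT (fun y : R =>
  poisson_kernel e (y - t)).
Proof.
move=> e0; have [mp _] := weight_poisson_kernel e0.
by apply: (measurableT_comp mp); exact: measurable_shift.
Qed.

Lemma poisson_kernel_shift_int (e t : R) : 0 < e ->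
  mu.-integrable setT (EFin \o (fun y => poisson_kernel e (y - t))).
Proof.
move=> e0; have [mp p0] := weight_poisson_kernel e0.
by apply: integrable_shift => //; have [] := integral_poisson_kernel e0.
Qed.

(** Away from 0 the kernel is O(e) times the fixed kernel [poisson_kernel 1], so the far part of a
    convolution vanishes as e tends to 0. *)
Lemma poisson_kernel_far (e eta s : R) : 0 < e -> e <= 1 -> 0 < eta -> eta <= `|s| ->
  poisson_kernel e s <= e * (1 + eta ^- 2) * poisson_kernel 1 s.
Proof.
move=> e0 e1 eta0 es.
have s2 : eta ^+ 2 <= s ^+ 2 by rewrite -(real_normK (num_real s)) lerXn2r ?nnegrE ?(ltW eta0).
have eta20 : 0 < eta ^+ 2 by rewrite exprn_gt0.
have s20 : 0 < s ^+ 2 by exact: lt_le_trans s2.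
have D1 := poisson_kernel_den s ltr01; have De := poisson_kernel_den s e0.
rewrite /poisson_kernel mulr1 expr1n in D1 *.
apply: (@le_trans _ _ (2 * e / s ^+ 2)).
  rewrite ler_wpM2l ?mulr_ge0 ?(ltW e0)// lef_pV2// lerDr sqr_ge0//.
rewrite mulrA ler_pdivrMr// mulrAC ler_pdivlMr//.
rewrite (_ : _ * 2 * s ^+ 2 = 2 * e * ((1 + eta ^- 2) * s ^+ 2)); last by ring.
rewrite ler_wpM2l ?mulr_ge0 ?(ltW e0)//.
rewrite mulrDl mul1r addrC lerD2l mulrC ler_pdivlMr ?mul1r//.
Qed.

(** Carries integrability against the kernel with e = 1 over to every smaller e. *)
Lemma poisson_kernel_le (e s : R) : 0 < e -> e <= 1 -> poisson_kernel e s <= e^-1 *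
  poisson_kernel 1 s.
Proof.
move=> e0 e1; have D1 := poisson_kernel_den s ltr01; have De := poisson_kernel_den s e0.
have e2 : e ^+ 2 <= 1 by rewrite expr_le1// ltW.
have s2 := sqr_ge0 s.
rewrite /poisson_kernel mulr1 expr1n in D1 *.
move: (s ^+ 2) s2 D1 De => S S0 D1 De; rewrite ler_pdivrMr//.
rewrite (_ : e^-1 * (2 / (1 + S)) * (e ^+ 2 + S) = (2 * (e ^+ 2 + S)) / (e * (1 + S)));
  last first.
  by field; rewrite !gt_eqF.
by rewrite ler_pdivlMr ?mulr_gt0//; rewrite expr2 in e2 *; nra.
Qed.

(** g may be unbounded: integrability against [poisson_kernel 1] replaces boundedness. Near t,
    continuity and the mass 2 pi give half of the error; far from t, [poisson_kernel_far] gives the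
    other half. *)
Lemma approx_identity (g : R -> R) (t : R) : continuous g ->
  mu.-integrable setT (EFin \o (fun y => g y * poisson_kernel 1 (y - t))) ->
  \int[mu]_y (g y * poisson_kernel (eps_seq n) (y - t)) @[n --> \oo] --> 2 * pi * g t.
Proof.
move=> cg ig.
have mg : measurable_fun setT g by exact: continuous_measurable_fun.
have ig' n : mu.-integrable setT (EFin \o (fun y => g y * poisson_kernel (eps_seq n) (y - t))).
  have e0 := eps_seq_gt0 n.
  apply: (@integrable_le _ _ (fun y => (eps_seq n)^-1 * `|g y * poisson_kernel 1 (y - t)|)).
  - by apply: measurable_funM => //; exact: measurable_poisson_kernel_shift.
  - move=> y; have P0 := poisson_kernel_ge0 (y - t) e0;
    have P1 := poisson_kernel_ge0 (y - t) (@ltr01 R).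
    rewrite [in leLHS]normrM (ger0_norm P0) normrM (ger0_norm P1) [leRHS]mulrCA ler_wpM2l//.
    by apply: poisson_kernel_le => //; exact: eps_seq_le1.
  - exact: (integrableRZ (eps_seq n)^-1 (integrable_norm ig)).
have Ic n : mu.-integrable setT (EFin \o (fun y => g t * poisson_kernel (eps_seq n) (y - t))).
  exact: (integrableRZ (g t) (poisson_kernel_shift_int t (eps_seq_gt0 n))).
have Ic1 : mu.-integrable setT (EFin \o (fun y => g t * poisson_kernel 1 (y - t))).
  exact: (integrableRZ (g t) (poisson_kernel_shift_int t ltr01)).
have E n : \int[mu]_y (g y * poisson_kernel (eps_seq n) (y - t)) - 2 * pi * g t =
    \int[mu]_y ((g y - g t) * poisson_kernel (eps_seq n) (y - t)).
  under [RHS]eq_Rintegral do rewrite mulrBl.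
  rewrite RintegralB//; congr (_ - _); rewrite RintegralZl//; last first.
    by apply: poisson_kernel_shift_int; exact: eps_seq_gt0.
  have [m0 p0] := weight_poisson_kernel (eps_seq_gt0 n).
  by rewrite (Rintegral_shift (- t) m0 p0) (integral_poisson_kernel (eps_seq_gt0 n)).2 mulrC.
have Id1 : mu.-integrable setT (EFin \o (fun y => (g y - g t) * poisson_kernel 1 (y - t))).
  by apply: eq_integrable (integrableRB ig Ic1) => // y _ /=; rewrite mulrBl.
have Id n : mu.-integrable setT (EFin \o (fun y => (g y - g t) * poisson_kernel (eps_seq n) (y -
  t))).
  by apply: eq_integrable (integrableRB (ig' n) (Ic n)) => // y _ /=; rewrite mulrBl.
pose M := \int[mu]_y `|(g y - g t) * poisson_kernel 1 (y - t)|.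
apply/cvgrPdist_le => eps eps0.
pose zeta := eps / 2 / (2 * pi).
have zeta0 : 0 < zeta by rewrite !divr_gt0 ?twopi_gt0.
have /cvgrPdist_le /(_ _ zeta0) /nbhs_ballP[eta /= eta0 Beta] := cg t.
have near0 : \forall n \near \oo, eps_seq n * ((1 + eta ^- 2) * M) <= eps / 2.
  have : eps_seq n * ((1 + eta ^- 2) * M) @[n --> \oo] --> 0 * ((1 + eta ^- 2) * M).
    by apply: cvgM; [exact: cvg_eps_seq|exact: cvg_cst].
  rewrite mul0r => /cvgrPdist_le /(_ (eps / 2)); rewrite divr_gt0// => /(_ isT).
  by apply: filterS => n; rewrite sub0r normrN; apply: le_trans; exact: ler_norm.
apply: filterS near0 => n nn; rewrite distrC E.
rewrite (le_trans (le_normr_Rintegral _ (Id n)))//.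
apply: (@le_trans _ _ (zeta * (2 * pi) + eps_seq n * ((1 + eta ^- 2) * M))); last first.
  have -> : zeta * (2 * pi) = eps / 2 by rewrite /zeta divfK// gt_eqF// twopi_gt0.
  by rewrite [leRHS](splitr eps) lerD2l.
have [m0 p0] := weight_poisson_kernel (eps_seq_gt0 n).
have Ip := poisson_kernel_shift_int t (eps_seq_gt0 n).
rewrite -(integral_poisson_kernel (eps_seq_gt0 n)).2 -(Rintegral_shift (- t) m0 p0).
rewrite -RintegralZl// mulrA -RintegralZl//; last exact: integrable_norm.
rewrite -RintegralD//; [|exact: integrableRZ|by apply: integrableRZ; exact: integrable_norm].
apply: le_RintegralT.
- exact: integrable_norm.
- by apply: integrableRD; apply: integrableRZ => //; exact: integrable_norm.
move=> y; have P0 := poisson_kernel_ge0 (y - t) (eps_seq_gt0 n).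
have P1 := poisson_kernel_ge0 (y - t) (@ltr01 R).
rewrite normrM (ger0_norm P0) normrM (ger0_norm P1).
have [lt|ge] := ltP `|y - t| eta.
  have h : `|g y - g t| <= zeta by rewrite distrC; apply: Beta; rewrite -ball_normE /= distrC.
  rewrite -[leLHS]addr0 lerD//.
    by rewrite ler_wpM2r.
  have E0 : 0 <= 1 + eta ^- 2 by apply: addr_ge0 => //; rewrite invr_ge0 exprn_ge0 ?(ltW eta0).
  have H0 := ltW (eps_seq_gt0 n).
  by rewrite mulr_ge0// mulr_ge0// mulr_ge0.
rewrite -[leLHS]add0r lerD//; first by rewrite mulr_ge0 ?(ltW zeta0).
rewrite [leRHS]mulrCA ler_wpM2l//.
by apply: poisson_kernel_far => //; [exact: eps_seq_gt0|exact: eps_seq_le1].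
Qed.

End approximate_identity.

(** * Inversion for phi and the multiplication formula in L2 *)

Section inversion.
Variable R : realType.
Notation mu := (@lebesgue_measure R).
Implicit Types (f g h : R -> R[i]) (d : R[i]) (t : R).

(** [node (x j)] is [node_exp x j]. The frequency is an arbitrary real here because, after
    inversion, evaluation at t is pairing with [node t]. *)
Definition node t (xi : R) : R[i] := expi (- (t * xi)).

Lemma cmeasurable_cnode d t : cmeasurable setT (fun xi => d * node t xi).
Proof. exact: cmeasurable_node. Qed.

Lemma sqc_cnode d t (xi : R) : sqc (d * node t xi) = sqc d.
Proof. by rewrite sqcM /node sqc_expi mulr1. Qed.

Lemma L2w_cnode w d t : weight w -> mu.-integrable setT (EFin \o w) ->
  L2w w (fun xi => d * node t xi).
Proof.
move=> ww iw; apply: (@L2w_bounded _ _ _ (sqc d)) => //.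
  exact: cmeasurable_cnode.
by move=> xi; rewrite sqc_cnode.
Qed.

Lemma cos_transform_exp_kernel (e s : R) : 0 < e -> cos_transform (exp_kernel e) s =
  poisson_kernel e s.
Proof. exact: exp_kernel_cos. Qed.

Definition phi_hat (phi : R -> R) (xi : R) : R := complex.Re (rfourier phi xi).

Lemma rfourierE phi (xi : R) : 0 <= rfourier phi xi -> rfourier phi xi = (phi_hat phi xi)%:C.
Proof.
by rewrite /phi_hat => /ger0_Im; case: (rfourier phi xi) => a b /= ->.
Qed.

Lemma phi_hat_ge0 phi (xi : R) : 0 <= rfourier phi xi -> 0 <= phi_hat phi xi.
Proof. by move=> H; move: (H); rewrite rfourierE// ler0c. Qed.

Lemma cvg_exp_kernel t : exp_kernel (eps_seq R n) t @[n --> \oo] --> (1 : R).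
Proof.
rewrite -[X in _ --> X]expR0; apply: continuous_cvg; first exact: continuous_expR.
rewrite -[X in _ --> X]oppr0; apply: cvgN.
rewrite -[X in _ --> X](mul0r `|t|); apply: cvgM; last exact: cvg_cst.
exact: cvg_eps_seq.
Qed.

Section L1_inversion.
Variable phi : R -> R.
Hypotheses (phi1 : A1 phi) (phi_ge0 : forall xi, 0 <= rfourier phi xi).

Lemma weight_phi_hat : weight (phi_hat phi).
Proof.
split; last by move=> xi; exact: phi_hat_ge0.
by have [_ [/integrableP[/measurable_EFinP]]] := phi1.
Qed.

Lemma integrable_phi_hat : mu.-integrable setT (EFin \o phi_hat phi).
Proof. by have [_ []] := phi1. Qed.

(** Abel summation: the regularised pairing of the transform with [node t] is computed by the
    multiplication formula. One side converges by the Poisson approximate identity and continuity of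
    phi, the other by dominated convergence since the transform is integrable. *)
Lemma phi_inversion1 d t :
  dotc (phi t)%:C d = kappa R * ip (phi_hat phi) (fun=> 1) (fun xi => d * node t xi).
Proof.
have [Lp _ cphi] := phi1.
have wp := weight_phi_hat; have iphat := integrable_phi_hat; have [mp p0] := wp.
have E n : ip (exp_kernel (eps_seq R n)) (rfourier phi) (fun xi => d * node t xi) =
    kappa R * \int[mu]_y (dotc (phi y)%:C d * poisson_kernel (eps_seq R n) (y - t)).
  rewrite ip_fourier//.
  - congr (_ * _); apply: eq_Rintegral => y _; rewrite cos_transform_exp_kernel//.
    exact: eps_seq_gt0.
  - exact: weight_exp_kernel.
  - by apply: integrable_exp_kernel; exact: eps_seq_gt0.
  - by move=> s; apply: exp_kernel_sin; exact: eps_seq_gt0.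
have C1 : kappa R * \int[mu]_y (dotc (phi y)%:C d * poisson_kernel (eps_seq R n) (y - t))
    @[n --> \oo] --> kappa R * (2 * pi * dotc (phi t)%:C d).
  apply: cvgM; first exact: cvg_cst.
  apply: approx_identity.
    move=> y; rewrite /dotc /=; apply: cvgD; apply: cvgM; try exact: cvg_cst.
    exact: cphi.
  have [Ir _] := Lp.
  apply: (@integrable_le _ _ (fun y => 2 * norm1c d * `|phi y|)).
  - apply: measurable_funM; last exact: measurable_poisson_kernel_shift.
    by apply: measurable_dotc; [exact: cmeasurable_L1 Lp|exact: cmeasurable_cst].
  - move=> y; have P1 := poisson_kernel_ge0 (y - t) (@ltr01 R).
    rewrite normrM (ger0_norm P1).
    have := dotc_le_norm1c (phi y)%:C d; rewrite {1}/norm1c /= normr0 addr0 => H.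
    have P2 : poisson_kernel 1 (y - t) <= 2.
      rewrite /poisson_kernel mulr1 ler_pdivrMr ?poisson_kernel_den// expr1n.
      by have := sqr_ge0 (y - t); lra.
    rewrite mulrC (_ : 2 * norm1c d * _ = 2 * (`|phi y| * norm1c d)); last by ring.
    by rewrite ler_pM.
  - exact: (integrableRZ (2 * norm1c d) (integrable_norm Ir)).
have C2 : ip (exp_kernel (eps_seq R n)) (rfourier phi) (fun xi => d * node t xi)
   @[n --> \oo] --> ip (phi_hat phi) (fun=> 1) (fun xi => d * node t xi).
  have md : measurable_fun setT (fun xi => phi_hat phi xi * dotc 1 (d * node t xi)).
    apply: measurable_funM => //; apply: measurable_dotc; first exact: cmeasurable_cst.
    exact: cmeasurable_cnode.
  have Id : mu.-integrable setT (EFin \o (fun xi => phi_hat phi xi * dotc 1 (d * node t xi))).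
    apply: ip_integrable => //; last exact: L2w_cnode.
    by apply: (@L2w_bounded _ _ _ (sqc 1)) => //; exact: cmeasurable_cst.
  have EE n xi : exp_kernel (eps_seq R n) xi * dotc (rfourier phi xi) (d * node t xi) =
      exp_kernel (eps_seq R n) xi * (phi_hat phi xi * dotc 1 (d * node t xi)).
    by rewrite rfourierE// -[in LHS](mulr1 (_ %:C)) dotcZl.
  rewrite /ip; under eq_fun do under eq_Rintegral do rewrite EE.
  apply: (@dominated_cvg_R _ _ _ (fun xi => `|phi_hat phi xi * dotc 1 (d * node t xi)|)) => //.
  - by move=> n; apply: measurable_funM => //; have [] := weight_exp_kernel (eps_seq R n).
  - apply: aeW => xi; rewrite -[X in _ --> X]mul1r; apply: cvgM; last exact: cvg_cst.
    exact: cvg_exp_kernel.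
  - exact: integrable_norm.
  - move=> n xi; rewrite normrM ler_piMl// ger0_norm; last by rewrite ltW// exp_kernel_gt0.
    by apply: exp_kernel_le1; exact: eps_seq_gt0.
rewrite (funext E) in C2.
rewrite (cvg_unique _ C2 C1)//.
by rewrite mulrA -expr2 mulrA kappa_sqr mul1r.
Qed.

(** The phase of s and the conjugate of c move across the pairing. The values phi (t - s) thus form,
    up to [kappa], the Gram kernel of the exponentials in the L2 space with weight [phi_hat phi],
    from which positivity and all bounds on the interpolation matrix follow. *)
Lemma phi_inversion (c d : R[i]) (s t : R) :
  dotc (c * (phi (t - s))%:C) d =
  kappa R * ip (phi_hat phi) (fun xi => c * node s xi) (fun xi => d * node t xi).
Proof.
transitivity (dotc (phi (t - s))%:C (c^* * d)).
  by case: c d => [a b] [p q]; rewrite /dotc /=; ring.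
rewrite phi_inversion1; congr (_ * _); apply: eq_Rintegral => xi _; congr (_ * _).
have -> : node (t - s) xi = node t xi * expi (s * xi).
  by rewrite /node -expiD; congr expi; ring.
rewrite /node; case: c d (expi (- (t * xi))) => [a b] [p q] [u v].
by rewrite /dotc /= cosN sinN; ring.
Qed.

End L1_inversion.

Lemma L2normT_nrm g : L2w \1_[set: R] g -> L2norm setT g = (nrm (fun=> 1) g)%:E.
Proof.
move=> Lg; rewrite L2norm_nrm//; congr (Num.sqrt _)%:E.
by apply: eq_Rintegral => t _; rewrite indicE in_setT.
Qed.

(* Finitely many g_ n may fail to be square integrable over the line. *)
Lemma cvg_ip_L2 (k : R -> R) (g_ : nat -> R -> R[i]) h : weight k ->
  (forall t, k t <= 1) -> (forall n, L2w k (g_ n)) -> L2w k h ->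
  L2norm setT (g_ n) @[n --> \oo] --> 0%E ->
  ip k (g_ n) h @[n --> \oo] --> 0.
Proof.
move=> wk k1 Lg Lh g0; apply/cvgrPdist_le => eps eps0.
have N0 : 0 < nrm k h + 1 by rewrite ltr_wpDl ?nrm_ge0.
have d0 : 0 < eps / (nrm k h + 1) by rewrite divr_gt0.
have : \forall n \near \oo, (L2norm setT (g_ n) < (eps / (nrm k h + 1))%:E)%E.
  have H : (0 < (eps / (nrm k h + 1))%:E)%E by rewrite lte_fin.
  exact: g0 _ (open_ereal_lt' H).
apply: filterS => n; rewrite sub0r normrN => Hn.
have Ln : L2w \1_[set: R] (g_ n).
  by apply: L2w_L2norm => //; [have [] := Lg n|apply: lt_trans Hn _; exact: ltry].
have Ln1 := L2w_cst1 Ln.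
rewrite L2normT_nrm// lte_fin in Hn.
rewrite (le_trans (cauchy_schwarz wk (Lg n) Lh))//.
have Hk : nrm k (g_ n) <= nrm (fun=> 1) (g_ n).
  by rewrite ler_wsqrtr//; apply: ip_sub => //; exact: weight1.
apply: (@le_trans _ _ (eps / (nrm k h + 1) * (nrm k h + 1))); last by rewrite divfK ?gt_eqF.
apply: ler_pM; rewrite ?nrm_ge0//; first exact: le_trans Hk (ltW Hn).
by rewrite lerDl.
Qed.

Section L2_fourier.
Variables (f fhat : R -> R[i]) (k : R -> R) (e C : R).
Hypothesis Ff : is_fourier_L2 f fhat.
Hypotheses (wk : weight k) (k1 : forall t, k t <= 1).
Hypothesis ik : mu.-integrable setT (EFin \o k).
Hypothesis ks : forall s, \int[mu]_x (k x * sin (s * x)) = 0.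
Hypotheses (e0 : 0 < e) (kc : forall s, cos_transform k s ^+ 2 <= C * poisson_kernel e s).

Lemma measurable_cos_transform : measurable_fun setT (cos_transform k).
Proof.
apply: (@measurable_param R (fun p => k p.2 * cos (p.1 * p.2))).
have [mk _] := wk.
apply: measurable_funM; first exact: (measurableT_comp mk measurable_snd).
apply: measurableT_comp; first by apply: continuous_measurable_fun; exact: continuous_cos.
by apply: measurable_funM; [exact: measurable_fst|exact: measurable_snd].
Qed.

(** The function that represents, on the side of f, the pairing of the transform with [node t] under
    the weight k. By [kc] its square lies below a translated Poisson kernel. *)
Let ker d t (y : R) : R[i] := (cos_transform k (y - t))%:C * d.

Lemma L2w_cos_transform d t : L2w (fun=> 1) (ker d t).
Proof.
have mc : measurable_fun setT (fun y : R => cos_transform k (y - t)).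
  by apply: measurableT_comp measurable_cos_transform _; exact: measurable_shift.
have mker : cmeasurable setT (ker d t).
  by apply: cmeasurableM; [exact: cmeasurable_real|exact: cmeasurable_cst].
split => //; apply: (@integrable_le _ _ (fun y => (C * sqc d) * poisson_kernel e (y - t))).
- by apply: measurable_funM => //; exact: measurable_dotc.
- move=> y; rewrite mul1r ger0_norm ?sqc_ge0// /ker sqcM mulrAC ler_wpM2r ?sqc_ge0//.
  by rewrite /sqc /dotc /= mul0r addr0 -expr2.
- exact: (integrableRZ (C * sqc d) (poisson_kernel_shift_int t e0)).
Qed.

(** Holds for the integrable approximants by [ip_fourier]. Both sides are continuous in L2: the left
    since k <= 1, the right since [ker] is square integrable. *)
Lemma ip_fourier_L2 d t :
  ip k fhat (fun xi => d * node t xi) = kappa R * ip (fun=> 1) f (ker d t).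
Proof.
have [Lf Lfh [u [Lu uf uhf]]] := Ff.
have w1 := weight1 R.
have L1f : L2w (fun=> 1) f by apply: L2w_cst1; exact: in_L2_L2w Lf.
have Lkfh : L2w k fhat.
  by apply: (L2w_sub wk w1 k1); apply: L2w_cst1; exact: in_L2_L2w Lfh.
have L1u n : L2w (fun=> 1) (u n).
  by apply: L2w_cst1; apply: in_L2_L2w => //; have [] := Lu n.
have Lkuh n : L2w k (fourier (u n)) by apply: L2w_fourier => //; have [] := Lu n.
have Lker := L2w_cos_transform d t.
have Lnode : L2w k (fun xi => d * node t xi) by exact: L2w_cnode.
have C1 : ip k (fun xi => fourier (u n) xi - fhat xi) (fun xi => d * node t xi)
    @[n --> \oo] --> 0.
  by apply: cvg_ip_L2 => // n; exact: L2wB.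
have C2 : kappa R * ip (fun=> 1) (fun y => u n y - f y) (ker d t)
    @[n --> \oo] --> kappa R * 0.
  apply: cvgM; first exact: cvg_cst.
  by apply: cvg_ip_L2 => // n; exact: L2wB.
have E n : ip k (fourier (u n)) (fun xi => d * node t xi) =
    kappa R * ip (fun=> 1) (u n) (ker d t).
  rewrite ip_fourier//; last by have [] := Lu n.
  congr (_ * _); apply: eq_Rintegral => y _.
  by rewrite mul1r /ker [in RHS]dotcC dotcZl mulrC dotcC.
have E2 n : ip k (fun xi => fourier (u n) xi - fhat xi) (fun xi => d * node t xi) =
  kappa R * ip (fun=> 1) (fun y => u n y - f y) (ker d t) +
  (kappa R * ip (fun=> 1) f (ker d t) - ip k fhat (fun xi => d * node t xi)).
  rewrite ipBl// ipBl// E; ring.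
rewrite (funext E2) in C1.
have C3 : kappa R * ip (fun=> 1) (fun y => u n y - f y) (ker d t) +
    (kappa R * ip (fun=> 1) f (ker d t) - ip k fhat (fun xi => d * node t xi)) @[n --> \oo] -->
    kappa R * 0 + (kappa R * ip (fun=> 1) f (ker d t) - ip k fhat (fun xi => d * node t xi)).
  by apply: cvgD; [exact: C2|exact: cvg_cst].
have : (0 : R) = _ := cvg_unique (@norm_hausdorff _ _) C1 C3.
rewrite mulr0 add0r => D.
by apply/esym/eqP; rewrite -subr_eq0 -D.
Qed.

End L2_fourier.

End inversion.

(** * Support of the transform and inversion for Paley-Wiener functions *)

Section support.
Variable R : realType.
Notation mu := (@lebesgue_measure R).

(* Second countability: the union of the open sets where g vanishes almost
   everywhere is covered by countably many rational intervals. *)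
Lemma supp_ae (g : R -> R[i]) (D : set R) : supp g `<=` D ->
  {ae mu, forall t, ~ D t -> g t = 0}.
Proof.
move=> sD.
pose I (p : rat * rat) : set R := `]ratr p.1, ratr p.2[%classic.
pose Z (p : rat * rat) : set R := [set t | I p t /\ g t <> 0].
(* The rational intervals are enumerated by [pickle]; those on which g does not vanish almost
   everywhere contribute the empty set, so every F n is negligible. *)
pose F (n : nat) : set R := if (choice.unpickle n : option (rat * rat)) is Some p then
   (if `[< mu.-negligible (Z p) >] then Z p else set0) else set0.
have nF n : mu.-negligible (F n).
  rewrite /F; case: choice.unpickle => [p|]; last exact: negligible_set0.
  by case: asboolP => // _; exact: negligible_set0.
apply: negligibleS (negligible_bigcup nF) => t /= /not_implyP[nDt gt].
have : ~ supp g t by move=> /sD.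
rewrite /supp /= => /contrapT[U [oU aeU] Ut].
have /nbhs_ballP[r /= r0 rU] : nbhs t U by exact: open_nbhs_nbhs.
have [q] : exists q : rat, ratr q \in `]t - r, t[ by apply: rat_in_itvoo; rewrite ltrBlDr ltrDl.
rewrite in_itv /= => /andP[q1 q2].
have [q'] : exists q : rat, ratr q \in `]t, t + r[ by apply: rat_in_itvoo; rewrite ltrDl.
rewrite in_itv /= => /andP[q1' q2'].
have It : I (q, q') t by rewrite /I /= in_itv /= q2 q1'.
have FE : F (choice.pickle (q, q')) = if `[< mu.-negligible (Z (q, q')) >] then Z (q, q') else
  set0.
  by rewrite /F choice.pickleK.
exists (choice.pickle (q, q')); first exact: Logic.I.
rewrite FE; case: asboolP => [_|[]]; first by split.
apply: negligibleS aeU => s /= [Is gs] H; apply: gs; apply: H; apply: rU.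
move: Is; rewrite /I /= in_itv /= => /andP[h1 h2].
rewrite -ball_normE /= ltr_norml; apply/andP; split.
  by rewrite ltrBDr -ltrBrDl; move: h2 q2'; lra.
by move: h1 q1; lra.
Qed.

End support.

Section PW_inversion.
Variable R : realType.
Notation mu := (@lebesgue_measure R).
Notation ID := (\1_(Ipi R) : R -> R).

Lemma Ipi_le1 (t : R) : ID t <= 1.
Proof. by rewrite indicE; case: (_ \in _); rewrite /= ?lexx ?ler01. Qed.

(* fhat need not be the transform provided by PW f; both agree against node on
   [-pi, pi] because the sinc kernel is square integrable. *)
Lemma PW_inversion (f fhat : R -> R[i]) (d : R[i]) (t : R) :
  PW f -> is_fourier_L2 f fhat ->
  dotc (f t) d = kappa R * ip ID fhat (fun xi => d * node t xi).
Proof.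
move=> [Lf [cr ci] [fh Ffh sfh]] Ff.
have wD := weight_Ipi R; have iD := integrable_Ipi R.
have kD s : cos_transform ID s ^+ 2 <= ((4 * pi ^+ 2 + 4) / 2) * poisson_kernel 1 s.
  have := sincint_le s; rewrite /cos_transform -/(sincint s).
  have D1 := poisson_kernel_den s (@ltr01 R); rewrite expr1n in D1.
  rewrite /poisson_kernel mulr1 expr1n (_ : _ / 2 * _ = (4 * pi ^+ 2 + 4) / (1 + s ^+ 2)).
    by rewrite ler_pdivlMr// mulrC.
  by field; rewrite gt_eqF.
(* The right-hand side depends on f alone, so any two transforms of f have the same pairing on
   [-pi, pi]. *)
have key g (Fg : is_fourier_L2 f g) := @ip_fourier_L2 R f g ID 1 _ Fg wD Ipi_le1 iD (@Ipi_sin R)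
  ltr01 kD d t.
rewrite (key _ Ff) -(key _ Ffh).
have [_ Lfh _] := Ffh.
have LDfh : L2w ID fh by apply: in_L2_L2w => //; exact: measurable_Ipi.
have Lnode := L2w_cnode d t wD iD.
have ID_int := ip_integrable wD LDfh Lnode.
have mfh : cmeasurable setT fh by have [] := LDfh.
have mnode := cmeasurable_cnode d t.
(* The kernel is at most 2 / e, so its square is at most 2 / e times itself. *)
have kE n s : cos_transform (exp_kernel (eps_seq R n)) s ^+ 2 <= (2 / eps_seq R n) *
  poisson_kernel (eps_seq R n) s.
  have e0 := eps_seq_gt0 R n; rewrite cos_transform_exp_kernel// expr2 ler_wpM2r
    ?poisson_kernel_ge0//.
  rewrite /poisson_kernel ler_pdivrMr ?poisson_kernel_den//.
  rewrite mulrDr (_ : 2 / eps_seq R n * eps_seq R n ^+ 2 = 2 * eps_seq R n); last by field;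
    rewrite gt_eqF.
  by rewrite lerDl mulr_ge0 ?sqr_ge0// divr_ge0// ltW.
have E n : ip (exp_kernel (eps_seq R n)) fh (fun xi => d * node t xi) =
    kappa R * \int[mu]_y (dotc (f y) d * poisson_kernel (eps_seq R n) (y - t)).
  have e0 := eps_seq_gt0 R n.
  rewrite (@ip_fourier_L2 R f fh _ _ _ Ffh (weight_exp_kernel _) (fun x => exp_kernel_le1 x e0)
    (integrable_exp_kernel e0) (fun s => exp_kernel_sin s e0) e0 (kE n) d t).
  congr (_ * _); apply: eq_Rintegral => y _.
  by rewrite mul1r cos_transform_exp_kernel// [LHS]dotcC dotcZl mulrC dotcC.
have L1f : L2w (fun=> 1) f by apply: L2w_cst1; exact: in_L2_L2w Lf.
have C1 : kappa R * \int[mu]_y (dotc (f y) d * poisson_kernel (eps_seq R n) (y - t))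
    @[n --> \oo] --> kappa R * (2 * pi * dotc (f t) d).
  apply: cvgM; first exact: cvg_cst.
  apply: (@approx_identity R (fun y => dotc (f y) d) t).
    by move=> y; rewrite /dotc /=; apply: cvgD; apply: cvgM; try exact: cvg_cst;
      [exact: cr|exact: ci].
  (* f is only square integrable: |<f, d>| <= |f|^2 + |d|^2, and the kernel is both bounded by 2 and
     integrable. *)
  apply: (@integrable_le _ _ (fun y => 2 * (1 * sqc (f y)) + sqc d * poisson_kernel 1 (y - t))).
  - apply: measurable_funM; last exact: measurable_poisson_kernel_shift.
    by apply: measurable_dotc; [have [] := L1f|exact: cmeasurable_cst].
  - move=> y; have P1 := poisson_kernel_ge0 (y - t) (@ltr01 R).
    have P2 : poisson_kernel 1 (y - t) <= 2.
      rewrite /poisson_kernel mulr1 ler_pdivrMr ?poisson_kernel_den// expr1n.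
      by have := sqr_ge0 (y - t); lra.
    rewrite normrM (ger0_norm P1) mul1r.
    apply: (@le_trans _ _ ((sqc (f y) + sqc d) * poisson_kernel 1 (y - t))).
      by rewrite ler_wpM2r// normr_dotc_le.
    rewrite mulrDl lerD2r mulrC ler_wpM2r ?sqc_ge0//.
  - apply: integrableRD; first exact: (integrableRZ 2 L1f.2).
    exact: (integrableRZ (sqc d) (poisson_kernel_shift_int t (@ltr01 R))).
have C2 : ip (exp_kernel (eps_seq R n)) fh (fun xi => d * node t xi)
   @[n --> \oo] --> ip ID fh (fun xi => d * node t xi).
  have md : measurable_fun setT (fun xi => ID xi * dotc (fh xi) (d * node t xi)).
    by apply: measurable_funM; [have [] := wD|exact: measurable_dotc].
  have EE n : ip (exp_kernel (eps_seq R n)) fh (fun xi => d * node t xi) =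
    \int[mu]_xi (exp_kernel (eps_seq R n) xi * (ID xi * dotc (fh xi) (d * node t xi))).
    (* As fh vanishes almost everywhere outside [-pi, pi], the indicator can be inserted; this also
       makes the integrand integrable uniformly in n. *)
    rewrite /ip /Rintegral; congr fine; apply: ae_eq_integral => //.
    - apply/measurable_EFinP; apply: measurable_funM;
      first by have [] := weight_exp_kernel (eps_seq R n).
      exact: measurable_dotc.
    - by apply/measurable_EFinP; apply: measurable_funM;
      first by have [] := weight_exp_kernel (eps_seq R n).
    apply: ae_imp (supp_ae sfh) => xi H _; congr (_ * _)%:E.
    rewrite indicE; case: (boolP (xi \in Ipi R)) => [_|]; first by rewrite mul1r.
    by rewrite notin_setE => /H ->; rewrite mul0r /dotc /= !mul0r addr0.
  rewrite (funext EE).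
  apply: (@dominated_cvg_R _ _ _ (fun xi => `|ID xi * dotc (fh xi) (d * node t xi)|)) => //.
  - by move=> n; apply: measurable_funM => //; have [] := weight_exp_kernel (eps_seq R n).
  - apply: aeW => xi; rewrite -[X in _ --> X]mul1r; apply: cvgM; last exact: cvg_cst.
    exact: cvg_exp_kernel.
  - exact: integrable_norm.
  - move=> n xi; rewrite normrM ler_piMl// ger0_norm; last by rewrite ltW// exp_kernel_gt0.
    by apply: exp_kernel_le1; exact: eps_seq_gt0.
rewrite (funext E) in C2.
have D : ip ID fh (fun xi => d * node t xi) = kappa R * (2 * pi * dotc (f t) d).
  exact: cvg_unique C2 C1.
by rewrite D mulrA -expr2 mulrA kappa_sqr mul1r.
Qed.

End PW_inversion.

(** * Exponential sums over the nodes *)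

Section finite_CIS.
Variable R : realType.
Notation mu := (@lebesgue_measure R).
Notation ID := (\1_(Ipi R) : R -> R).
Implicit Types (A B : {fset int}) (c d : int -> R[i]) (x : int -> R).

Definition tsum x A c (xi : R) : R[i] :=
  \sum_(j <- enum_fset A) c j * node (x j) xi.

Definition energy A c : R := \sum_(j <- enum_fset A) sqc (c j).

Lemma energy_ge0 A c : 0 <= energy A c.
Proof. by rewrite /energy; elim/big_ind: _ => // [*|j _]; [exact: addr_ge0|exact: sqc_ge0]. Qed.

Lemma big_fset_supp (V : nmodType) A B (F : int -> V) : (A `<=` B)%fset ->
  \sum_(j <- enum_fset B) (if j \in A then F j else 0) = \sum_(j <- enum_fset A) F j.
Proof.
move=> AB; rewrite -(big_fset_incl _ AB); last by move=> j _ /negbTE ->.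
by apply: eq_big_seq => j ->.
Qed.

Definition fset_restr A c (j : int) : R[i] := if j \in A then c j else 0.

Lemma sqc0 : sqc 0 = 0 :> R.
Proof. by rewrite /sqc /dotc /= mul0r addr0. Qed.

Lemma l2norm_fset_restr A c : l2norm (fset_restr A c) = (Num.sqrt (energy A c))%:E.
Proof.
rewrite /l2norm.
rewrite [esum _ _](_ : _ = (energy A c)%:E); last first.
  transitivity (\esum_(j in [set: int]) (if j \in [set` A] then (sqc (c j))%:E else 0%E)).
    apply: eq_esum => j _; rewrite -sqcE /fset_restr; case: ifPn => jA.
      by rewrite mem_set.
    by rewrite memNset ?sqc0//; exact/negP.
  rewrite -esum_mkcondr setTI esum_fset//; last by move=> j _; rewrite lee_fin sqc_ge0.
  rewrite -fsbig_seq; last exact: fset_uniq.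
  by rewrite /energy -sumEFin.
by rewrite poweR_EFin powR12_sqrt// energy_ge0.
Qed.

Lemma L2norm_eq (D : set R) (g g' : R -> R[i]) : (forall t, D t -> g t = g' t) ->
  L2norm D g = L2norm D g'.
Proof.
move=> gg'; congr Lnorm; apply/funext => t.
by rewrite /patch; case: ifPn => // /set_mem /gg' ->.
Qed.

Lemma cmeasurable_patch (D : set R) (g : R -> R[i]) : measurable D -> cmeasurable D g ->
  cmeasurable setT (fun t => if t \in D then g t else 0).
Proof.
move=> mD [gr gi]; split.
  apply: eq_measurable_fun ((measurable_restrictT _ mD).1 gr) => t _.
  by rewrite /patch; case: ifP.
apply: eq_measurable_fun ((measurable_restrictT _ mD).1 gi) => t _.
by rewrite /patch; case: ifP.
Qed.

Lemma L2w_tsum w x A c : weight w -> mu.-integrable setT (EFin \o w) ->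
  L2w w (tsum x A c).
Proof. by move=> ww iw; apply: L2w_sum => // j; exact: L2w_cnode. Qed.

(** For finitely supported coefficients the partial sums are constant once the index set contains A,
    so the L2 sum provided by the hypothesis agrees in norm with the finite one. The rest of the
    proof uses the Riesz bounds for finite sums only. *)
Lemma CIS_frame x : CIS x -> exists2 C : R, 0 < C & forall A c,
  nrm ID (tsum x A c) <= C * Num.sqrt (energy A c) /\
  Num.sqrt (energy A c) <= C * nrm ID (tsum x A c).
Proof.
move=> [_ [C C0 H]]; exists C => // A c.
have wD := weight_Ipi R; have iD := integrable_Ipi R; have mD := @measurable_Ipi R.
have [|S [[mS oS] lS]] := H (fset_restr A c).
  by rewrite /in_l2 l2norm_fset_restr ltry.
(* S is known to be measurable on [-pi, pi] only, hence the extension by 0. *)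
pose S' t := if t \in Ipi R then S t else 0.
have SS' : L2norm (Ipi R) S = L2norm (Ipi R) S'.
  by apply: L2norm_eq => t Dt; rewrite /S' mem_set.
have LS' : L2w ID S'.
  by apply: L2w_L2norm => //; [exact: cmeasurable_patch|rewrite -SS'].
have LT := L2w_tsum x A c wD iD.
have D0 : nrm ID (fun t => tsum x A c t - S' t) = 0.
  have LB := L2wB wD LT LS'.
  apply/eqP; rewrite eq_le nrm_ge0 andbT; apply/ler_addgt0Pr => e e0; rewrite add0r.
  have := lS _ (open_ereal_lt' (_ : (0 < e%:E)%E)); rewrite lte_fin => /(_ e0) [B0 _ HB].
  (* On a set that contains A the restricted coefficients give exactly [tsum x A c], so the distance
     to S is below e for every e. *)
  have := HB (A `|` B0)%fset (fsubsetUr _ _) => /=.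
  rewrite (@L2norm_eq _ _ (fun t => tsum x A c t - S' t)); last first.
    move=> t Dt; rewrite /S' mem_set//; congr (_ - _).
    rewrite /tsum -(big_fset_supp (fun j => c j * node (x j) t) (fsubsetUl A B0)).
    by apply: eq_bigr => j _; rewrite /fset_restr; case: ifP => // _; rewrite mul0r.
  by rewrite L2norm_nrm// lte_fin => /ltW.
have N1 : nrm ID (tsum x A c) <= nrm ID S'.
  have := nrmD wD (L2wB wD LT LS') LS'; rewrite D0 add0r.
  by apply: le_trans; rewrite [leLHS](_ : _ = nrm ID (fun t => tsum x A c t - S' t + S' t))//;
    congr nrm; apply/funext => t; rewrite subrK.
have N2 : nrm ID S' <= nrm ID (tsum x A c).
  have := nrmB wD LT (L2wB wD LT LS'); rewrite D0 addr0.
  by apply: le_trans; rewrite [leLHS](_ : _ = nrm ID (fun t => tsum x A c t - (tsum x A c t - S'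
    t)))//; congr nrm; apply/funext => t; rewrite opprB addrC subrK.
rewrite l2norm_fset_restr SS' L2norm_nrm// !lee_fin => -[H1 H2]; split.
  exact: le_trans N1 H2.
by rewrite -ler_pdivrMl// (le_trans H1).
Qed.

Lemma CIS_dense x (g : R -> R[i]) (e : R) : CIS x -> L2w ID g -> 0 < e ->
  exists A c, nrm ID (fun t => g t - tsum x A c t) < e.
Proof.
have wD := weight_Ipi R; have iD := integrable_Ipi R; have mD := @measurable_Ipi R.
move=> [H _] Lg e0; have [|A [c]] := H g _ e e0.
  split; last by rewrite L2norm_nrm// ltry.
  by have [[mr mi] _] := Lg; split; exact: measurable_funTS.
have LB : L2w ID (fun t => g t - tsum x A c t) by apply: L2wB => //; exact: L2w_tsum.
move=> h; exists A, c; move: h.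
by rewrite (@L2norm_eq _ _ (fun t => g t - tsum x A c t))// L2norm_nrm// lte_fin.
Qed.

Lemma tsum_shift x A c (a t : R) :
  tsum x A c (t + a) = tsum x A (fun j => c j * node (x j) a) t.
Proof.
apply: eq_bigr => j _; rewrite -mulrA; congr (_ * _).
by rewrite /node -expiD; congr expi; ring.
Qed.

Lemma energy_twist x A c a : energy A (fun j => c j * node (x j) a) = energy A c.
Proof. by apply: eq_bigr => j _; rewrite sqcM /node sqc_expi mulr1. Qed.

End finite_CIS.

(** * The weight outside [-pi, pi] *)

Section outer_bound.
Variable R : realType.
Notation mu := (@lebesgue_measure R).
Notation ID := (\1_(Ipi R) : R -> R).
Variables (phi : R -> R) (L : R).
Hypotheses (phi1 : A1 phi) (phi_ge0 : forall xi, 0 <= rfourier phi xi).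
Hypothesis sumM : (\esum_(j in [set j : int | (j != 0)%R]) Mj phi j <= L%:E)%E.

Lemma phi_hat_le_Mj (j : int) (xi : R) : Ipi R xi ->
  ((phi_hat phi (xi + 2 * pi * j%:~R))%:E <= Mj phi j)%E.
Proof. by move=> Dxi; apply: ereal_sup_ubound; exists xi. Qed.

Lemma Mj_ge0 (j : int) : (0 <= Mj phi j)%E.
Proof.
apply: (@le_trans _ _ (phi_hat phi (0 + 2 * pi * j%:~R))%:E).
  by rewrite lee_fin phi_hat_ge0.
by apply: phi_hat_le_Mj; rewrite /Ipi /= in_itv /= oppr_le0 pi_ge0.
Qed.

Lemma sum_Mj_seq (s : seq int) : uniq s -> (forall j, j \in s -> j != 0) ->
  (\sum_(j <- s) Mj phi j <= L%:E)%E.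
Proof.
move=> us s0; apply: le_trans sumM; rewrite fsbig_seq//.
apply: ereal_sup_ubound; exists [set` s] => //; split; first exact: finite_seq.
by move=> j /s0.
Qed.

Definition outer_weight (t : R) : R := phi_hat phi t * \1_(~` Ipi R) t.

Lemma weight_outer_weight : weight outer_weight.
Proof.
apply: weightM; first exact: weight_phi_hat.
by apply: weight_indic; apply: measurableC; exact: measurable_Ipi.
Qed.

Section half_line.
Variables (k : nat -> int) (S : R -> R[i]) (K : R).
Hypotheses (k_inj : injective k) (k0 : forall n, k n != 0).
Hypothesis mS : cmeasurable setT S.
Hypothesis SK : forall a, (\int[mu]_t (ID t * sqc (S (t + a)))%:E <= K%:E)%E.

(** On a translate of [-pi, pi] the transform is replaced by its supremum there; the sum over n
    majorises [outer_weight] times |S|^2 on the translates that k enumerates. With k injective into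
    the nonzero integers, one argument over nat covers the positive and the negative translates. *)
Definition replica (n : nat) (t : R) : \bar R :=
  (Mj phi (k n) * (ID (t - 2 * pi * (k n)%:~R) * sqc (S t))%:E)%E.

Lemma replica_ge0 n t : (0 <= replica n t)%E.
Proof. by rewrite mule_ge0 ?Mj_ge0// lee_fin mulr_ge0 ?sqc_ge0// indicE. Qed.

Lemma measurable_replica n : measurable_fun setT (replica n).
Proof.
have [mD _] := weight_Ipi R.
apply: emeasurable_funM; first exact: measurable_cst.
apply/measurable_EFinP; apply: measurable_funM; last exact: measurable_dotc.
by apply: (measurableT_comp mD); exact: measurable_shift.
Qed.

(** Each term, translated back to [-pi, pi], is at most K times its supremum, because [SK] is
    uniform in the shift. The suprema have distinct nonzero indices and so sum to at most L. *)
Lemma integral_replica : (\int[mu]_t (\sum_(n <oo) replica n t) <= (L * K)%:E)%E.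
Proof.
have K0 : 0 <= K.
  rewrite -lee_fin; apply: le_trans (SK 0); apply: integral_ge0 => t _.
  by rewrite lee_fin mulr_ge0 ?sqc_ge0// indicE.
rewrite integral_nneseries//; last 2 first.
  exact: measurable_replica.
  by move=> n t _; exact: replica_ge0.
have I n : (\int[mu]_t replica n t <= Mj phi (k n) * K%:E)%E.
  have [mD _] := weight_Ipi R.
  have mF (a : R) : measurable_fun setT (fun t : R => ID (t - a) * sqc (S t)).
    apply: measurable_funM; last exact: measurable_dotc.
    by apply: (measurableT_comp mD); exact: measurable_shift.
  rewrite ge0_integralZl//; last 3 first.
  - by apply/measurable_EFinP; exact: mF.
  - by move=> t _; rewrite lee_fin mulr_ge0 ?sqc_ge0// indicE.
  - exact: Mj_ge0.
  apply: lee_wpmul2l; first exact: Mj_ge0.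
  set a := 2 * pi * (k n)%:~R.
  rewrite -(@integral_shift R (fun t => (ID (t - a) * sqc (S t))%:E) a); last 2 first.
  - by apply/measurable_EFinP; exact: mF.
  - by move=> t; rewrite lee_fin mulr_ge0 ?sqc_ge0// indicE.
  by under eq_integral do rewrite addrK; exact: SK.
apply: lime_le; first by apply: is_cvg_nneseries => n _ _; apply: integral_ge0 => t _;
  exact: replica_ge0.
apply: nearW => N.
apply: (@le_trans _ _ (\sum_(0 <= n < N) (Mj phi (k n) * K%:E))%E).
  by apply: lee_sum => n _; exact: I.
rewrite -ge0_sume_distrl; last by move=> n _; exact: Mj_ge0.
rewrite EFinM; apply: lee_wpmul2r; first by rewrite lee_fin.
rewrite -(big_map k predT (Mj phi)); apply: sum_Mj_seq.
  by rewrite map_inj_uniq// iota_uniq.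
by move=> j /mapP[n _ ->].
Qed.

Lemma le_replica n t : Ipi R (t - 2 * pi * (k n)%:~R) ->
  ((outer_weight t * sqc (S t))%:E <= \sum_(n <oo) replica n t)%E.
Proof.
move=> Dt; have D1 : ID (t - 2 * pi * (k n)%:~R) = 1 by rewrite indicE mem_set.
apply: (@le_trans _ _ (replica n t)).
  rewrite /replica D1 mul1r EFinM; apply: lee_wpmul2r.
    by rewrite lee_fin sqc_ge0.
  have := @phi_hat_le_Mj (k n) _ Dt; rewrite subrK; apply: le_trans.
  by rewrite lee_fin /outer_weight ler_piMr ?phi_hat_ge0// indicE; case: (_ \in _).
apply: le_trans (nneseries_lim_ge n.+1 (fun i _ _ => replica_ge0 i t)).
by rewrite big_nat_recr//= leeDr// sume_ge0// => i _; exact: replica_ge0.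
Qed.

End half_line.

Lemma outer_cover (t : R) : pi < t -> exists n : nat, Ipi R (t - 2 * pi * (Posz n.+1)%:~R).
Proof.
move=> tpi; have p0 := twopi_gt0 R.
pose y := (t - pi) / (2 * pi).
have y0 : 0 <= y by rewrite divr_ge0 ?subr_ge0 ?(ltW p0)// ltW.
have /andP[h1 h2] := truncn_itv y0.
(* With n the integer part of (t - pi) / (2 pi), the point t lies in translate number n + 1, never
   in the central interval. *)
exists (Num.truncn y); rewrite /Ipi /= in_itv /= -pmulrn.
rewrite -[(Num.truncn y).+1%:R]natr1 in h2 *.
move: ((Num.truncn y)%:R : R) h1 h2 => n.
rewrite /y ler_pdivlMr// ltr_pdivrMr//.
have := pi_gt0 R; move: (pi : R) => p p_gt0 h1 h2.
rewrite (_ : 2 * p * (n + 1) = n * (2 * p) + 2 * p); last by ring.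
rewrite mulrDl mul1r in h2.
by move: (n * (2 * p)) h1 h2 => q h1 h2; apply/andP; split; lra.
Qed.

(** The positive and the negative translates are each charged the full sum L, whence the factor
    2. *)
Lemma outer_bound (S : R -> R[i]) (K : R) : cmeasurable setT S ->
  (forall a, (\int[mu]_t (ID t * sqc (S (t + a)))%:E <= K%:E)%E) ->
  L2w outer_weight S /\ ip outer_weight S S <= 2 * L * K.
Proof.
move=> mS SK; have [mw w0] := weight_outer_weight.
pose k1 n := Posz n.+1; pose k2 n := - Posz n.+1.
have k1i : injective k1 by move=> m n [].
have k2i : injective k2 by move=> m n /oppr_inj[].
have k10 n : k1 n != 0 by [].
have k20 n : k2 n != 0 by [].
have I1 := integral_replica k1i k10 mS SK; have I2 := integral_replica k2i k20 mS SK.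
have mr k : measurable_fun setT (fun t => \sum_(n <oo) replica k S n t)%E.
  rewrite (_ : (fun t => _) = (fun t => \sum_(n <oo | n \in xpredT) replica k S n t)%E)//.
  apply: ge0_emeasurable_sum; last by move=> n _; exact: measurable_replica.
  by move=> n t _ _; exact: replica_ge0.
have r0 k t : (0 <= \sum_(n <oo) replica k S n t)%E.
  by apply: nneseries_ge0 => n _ _; exact: replica_ge0.
have mG : measurable_fun setT (fun t => outer_weight t * sqc (S t)).
  by apply: measurable_funM => //; exact: measurable_dotc.
have B : (\int[mu]_t (outer_weight t * sqc (S t))%:E <= (2 * L * K)%:E)%E.
  apply: (@le_trans _ _ (\int[mu]_t ((\sum_(n <oo) replica k1 S n t) + \sum_(n <oo) replica k2 S
    n t))%E).
    apply: ge0_le_integral => //.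
    - by move=> t _; rewrite lee_fin mulr_ge0 ?sqc_ge0.
    - by apply/measurable_EFinP; exact: mG.
    - exact: (emeasurable_funD (mr k1) (mr k2)).
    move=> t _; have [tp|] := leP t pi; last first.
      move=> /outer_cover[n Dn]; apply: le_trans (@le_replica k1 S n t Dn) _.
      exact: leeDl.
    have [pt|] := leP (- pi) t.
      rewrite /outer_weight indicE memNset ?mulr0 ?mul0r ?adde_ge0//.
      by apply: contra_notP => //; rewrite /Ipi /= in_itv /= pt tp.
    rewrite ltrNr => /outer_cover[n Dn]; apply: le_trans (@le_replica k2 S n t _) _.
      move: Dn; rewrite /Ipi /k2 /= !in_itv /= mulrNz mulrN opprK.
      by move: ((Posz n.+1)%:~R) => z /andP[? ?]; apply/andP; split; lra.
    exact: leeDr.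
  rewrite (ge0_integralD mu measurableT (fun t _ => r0 k1 t) (mr k1) (fun t _ => r0 k2 t) (mr
    k2)).
  have -> : 2 * L * K = L * K + L * K by ring.
  by rewrite EFinD; exact: leeD I1 I2.
have LS : L2w outer_weight S.
  split => //; apply/integrableP; split; first by apply/measurable_EFinP; exact: mG.
  under eq_integral.
    move=> t _; rewrite gee0_abs; first over.
    by rewrite lee_fin mulr_ge0 ?sqc_ge0.
  exact: le_lt_trans B (ltry _).
by split => //; rewrite -lee_fin -integral_ip.
Qed.

End outer_bound.

(** * The error estimate *)

Section core_estimate.
Variable R : realType.
Notation mu := (@lebesgue_measure R).
Notation ID := (\1_(Ipi R) : R -> R).
Variables (x : int -> R) (C : R).
Hypotheses (C0 : 0 < C) (frame : forall A c,
  nrm ID (tsum x A c) <= C * Num.sqrt (energy A c) /\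
  Num.sqrt (energy A c) <= C * nrm ID (tsum x A c)).
Variables (phi : R -> R) (m B : R).
Hypotheses (phi1 : A1 phi) (phi_ge0 : forall xi, 0 <= rfourier phi xi).
Hypotheses (m0 : 0 < m) (phi_hat_m : forall xi, Ipi R xi -> m <= phi_hat phi xi).
Hypotheses (B0 : 0 <= B)
  (sumM : (\esum_(j in [set j : int | (j != 0)%R]) Mj phi j <= (B * m)%:E)%E).

Let wD := weight_Ipi R.
Let iD := integrable_Ipi R.
Let wp := weight_phi_hat phi1 phi_ge0.
Let iphat := integrable_phi_hat phi1.
Let wo := weight_outer_weight phi1 phi_ge0.

Lemma outer_weight_le xi : outer_weight phi xi <= phi_hat phi xi.
Proof. by rewrite /outer_weight ler_piMr ?phi_hat_ge0// indicE; case: (_ \in _). Qed.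

Lemma L2w_outer_weight (g : R -> R[i]) : L2w (phi_hat phi) g -> L2w (outer_weight phi) g.
Proof. by apply: L2w_sub => //; exact: outer_weight_le. Qed.

Definition hat_mul (g : R -> R[i]) (xi : R) : R[i] := (phi_hat phi xi)%:C * g xi.

Lemma sqc_real (a : R) : sqc a%:C = a ^+ 2.
Proof. by rewrite /sqc /dotc /= mul0r addr0 expr2. Qed.

Lemma L2w_hat_mul g : L2w ID g -> L2w ID (hat_mul g).
Proof.
move=> Lg; apply: (@L2wM _ _ _ _ (2 * fourier_bound (fun t => (phi t)%:C) ^+ 2)) => //.
  by apply: cmeasurable_real; have [] := wp.
by move=> t; rewrite -rfourierE//; apply: sqc_fourier_le; have [] := phi1.
Qed.

Lemma ip_phi_hat_split (g h : R -> R[i]) : L2w ID g -> L2w ID h ->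
  L2w (phi_hat phi) g -> L2w (phi_hat phi) h ->
  ip (phi_hat phi) g h = ip ID (hat_mul g) h + ip (outer_weight phi) g h.
Proof.
move=> LDg LDh Lg Lh; rewrite -RintegralD//; last 2 first.
- by apply: ip_integrable => //; exact: L2w_hat_mul.
- by apply: ip_integrable => //; exact: L2w_outer_weight.
apply: eq_Rintegral => xi _; rewrite dotcZl /outer_weight !indicE in_setC.
by case: (xi \in Ipi R); rewrite /= ?mul1r ?mulr1 ?mul0r ?mulr0 ?mul0r ?addr0 ?add0r.
Qed.

Lemma integral_shift_le (S : R -> R[i]) (K a : R) : L2w ID (fun t => S (t + a)) ->
  nrm ID (fun t => S (t + a)) ^+ 2 <= K ->
  (\int[mu]_t (ID t * sqc (S (t + a)))%:E <= K%:E)%E.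
Proof. by move=> LS; rewrite sqr_nrm// (integral_ip wD LS) lee_fin. Qed.

Lemma outer_const_ge0 : 0 <= 2 * B * m.
Proof. by rewrite !mulr_ge0// ltW. Qed.

Lemma nrm_outer_weight_tsum A c : nrm (outer_weight phi) (tsum x A c) <=
  Num.sqrt (2 * B * m) * (C * Num.sqrt (energy A c)).
Proof.
have LT := L2w_tsum x A c wD iD.
have E a : (fun t => tsum x A c (t + a)) = tsum x A (fun j => c j * node (x j) a).
  by apply/funext => t; exact: tsum_shift.
have H a : (\int[mu]_t (ID t * sqc (tsum x A c (t + a)))%:E <= (C ^+ 2 * energy A c)%:E)%E.
  apply: integral_shift_le; rewrite E; first exact: L2w_tsum.
  rewrite -(energy_twist x A c a) -[energy _ _]sqr_sqrtr ?energy_ge0// -exprMn.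
  rewrite ler_pXn2r ?nnegrE ?nrm_ge0 ?mulr_ge0 ?sqrtr_ge0 ?(ltW C0)//.
  by have [] := frame A (fun j => c j * node (x j) a).
have [_ H2] := outer_bound phi1 phi_ge0 sumM LT.1 H.
rewrite -(@ler_pXn2r _ 2)// ?nnegrE ?nrm_ge0 ?mulr_ge0 ?sqrtr_ge0 ?(ltW C0)//.
rewrite sqr_nrm// !exprMn !sqr_sqrtr ?energy_ge0 ?outer_const_ge0//.
by rewrite (le_trans H2)// !mulrA.
Qed.

(** An exponential has constant modulus, so all its shifts have the same norm on [-pi, pi]. This
    handles evaluation at an arbitrary t, which need not be a node. *)
Lemma nrm_outer_weight_cnode z t : nrm (outer_weight phi) (fun xi => z * node t xi) <=
  Num.sqrt (2 * B * m) * (Num.sqrt (2 * pi) * normc z).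
Proof.
have H a : (\int[mu]_xi (ID xi * sqc (z * node t (xi + a)))%:E <= (sqc z * (2 * pi))%:E)%E.
  under eq_integral do rewrite sqc_cnode.
  have LT := L2w_cnode z t wD iD.
  have := integral_ip wD LT; rewrite (_ : ip _ _ _ = sqc z * (2 * pi)).
    by move=> <-; under [X in (_ <= X)%E]eq_integral do rewrite sqc_cnode.
  rewrite -integral_Ipi -RintegralZl//; apply: eq_Rintegral => xi _.
  by rewrite -/(sqc _) sqc_cnode mulrC.
have [_ H2] := outer_bound phi1 phi_ge0 sumM (cmeasurable_cnode z t) H.
rewrite -(@ler_pXn2r _ 2)// ?nnegrE ?nrm_ge0 ?mulr_ge0 ?sqrtr_ge0 ?normc_nonneg//.
rewrite sqr_nrm// !exprMn !sqr_sqrtr ?outer_const_ge0 ?(ltW (twopi_gt0 _))//.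
rewrite -sqcE (_ : 2 * B * m * (2 * pi * sqc z) = 2 * (B * m) * (sqc z * (2 * pi)))//; ring.
Qed.

Lemma nrm_cnode z t : nrm ID (fun xi => z * node t xi) <= Num.sqrt (2 * pi) * normc z.
Proof.
rewrite normc_sqrt -sqrtrM ?(ltW (twopi_gt0 _))// ler_wsqrtr// mulrC -integral_Ipi.
apply: nrm_bounded => //; first exact: cmeasurable_cnode.
by move=> xi; rewrite sqc_cnode.
Qed.

Definition translates A c (t : R) : R[i] := \sum_(j <- enum_fset A) c j * (phi (t - x j))%:C.

Lemma dotc_translates A c d t : dotc (translates A c t) d =
  kappa R * ip (phi_hat phi) (tsum x A c) (fun xi => d * node t xi).
Proof.
rewrite dotc_sum ip_suml//; [|by move=> j; exact: L2w_cnode|exact: L2w_cnode].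
by rewrite mulr_sumr; apply: eq_bigr => j _; rewrite -phi_inversion.
Qed.

Section with_function.
Variables (f fhat : R -> R[i]).
Hypothesis Lfh : L2w ID fhat.
Hypothesis f_inv : forall d t, dotc (f t) d = kappa R * ip ID fhat (fun xi => d * node t xi).

(* Equal to m / phi_hat on [-pi, pi]; the maximum keeps it below 1 elsewhere. *)
Definition damping (xi : R) : R := m / Num.max (phi_hat phi xi) m.
Definition damped (xi : R) : R[i] := (damping xi)%:C * fhat xi.

Lemma damping_den_gt0 xi : 0 < Num.max (phi_hat phi xi) m.
Proof. by rewrite lt_max m0 orbT. Qed.

Lemma damping_gt0 xi : 0 < damping xi.
Proof. by rewrite divr_gt0// damping_den_gt0. Qed.

Lemma damping_le1 xi : damping xi <= 1.
Proof. by rewrite ler_pdivrMr ?damping_den_gt0// mul1r le_max lexx orbT. Qed.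

Lemma dampingE xi : Ipi R xi -> damping xi * phi_hat phi xi = m.
Proof.
move=> Dxi; have pm := phi_hat_m Dxi; rewrite /damping max_l// divfK//.
by rewrite gt_eqF// (lt_le_trans m0).
Qed.

Lemma measurable_damping : measurable_fun setT damping.
Proof.
have [mp _] := wp; apply: measurable_funM => //.
(* The inverse is written as a power, for which measurability is available. *)
have E : (fun xi => (Num.max (phi_hat phi xi) m)^-1) = (fun xi => Num.max (phi_hat phi xi) m `^
  (-1)).
  by apply/funext => xi; rewrite powR_inv1// ltW// damping_den_gt0.
rewrite E; apply: (measurableT_comp (measurable_powR (R := R) (-1))).
exact: measurable_maxr.
Qed.

Lemma L2w_damping g : L2w ID g -> L2w ID (fun xi => (damping xi)%:C * g xi).
Proof.
move=> Lg; apply: (@L2wM _ _ _ _ 1) => //.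
  by apply: cmeasurable_real; exact: measurable_damping.
by move=> t; rewrite sqc_real expr_le1// ?damping_le1// ltW// damping_gt0.
Qed.

Section with_coefficients.
Variables (A : {fset int}) (c : int -> R[i]) (eps : R).
Let S := tsum x A c.
Hypothesis eps0 : 0 <= eps.
(** The errors at the nodes have l2 norm at most eps, stated by duality over finite sets.
    Truncations of an interpolating sequence satisfy this, and through [sum_error] it bounds
    pairings with exponential sums. *)
Hypothesis near_interp : forall A' d,
  `|\sum_(n <- enum_fset A') dotc (f (x n) - translates A c (x n)) (d n)|
    <= eps * Num.sqrt (energy A' d).

Definition resid (xi : R) : R[i] := fhat xi - hat_mul S xi.

Let LDS : L2w ID S. Proof. exact: L2w_tsum. Qed.
Let LPS : L2w (phi_hat phi) S. Proof. exact: L2w_tsum. Qed.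
Let LWS : L2w (outer_weight phi) S. Proof. exact: L2w_outer_weight. Qed.
Let LDr : L2w ID resid. Proof. by apply: L2wB => //; exact: L2w_hat_mul. Qed.

Lemma dotc_error d t : dotc (f t - translates A c t) d =
  kappa R * (ip ID resid (fun xi => d * node t xi) - ip (outer_weight phi) S (fun xi => d * node
    t xi)).
Proof.
have LDn := L2w_cnode d t wD iD; have LPn := L2w_cnode d t wp iphat.
rewrite dotcBl f_inv dotc_translates ip_phi_hat_split// ipBl//; last exact: L2w_hat_mul.
by ring.
Qed.

(** [e1] is eps divided by [kappa], with one lower Riesz bound. [K] comes from bounding the outer
    norms of S and of a test sum: each gives sqrt(2 B m), an upper and a lower Riesz constant. The
    factor m stays with s. *)
Let s := nrm ID S.
Let rho := nrm ID resid.
Let tau := nrm ID damped.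
Let e1 := (kappa R)^-1 * eps * C.
Let K := 2 * B * C ^+ 4.

Lemma sum_error A' d :
  \sum_(n <- enum_fset A') dotc (f (x n) - translates A c (x n)) (d n) =
  kappa R * (ip ID resid (tsum x A' d) - ip (outer_weight phi) S (tsum x A' d)).
Proof.
under eq_bigr do rewrite dotc_error; rewrite -mulr_sumr sumrB; congr (_ * (_ - _)).
  rewrite ipC ip_suml//; last by move=> j; exact: L2w_cnode.
  by apply: eq_bigr => j _; rewrite ipC.
rewrite ipC ip_suml//; last by move=> j; apply: L2w_outer_weight; exact: L2w_cnode.
by apply: eq_bigr => j _; rewrite ipC.
Qed.

Lemma ip_resid_tsum A' d : `|ip ID resid (tsum x A' d)| <= (e1 + K * (m * s)) * nrm ID (tsum x
  A' d).
Proof.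
have k0 := kappa_gt0 R; set h := tsum x A' d.
have LWh : L2w (outer_weight phi) h by apply: L2w_outer_weight; exact: L2w_tsum.
have -> : ip ID resid h = (kappa R)^-1 *
    (\sum_(n <- enum_fset A') dotc (f (x n) - translates A c (x n)) (d n)) + ip (outer_weight
      phi) S h.
  by rewrite sum_error mulKf ?gt_eqF// subrK.
have [_ E'] := frame A' d; have [_ E] := frame A c.
rewrite (le_trans (ler_normD _ _))// mulrDl lerD//.
  rewrite normrM ger0_norm ?invr_ge0 ?(ltW k0)// /e1 -!mulrA ler_wpM2l ?invr_ge0 ?(ltW k0)//.
  by rewrite (le_trans (near_interp _ _))// ler_wpM2l.
rewrite (le_trans (cauchy_schwarz wo LWS LWh))//.
have H1 := nrm_outer_weight_tsum A c; have H2 := nrm_outer_weight_tsum A' d.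
apply: (@le_trans _ _ ((Num.sqrt (2 * B * m) * (C * (C * s))) * (Num.sqrt (2 * B * m) * (C * (C
  * nrm ID h))))).
  apply: ler_pM; rewrite ?nrm_ge0//.
    by rewrite (le_trans H1)// !ler_wpM2l ?sqrtr_ge0 ?(ltW C0).
  by rewrite (le_trans H2)// !ler_wpM2l ?sqrtr_ge0 ?(ltW C0).
rewrite (_ : _ * _ = Num.sqrt (2 * B * m) ^+ 2 * (C ^+ 4 * s * nrm ID h)); last by ring.
rewrite sqr_sqrtr ?outer_const_ge0// /K.
move: (nrm ID h) s {E E' H1 H2} => n s'.
by rewrite le_eqVlt; apply/orP; left; apply/eqP; ring.
Qed.

Lemma e1_ge0 : 0 <= e1.
Proof. by rewrite /e1 !mulr_ge0 ?(ltW C0)// invr_ge0 ltW// kappa_gt0. Qed.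

Lemma K_ge0 : 0 <= K.
Proof. by apply: mulr_ge0; [exact: mulr_ge0|apply: exprn_ge0; exact: ltW]. Qed.

Hypothesis dense : forall g e, L2w ID g -> 0 < e ->
  exists A' d, nrm ID (fun t => g t - tsum x A' d t) < e.

(* Duality: the bound of ip_resid_tsum extends to the norm by density. *)
Lemma resid_le : rho <= e1 + K * (m * s).
Proof.
set E := e1 + _.
have s0 : 0 <= s := nrm_ge0 _ _.
have E0 : 0 <= E.
  by apply: addr_ge0; [exact: e1_ge0|apply: mulr_ge0; [exact: K_ge0|apply: mulr_ge0 => //;
    exact: ltW]].
have rho0 : 0 <= rho := nrm_ge0 _ _.
have H delta : 0 < delta -> rho ^+ 2 <= E * rho + delta * (E + rho).
  move=> d0; have [A' [d Hd]] := dense LDr d0.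
  have LT := L2w_tsum x A' d wD iD; have LB := L2wB wD LDr LT.
  have h_le : nrm ID (tsum x A' d) <= rho + delta.
    have := nrmB wD LDr LB; rewrite (_ : (fun t => _) = tsum x A' d).
      by move=> H; apply: le_trans H _; rewrite lerD2l ltW.
    by apply/funext => t; rewrite opprB addrC subrK.
  have -> : rho ^+ 2 = ip ID resid (tsum x A' d) + ip ID resid (fun t => resid t - tsum x A' d t).
    by rewrite /rho sqr_nrm// ipBr// addrC subrK.
  rewrite (_ : _ + delta * _ = E * (rho + delta) + rho * delta); last by ring.
  apply: lerD; apply: le_trans (ler_norm _) _.
    by rewrite (le_trans (ip_resid_tsum _ _))// ler_wpM2l.
  by rewrite (le_trans (cauchy_schwarz wD LDr LB))// ler_wpM2l// ltW.
have H2 : rho ^+ 2 <= E * rho.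
  apply/ler_addgt0Pr => e e0.
  have ER : 0 < E + rho + 1 by rewrite ltr_wpDl// addr_ge0.
  rewrite (le_trans (H (e / (E + rho + 1)) _)) ?divr_gt0// lerD2l.
  rewrite mulrAC ler_pdivrMr// ler_pM2l// lerDl//.
move: rho0; rewrite le_eqVlt => /orP[/eqP <-//|rho0].
by rewrite -(ler_pM2r rho0) -expr2.
Qed.

Lemma ip_resid_S : - (e1 * s) <= ip ID resid S.
Proof.
have k0 := kappa_gt0 R; have [_ E'] := frame A c.
have -> : ip ID resid S = (kappa R)^-1 *
    (\sum_(n <- enum_fset A) dotc (f (x n) - translates A c (x n)) (c n)) + ip (outer_weight
      phi) S S.
  by rewrite sum_error mulKf ?gt_eqF// subrK.
rewrite -[leLHS]addr0 lerD ?ip_ge0// lerNl -mulrN /e1 -!mulrA ler_wpM2l ?invr_ge0 ?(ltW k0)//.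
apply: le_trans (ler_norm _) _; rewrite normrN (le_trans (near_interp _ _))//.
by rewrite ler_wpM2l.
Qed.

(* On [-pi, pi], damped = m S + damping * resid. Let w be the norm of
   damping * resid; pairing with resid gives w ^ 2 <= tau * rho + m * e1 * s, and
   m * s <= tau + w. *)
Lemma scaled_tsum_le : m * s <= (2 + K) * tau + 2 * e1.
Proof.
have s0 : 0 <= s := nrm_ge0 _ _; have tau0 : 0 <= tau := nrm_ge0 _ _.
have e10 := e1_ge0; have K0 := K_ge0.
pose qr xi := (damping xi)%:C * resid xi.
have Lqr : L2w ID qr by exact: L2w_damping.
have Ld : L2w ID damped by exact: L2w_damping.
pose w := nrm ID qr.
have w0 : 0 <= w := nrm_ge0 _ _.
have dE xi : Ipi R xi -> damped xi = qr xi + m%:C * S xi.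
  move=> Dxi; rewrite /qr /damped /resid /hat_mul mulrBr mulrA -rmorphM dampingE//.
  by rewrite subrK.
have Lms : L2w ID (fun xi => m%:C * S xi) by exact: L2wZ.
have msE : nrm ID (fun xi => m%:C * S xi) = m * s.
  by rewrite /nrm ipZl// ipZr// mulrA -expr2 sqrtrM ?sqr_ge0// sqrtr_sqr gtr0_norm.
have IDP (g g' h : R -> R[i]) : (forall xi, Ipi R xi -> g xi = g' xi) -> ip ID g h = ip ID g' h.
  move=> E; apply: eq_Rintegral => xi _; rewrite indicE.
  by case: (boolP (xi \in Ipi R)) => [/set_mem /E ->//|_]; rewrite !mul0r.
have h1 : m * s <= tau + w.
  rewrite -msE; have := nrmB wD Ld Lqr; apply: le_trans.
  rewrite le_eqVlt; apply/orP; left; apply/eqP; congr Num.sqrt.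
  have E xi : Ipi R xi -> m%:C * S xi = damped xi - qr xi.
    by move=> Dxi; rewrite dE// addrC addKr.
  by rewrite (IDP _ _ _ E) ipC (IDP _ _ _ E).
(* Since 0 < damping <= 1, w ^ 2 is at most the pairing of qr with resid, and qr = damped - m S on
   [-pi, pi]; [ip_resid_S] bounds the contribution of S. *)
have h2 : w ^+ 2 <= tau * rho + m * (e1 * s).
  have -> : tau * rho + m * (e1 * s) = tau * rho - m * - (e1 * s) by ring.
  apply: (@le_trans _ _ (ip ID damped resid - m * ip ID resid S)); last first.
    apply: lerB; first exact: le_trans (ler_norm _) (cauchy_schwarz wD Ld LDr).
    by rewrite ler_pM2l// ip_resid_S.
  have -> : ip ID damped resid - m * ip ID resid S = ip ID qr resid.
    rewrite (IDP _ _ _ dE) ipDl// ipZl// [ip ID S _]ipC; ring.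
  rewrite sqr_nrm//; apply: le_RintegralT; [exact: ip_integrable..|].
  move=> xi; have D1 : 0 <= ID xi by rewrite indicE.
  have q0 := ltW (damping_gt0 xi); have q1 := damping_le1 xi.
  have r0 := sqc_ge0 (resid xi); rewrite /qr.
  have -> : dotc ((damping xi)%:C * resid xi) ((damping xi)%:C * resid xi) = damping xi *
    (damping xi * sqc (resid xi)).
    by rewrite dotcZl dotcC dotcZl.
  rewrite dotcZl -/(sqc _) ler_wpM2l// ler_wpM2l// ler_piMl//.
have h3 := resid_le.
have h4 : w ^+ 2 <= tau * (e1 + K * (m * s)) + e1 * (m * s).
  rewrite (_ : e1 * (m * s) = m * (e1 * s)); last by ring.
  by rewrite (le_trans h2)// lerD2r ler_wpM2l.
move: (m * s) (mulr_ge0 (ltW m0) s0) h1 h4 => sg sg0 h1 h4.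
(* The claim is immediate for m s <= tau. Otherwise tau * e1 <= e1 * (m s), so w ^ 2 <= (K tau + 2
   e1) (m s); the arithmetic-geometric mean inequality bounds w by half of the sum, and h1 absorbs
   half of m s. *)
have [le|lt] := leP sg tau.
  by rewrite (le_trans le)// mulrDl; nra.
have h5 : w <= (K * tau + 2 * e1 + sg) / 2.
  have Kt : 0 <= K * tau by exact: mulr_ge0.
  have N0 : 0 <= (K * tau + 2 * e1 + sg) / 2 by lra.
  rewrite -(@ler_pXn2r _ 2)//.
  apply: (@le_trans _ _ ((K * tau + 2 * e1) * sg)).
    apply: (le_trans h4).
    have h6 : tau * e1 <= e1 * sg by rewrite mulrC ler_wpM2l// ltW.
    rewrite (_ : (K * tau + 2 * e1) * sg = e1 * sg + tau * (K * sg) + e1 * sg); last by ring.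
    by rewrite mulrDr lerD2r lerD2r.
  rewrite -subr_ge0 (_ : _ - _ = ((K * tau + 2 * e1 - sg) / 2) ^+ 2) ?sqr_ge0//; by field.
have Kt : (2 + K) * tau = 2 * tau + K * tau by rewrite mulrDl.
by rewrite Kt; lra.
Qed.

(** The error z is tested against itself, so |z|^2 is at most |z| times the norms of the two parts;
    [kappa] cancels the norm sqrt(2 pi) of the exponential. The part outside contributes 2 B C^2 m
    s, with two factors C only, as the test function is a single exponential. *)
Lemma translates_error t : normc (f t - translates A c t) <=
  e1 + (K + 2 * B * C ^+ 2) * ((2 + K) * tau + 2 * e1).
Proof.
set z := f t - translates A c t.
have p0 := twopi_gt0 R; have k0 := kappa_gt0 R.
have s0 : 0 <= s := nrm_ge0 _ _; have rho0 : 0 <= rho := nrm_ge0 _ _.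
have kp : kappa R * Num.sqrt (2 * pi) = 1 by rewrite mulVf// gt_eqF// sqrtr_gt0.
have LDn := L2w_cnode z t wD iD.
have LWn : L2w (outer_weight phi) (fun xi => z * node t xi) by apply: L2w_outer_weight;
  exact: L2w_cnode.
have [_ E'] := frame A c.
have h1 : ip ID resid (fun xi => z * node t xi) <= rho * (Num.sqrt (2 * pi) * normc z).
  apply: le_trans (ler_norm _) _; rewrite (le_trans (cauchy_schwarz wD LDr LDn))// ler_wpM2l//.
  exact: nrm_cnode.
have h2 : - ip (outer_weight phi) S (fun xi => z * node t xi) <=
    (2 * B * m) * C ^+ 2 * s * (Num.sqrt (2 * pi) * normc z).
  apply: le_trans (ler_norm _) _; rewrite normrN (le_trans (cauchy_schwarz wo LWS LWn))//.
  apply: (@le_trans _ _ ((Num.sqrt (2 * B * m) * (C * (C * s))) *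
      (Num.sqrt (2 * B * m) * (Num.sqrt (2 * pi) * normc z)))).
    apply: ler_pM; [exact: nrm_ge0|exact: nrm_ge0| |exact: nrm_outer_weight_cnode].
    by rewrite (le_trans (nrm_outer_weight_tsum A c))// !ler_wpM2l ?sqrtr_ge0 ?(ltW C0).
  have := sqr_sqrtr outer_const_ge0; move: (Num.sqrt (2 * B * m)) => q <-.
  by rewrite le_eqVlt; apply/orP; left; apply/eqP; ring.
have h3 : sqc z <= (rho + (2 * B * m) * C ^+ 2 * s) * normc z.
  rewrite /sqc dotc_error -/z.
  apply: (@le_trans _ _ (kappa R * (rho * (Num.sqrt (2 * pi) * normc z) +
      (2 * B * m) * C ^+ 2 * s * (Num.sqrt (2 * pi) * normc z)))).
    by rewrite ler_pM2l// lerD.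
  rewrite le_eqVlt; apply/orP; left; apply/eqP; rewrite -mulrDl.
  by rewrite mulrCA [kappa R * _]mulrA kp mul1r.
have h4 : normc z <= rho + (2 * B * m) * C ^+ 2 * s.
  have := normc_nonneg z; rewrite le_eqVlt => /orP[/eqP <-|z0].
    have B2 : 0 <= 2 * B * m * C ^+ 2 by apply: mulr_ge0; [exact: outer_const_ge0|exact: sqr_ge0].
    by apply: addr_ge0 => //; exact: mulr_ge0.
  by rewrite -(ler_pM2r z0) -expr2 -sqcE.
apply: le_trans h4 _; apply: le_trans (lerD resid_le (lexx _)) _.
rewrite -addrA lerD2l.
have h5 := scaled_tsum_le; have K0 := K_ge0.
apply: (@le_trans _ _ ((K + 2 * B * C ^+ 2) * (m * s))); last first.
  have B2 : 0 <= 2 * B * C ^+ 2 by apply: mulr_ge0; [exact: mulr_ge0|exact: sqr_ge0].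
  by rewrite ler_wpM2l// addr_ge0.
by rewrite le_eqVlt; apply/orP; left; apply/eqP; ring.
Qed.

End with_coefficients.
End with_function.
End core_estimate.

(** * The interpolating sequence *)

Section interpolation.
Variable R : realType.
Notation mu := (@lebesgue_measure R).
Notation ID := (\1_(Ipi R) : R -> R).
Variables (x : int -> R) (C : R).
Hypotheses (C0 : 0 < C) (frame : forall A c,
  nrm ID (tsum x A c) <= C * Num.sqrt (energy A c) /\
  Num.sqrt (energy A c) <= C * nrm ID (tsum x A c)).
Variables (phi : R -> R) (m B : R).
Hypotheses (phi1 : A1 phi) (phi_ge0 : forall xi, 0 <= rfourier phi xi).
Hypotheses (m0 : 0 < m) (phi_hat_m : forall xi, Ipi R xi -> m <= phi_hat phi xi).
Hypotheses (B0 : 0 <= B)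
  (sumM : (\esum_(j in [set j : int | (j != 0)%R]) Mj phi j <= (B * m)%:E)%E).

Let wD := weight_Ipi R.
Let iD := integrable_Ipi R.
Let wp := weight_phi_hat phi1 phi_ge0.
Let iphat := integrable_phi_hat phi1.

(** P bounds the transform, Q the quadratic form of the translates, T their values. They depend on
    phi beyond m and B, and serve convergence and existence, not the final constant. *)
Let P := 1 + 2 * fourier_bound (fun t => (phi t)%:C) ^+ 2.
Let Q := (P + 2 * B * m) * C ^+ 2.
Let T := kappa R * Num.sqrt Q * Num.sqrt (\int[mu]_t phi_hat phi t).

Let phi_hat_leP xi : phi_hat phi xi <= P.
Proof.
have L1 : in_L1 (fun t => (phi t)%:C) by have [] := phi1.
have := sqc_fourier_le xi L1; rewrite -/(rfourier phi xi) rfourierE// sqc_real /P.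
by have := sqr_ge0 (phi_hat phi xi - 1); rewrite !expr2; nra.
Qed.

Let P0 : 0 <= P.
Proof. by apply: addr_ge0 => //; apply: mulr_ge0 => //; exact: sqr_ge0. Qed.

Let Q0 : 0 <= Q.
Proof.
by apply: mulr_ge0; [apply: addr_ge0 => //; exact: (outer_const_ge0 m0 B0)|exact: sqr_ge0].
Qed.

Let T0 : 0 <= T.
Proof. by rewrite !mulr_ge0 ?sqrtr_ge0// ltW// kappa_gt0. Qed.

(** The contribution outside [-pi, pi] is nonnegative and is discarded; inside, the transform is at
    least m. This is the coercivity behind invertibility and the bound on the solutions. *)
Lemma ip_phi_hat_ge A c : m * ip ID (tsum x A c) (tsum x A c) <= ip (phi_hat phi) (tsum x A c)
  (tsum x A c).
Proof.
rewrite -ipZw//; [|exact: L2w_tsum..].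
have wm : weight (fun t => m * ID t) by apply: weightZ => //; exact: ltW.
apply: ip_sub => //; last exact: L2w_tsum.
move=> t; rewrite indicE; case: (boolP (t \in Ipi R)) => [/set_mem /phi_hat_m|_].
  by rewrite mulr1.
by rewrite mulr0; have [] := wp.
Qed.

Lemma ip_phi_hat_le A c : ip (phi_hat phi) (tsum x A c) (tsum x A c) <= Q * energy A c.
Proof.
set S := tsum x A c.
have LD : L2w ID S by exact: L2w_tsum.
have LP : L2w (phi_hat phi) S by exact: L2w_tsum.
rewrite ip_phi_hat_split//.
have [H1 _] := frame A c; have H2 := nrm_outer_weight_tsum C0 frame phi1 phi_ge0 m0 B0 sumM A c.
have E0 := energy_ge0 A c.
rewrite /Q (_ : _ * energy _ _ = P * (C ^+ 2 * energy A c) + 2 * B * m * (C ^+ 2 * energy A c));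
  last by ring.
apply: lerD.
  have LPD : L2w (fun t => P * ID t) S.
    have [mS IS] := LD; split => //.
    by apply: eq_integrable (integrableRZ P IS) => // t _ /=; rewrite mulrA.
  apply: (@le_trans _ _ (P * ip ID S S)).
    rewrite -ipZw//; apply: le_RintegralT.
    - by apply: ip_integrable => //; exact: L2w_hat_mul.
    - by apply: ip_integrable => //; exact: weightZ.
    move=> t; rewrite dotcZl -/(sqc _) mulrA; apply: ler_wpM2r; first exact: sqc_ge0.
    by rewrite mulrC; apply: ler_wpM2r; [rewrite indicE|exact: phi_hat_leP].
  rewrite ler_wpM2l// -sqr_nrm// -[energy _ _]sqr_sqrtr// -exprMn ler_pXn2r// ?nnegrE ?nrm_ge0//.
  by rewrite mulr_ge0 ?sqrtr_ge0// ltW.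
have B2 := outer_const_ge0 m0 B0.
rewrite -sqr_nrm; last exact: weight_outer_weight.
rewrite -[energy _ _]sqr_sqrtr// -[2 * B * m]sqr_sqrtr// -!exprMn ler_pXn2r// ?nnegrE ?nrm_ge0//.
by rewrite !mulr_ge0 ?sqrtr_ge0// ltW.
Qed.

Lemma nrm_phi_hat_le A c : nrm (phi_hat phi) (tsum x A c) <= Num.sqrt Q * Num.sqrt (energy A c).
Proof. by rewrite -sqrtrM// ler_wsqrtr// ip_phi_hat_le. Qed.

Lemma sum_translatesE A c A' d :
  \sum_(n <- enum_fset A') dotc (translates x phi A c (x n)) (d n) =
  kappa R * ip (phi_hat phi) (tsum x A c) (tsum x A' d).
Proof.
under eq_bigr do rewrite dotc_translates//; rewrite -mulr_sumr; congr (_ * _).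
rewrite ipC ip_suml//; [|by move=> j; exact: L2w_cnode|exact: L2w_tsum].
by apply: eq_bigr => j _; rewrite ipC.
Qed.

Lemma sum_translates_le A c A' d :
  `|\sum_(n <- enum_fset A') dotc (translates x phi A c (x n)) (d n)| <=
  kappa R * Q * Num.sqrt (energy A c) * Num.sqrt (energy A' d).
Proof.
have k0 := kappa_gt0 R.
rewrite sum_translatesE normrM gtr0_norm//.
rewrite -[kappa R * Q * _]mulrA -[kappa R * _ * _]mulrA ler_pM2l//.
have LT A1 c1 : L2w (phi_hat phi) (tsum x A1 c1) by exact: L2w_tsum.
rewrite (le_trans (cauchy_schwarz wp (LT A c) (LT A' d)))//.
apply: le_trans (ler_pM (nrm_ge0 _ _) (nrm_ge0 _ _) (nrm_phi_hat_le A c) (nrm_phi_hat_le A' d)) _.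
by rewrite mulrACA -expr2 sqr_sqrtr// mulrA.
Qed.

Lemma translates_le A c t : normc (translates x phi A c t) <= T * Num.sqrt (energy A c).
Proof.
set z := translates _ _ _ _ _.
have := normc_nonneg z; rewrite le_eqVlt => /orP[/eqP <-|z0].
  by rewrite mulr_ge0 ?sqrtr_ge0.
rewrite -(ler_pM2r z0) -expr2 -sqcE /sqc {1}/z dotc_translates// /T -!mulrA.
rewrite ler_pM2l ?kappa_gt0//.
have LT : L2w (phi_hat phi) (tsum x A c) by exact: L2w_tsum.
have LN := L2w_cnode z t wp iphat.
rewrite (le_trans (ler_norm _))// (le_trans (cauchy_schwarz wp LT LN))//.
rewrite (_ : _ * (_ * (_ * normc z)) = (Num.sqrt Q * Num.sqrt (energy A c)) *
  (normc z * Num.sqrt (\int[mu]_t phi_hat phi t))); last by ring.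
apply: ler_pM; [exact: nrm_ge0|exact: nrm_ge0|exact: nrm_phi_hat_le|].
rewrite normc_sqrt -sqrtrM ?sqc_ge0// ler_wsqrtr//.
apply: nrm_bounded => //; first exact: cmeasurable_cnode.
by move=> xi; rewrite sqc_cnode.
Qed.

Lemma energy0 A (c : int -> R[i]) : energy A c = 0 -> forall j, j \in A -> c j = 0.
Proof.
move=> E j jA; have : energy A c = \sum_(k <- enum_fset A) sqc (c k) by [].
rewrite E (big_rem j)//= => /esym/eqP; rewrite paddr_eq0 ?sqc_ge0//; last first.
  by elim/big_ind: _ => // [*|k _]; [exact: addr_ge0|exact: sqc_ge0].
by move=> /andP[/eqP]; rewrite sqcE => /eqP; rewrite sqrf_eq0 => /eqP /eq0_normc.
Qed.

(* The matrices phi (x n - x j), with n and j in a finite set, are positive definite. *)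
Lemma translates_inj A c : (forall n, n \in A -> translates x phi A c (x n) = 0) ->
  forall j, j \in A -> c j = 0.
Proof.
move=> H; apply: energy0.
have := sum_translatesE A c A c.
rewrite big_seq big1; last by move=> n nA; rewrite H// /dotc /= !mul0r addr0.
move=> /esym/eqP; rewrite mulf_eq0 gt_eqF ?kappa_gt0//= => /eqP E.
have := ip_phi_hat_ge A c; rewrite E pmulr_rle0// => H1.
have N0 : nrm ID (tsum x A c) = 0 by exact: ler0_sqrtr.
have [_] := frame A c; rewrite N0 mulr0 => H2.
by apply/eqP; rewrite eq_le energy_ge0 andbT -sqrtr_eq0 eq_le H2 sqrtr_ge0.
Qed.

Lemma finite_interp A (b : int -> R[i]) :
  exists c, forall n, n \in A -> translates x phi A c (x n) = b n.
Proof.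
set s := enum_fset A; set N := size s.
have us : uniq s by exact: fset_uniq.
(* Reads a row vector as coefficients on A through positions in s, with value 0 off A. *)
pose cof (u : 'rV[R[i]]_N) (j : int) : R[i] :=
  if insub (index j s) is Some i then u 0 i else 0.
have cofE u (i : 'I_N) : cof u (nth 0 s i) = u 0 i.
  by rewrite /cof index_uniq// insubT// => lt; congr (u 0 _); exact: val_inj.
pose G : 'M[R[i]]_N := \matrix_(i, j) (phi (x (nth 0 s j) - x (nth 0 s i)))%:C.
have GE u (j : 'I_N) : (u *m G) 0 j = translates x phi A (cof u) (x (nth 0 s j)).
  rewrite mxE /translates -/s (big_nth 0) big_mkord.
  by apply: eq_bigr => i _; rewrite mxE cofE.
have Gunit : G \in unitmx.
  rewrite -row_free_unit; apply: inj_row_free => u uG.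
  apply/rowP => j; rewrite mxE -cofE; apply: (@translates_inj A); last exact: mem_nth.
  move=> n nA; have nlt : (index n s < N)%N by rewrite index_mem.
  have := GE u (Ordinal nlt); rewrite uG mxE nth_index//.
exists (cof ((\row_j b (nth 0 s j)) *m invmx G)) => n nA.
have nlt : (index n s < N)%N by rewrite index_mem.
have := GE ((\row_j b (nth 0 s j)) *m invmx G) (Ordinal nlt).
by rewrite mulmxKV// mxE /= nth_index.
Qed.

(** The equations are tested with the solution itself: m |S|^2 <= <fhat, S> on [-pi, pi]. The bound
    does not depend on A, which makes the limit of the finite sections possible. *)
Lemma finite_interp_energy (f fhat : R -> R[i]) A c : L2w ID fhat ->
  (forall d t, dotc (f t) d = kappa R * ip ID fhat (fun xi => d * node t xi)) ->
  (forall n, n \in A -> translates x phi A c (x n) = f (x n)) ->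
  Num.sqrt (energy A c) <= C * (nrm ID fhat / m).
Proof.
move=> Lf f_inv fA; have k0 := kappa_gt0 R.
have LT : L2w ID (tsum x A c) by exact: L2w_tsum.
have E : ip (phi_hat phi) (tsum x A c) (tsum x A c) = ip ID fhat (tsum x A c).
  apply: (@mulfI _ (kappa R)); first by rewrite gt_eqF.
  rewrite -sum_translatesE big_seq.
  under eq_bigr => n nA do rewrite fA// f_inv.
  rewrite -big_seq -mulr_sumr; congr (_ * _).
  rewrite [RHS]ipC ip_suml//; last by move=> j; exact: L2w_cnode.
  by apply: eq_bigr => j _; rewrite ipC.
have [_ H] := frame A c; apply: le_trans H _; rewrite ler_pM2l// ler_pdivlMr//.
set s := nrm ID (tsum x A c).
have h : m * s ^+ 2 <= nrm ID fhat * s.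
  rewrite sqr_nrm// (le_trans (ip_phi_hat_ge _ _))// E.
  by rewrite (le_trans (ler_norm _))// (cauchy_schwarz wD Lf LT).
have : 0 <= s := nrm_ge0 _ _; rewrite le_eqVlt => /orP[/eqP <-|s0].
  by rewrite mul0r nrm_ge0.
by rewrite -(ler_pM2r s0) mulrAC mulrC -expr2.
Qed.

End interpolation.

(** * Square-summable coefficients and passage to the limit *)

Section square_summable.
Variable R : realType.
Implicit Types (A B : {fset int}) (a c d : int -> R[i]) (x : int -> R) (phi : R -> R).

(** With [in_l2_energy], this replaces square summability by boundedness of the finite energies. *)
Lemma energy_le_l2 a : in_l2 a -> exists N : R, forall A, energy A a <= N.
Proof.
rewrite /in_l2 /l2norm => /lty_poweRy; rewrite invr_eq0 pnatr_eq0 => /(_ isT) oo.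
have E0 : (0 <= \esum_(j in [set: int]) (normc (a j) ^+ 2)%:E)%E.
  by apply: esum_ge0 => j _; rewrite lee_fin sqr_ge0.
have F : (\esum_(j in [set: int]) (normc (a j) ^+ 2)%:E)%E \is a fin_num by rewrite ge0_fin_numE.
exists (fine (\esum_(j in [set: int]) (normc (a j) ^+ 2)%:E)%E) => A.
rewrite -lee_fin fineK// /energy -sumEFin.
under eq_bigr do rewrite sqcE.
rewrite fsbig_seq; last exact: fset_uniq.
by apply: ereal_sup_ubound; exists [set` enum_fset A] => //; split=> //; exact: finite_seq.
Qed.

Lemma in_l2_energy a (N : R) : (forall A, energy A a <= N) -> in_l2 a.
Proof.
move=> H; rewrite /in_l2 /l2norm; apply: poweR_lty.
apply: (@le_lt_trans _ _ N%:E); last exact: ltry.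
apply: ge_ereal_sup => _ [X [fX _] <-].
rewrite fsbig_finite//= sumEFin lee_fin; apply: le_trans (H (fset_set X)).
by rewrite le_eqVlt; apply/orP; left; apply/eqP; apply: eq_bigr => j _; rewrite sqcE.
Qed.

Lemma big_fsetD (V : nmodType) A B (F : int -> V) : (A `<=` B)%fset ->
  \sum_(j <- enum_fset B) F j =
  \sum_(j <- enum_fset A) F j + \sum_(j <- enum_fset (B `\` A)%fset) F j.
Proof.
move=> AB; rewrite (big_fsetID _ (mem A)) /=; congr (_ + _).
  by apply: eq_fbigl => j; rewrite !inE /=; case: (boolP (j \in A)) => jA;
    rewrite ?andbF ?andbT//; exact: (fsubsetP AB).
by apply: eq_fbigl => j; rewrite !inE /= andbC.
Qed.

Lemma energyS A B a : (A `<=` B)%fset -> energy A a <= energy B a.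
Proof. by move=> AB; rewrite /energy (big_fsetD _ AB) lerDl energy_ge0. Qed.

(** A0 nearly attains the supremum of the energies, so little energy is left outside it. *)
Lemma energy_tail a (N e : R) : (forall A, energy A a <= N) -> 0 < e ->
  exists A0, forall B, (A0 `<=` B)%fset -> energy (B `\` A0)%fset a <= e.
Proof.
move=> H e0; pose E := [set energy A a | A in [set: {fset int}]].
have sE : has_sup E.
  split; first by exists (energy fset0 a); exists fset0.
  by exists N => _ [A _ <-].
have [_ [A0 _ <-] h] := sup_adherent e0 sE.
exists A0 => B AB.
have h2 : energy B a <= sup E by apply: ub_le_sup; [exact: sE.2|exists B].
have : energy B a = energy A0 a + energy (B `\` A0)%fset a by rewrite /energy (big_fsetD _ AB).
by lra.
Qed.

Lemma near_totally A0 (Pr : {fset int} -> Prop) :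
  (forall B, (A0 `<=` B)%fset -> Pr B) -> \forall B \near @summability.totally int, Pr B.
Proof. by move=> H; exists A0. Qed.

Lemma translatesD x phi A B a t : (A `<=` B)%fset ->
  translates x phi B a t = translates x phi A a t + translates x phi (B `\` A)%fset a t.
Proof. exact: big_fsetD. Qed.

Lemma translatesB x phi A a c t :
  translates x phi A a t - translates x phi A c t = translates x phi A (fun j => a j - c j) t.
Proof. by rewrite /translates -sumrB; apply: eq_bigr => j _; rewrite mulrBl. Qed.

Lemma normc_ReIm (z : R[i]) : normc z <= `|complex.Re z| + `|complex.Im z|.
Proof.
rewrite -(@ler_pXn2r _ 2)// ?nnegrE ?normc_nonneg ?addr_ge0// -sqcE /sqc /dotc -!expr2.
rewrite -[X in X + _]real_normK ?num_real// -[X in _ + X]real_normK ?num_real//.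
by rewrite sqrrD -addrA lerD2l -[leLHS]add0r lerD// mulrn_wge0// mulr_ge0.
Qed.

Lemma Re_le_normc (z : R[i]) : `|complex.Re z| <= normc z.
Proof.
rewrite -(@ler_pXn2r _ 2)// ?nnegrE ?normc_nonneg// -sqcE /sqc /dotc real_normK ?num_real//.
by rewrite -expr2 lerDl -expr2 sqr_ge0.
Qed.

Lemma Im_le_normc (z : R[i]) : `|complex.Im z| <= normc z.
Proof.
rewrite -(@ler_pXn2r _ 2)// ?nnegrE ?normc_nonneg// -sqcE /sqc /dotc real_normK ?num_real//.
by rewrite -!expr2 lerDr sqr_ge0.
Qed.

Lemma Re_sum I (s : seq I) (F : I -> R[i]) :
  complex.Re (\sum_(i <- s) F i) = \sum_(i <- s) complex.Re (F i).
Proof.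
elim: s => [|i s IH]; rewrite ?big_nil ?big_cons//.
by rewrite -IH; case: (F i) (\sum_(j <- s) F j) => [? ?] [].
Qed.

Lemma Im_sum I (s : seq I) (F : I -> R[i]) :
  complex.Im (\sum_(i <- s) F i) = \sum_(i <- s) complex.Im (F i).
Proof.
elim: s => [|i s IH]; rewrite ?big_nil ?big_cons//.
by rewrite -IH; case: (F i) (\sum_(j <- s) F j) => [? ?] [].
Qed.

Let totally_proper := @summability.totally_filter int.
Existing Instance totally_proper.

(** The Cauchy criterion for unconditional sums: by completeness [sum] is the limit and not an
    arbitrary value. *)
Lemma cvg_totally (u : int -> R) :
  (forall e : R, 0 < e -> exists A0, forall B, (A0 `<=` B)%fset ->
     `|\sum_(j <- enum_fset B) u j - \sum_(j <- enum_fset A0) u j| <= e) ->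
  forall e : R, 0 < e -> \forall B \near @summability.totally int,
    `|\sum_(j <- enum_fset B) u j - @summability.sum int R R^o u| <= e.
Proof.
move=> H.
have E : summability.partial_sum u = (fun B => \sum_(j <- enum_fset B) u j) :> (_ -> R).
  by apply/funext => B; rewrite /summability.partial_sum big_seq_fsetE.
have C : cvg ((summability.partial_sum u : {fset int} -> R^o) @ @summability.totally int).
  apply/cauchy_cvgP/cauchy_exP => e e0.
  have e20 : 0 < e / 2 by rewrite divr_gt0.
  have [A0 HA] := H _ e20.
  exists (\sum_(j <- enum_fset A0) u j); exists A0 => // B AB; rewrite /preimage /=.
  rewrite E -ball_normE /= distrC; apply: le_lt_trans (HA _ AB) _.
  by rewrite ltr_pdivrMr// ltr_pMr// ltr1n.
move=> e e0; have /cvgrPdist_le /(_ _ e0) : summability.partial_sum u @ @summability.totally int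
  --> (@summability.sum int R R^o u : R^o) by exact: C.
by apply: filterS => B; rewrite E distrC.
Qed.

Lemma near_all_seq (I : eqType) (s : seq I) (Pr : I -> {fset int} -> Prop) :
  (forall i, \forall B \near @summability.totally int, Pr i B) ->
  \forall B \near @summability.totally int, forall i, i \in s -> Pr i B.
Proof.
move=> H; elim: s => [|i s IH]; first by apply: nearW.
have [A0 _ h0] := H i; have [A1 _ h1] := IH; exists (A0 `|` A1)%fset => // B.
rewrite /= fsubUset => /andP[AB0 AB1] j; rewrite inE => /orP[/eqP ->|].
  exact: h0.
exact: h1.
Qed.

Lemma near_totallyI (P Q : {fset int} -> Prop) :
  (\forall B \near @summability.totally int, P B) ->
  (\forall B \near @summability.totally int, Q B) ->
  \forall B \near @summability.totally int, P B /\ Q B.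
Proof.
move=> [A0 _ h0] [A1 _ h1]; exists (A0 `|` A1)%fset => // B.
by rewrite /= fsubUset => /andP[AB0 AB1]; split; [exact: h0|exact: h1].
Qed.

(** Compactness of [-N, N] gives a cluster point, and an ultrafilter converges to its cluster
    points. *)
Lemma ultra_bounded_cvg (I : Type) (U : set_system I) (g : I -> R) (N : R) :
  UltraFilter U -> (forall i, `|g i| <= N) -> exists p : R, g i @[i --> U] --> p.
Proof.
move=> UU gN.
have H : \forall i \near U, `[- N, N]%classic (g i).
  by apply: nearW => i; rewrite /= in_itv /= -ler_norml; exact: gN.
have [p [_ clp]] := @segment_compact R (- N) N (g @ U) _ H.
exists p => V Vp; have [//|nV] := in_ultra_setVsetC (g @^-1` V) UU.
have [y [nVy Vy]] := clp (~` V) V nV Vp.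
by [].
Qed.

Section limits.
Variables (x : int -> R) (phi : R -> R) (f : R -> R[i]) (T Q N : R).
Hypotheses (T0 : 0 <= T) (Q0 : 0 <= Q) (N0 : 0 <= N).
Hypothesis translates_bound : forall A c t,
  normc (translates x phi A c t) <= T * Num.sqrt (energy A c).
Hypothesis sum_bound : forall A c A' d,
  `|\sum_(n <- enum_fset A') dotc (translates x phi A c (x n)) (d n)| <=
  Q * Num.sqrt (energy A c) * Num.sqrt (energy A' d).
Hypothesis finite_sol : forall A, exists c, (forall n, n \in A -> translates x phi A c (x n) = f
  (x n)) /\
  Num.sqrt (energy A c) <= N.

(** A tail of small energy contributes little at t by [translates_bound], so the real and imaginary
    partial sums are Cauchy. *)
Lemma cvg_translates a t (e : R) : in_l2 a -> 0 < e ->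
  \forall B \near @summability.totally int,
    normc (translates x phi B a t - translates_sum x phi a t) <= e.
Proof.
move=> /energy_le_l2[M HM] e0.
(* T may be 0 and is to be divided by. *)
have T10 : 0 < T + 1 by rewrite ltr_wpDl.
have H (e' : R) : 0 < e' -> exists A0, forall B, (A0 `<=` B)%fset ->
    normc (translates x phi B a t - translates x phi A0 a t) <= e'.
  move=> {}e0; have d0 : 0 < (e' / (T + 1)) ^+ 2 by rewrite exprn_gt0// divr_gt0.
  have [A0 HA] := energy_tail HM d0; exists A0 => B AB.
  rewrite (translatesD _ _ _ _ AB) addrAC subrr add0r.
  apply: le_trans (translates_bound _ _ _) _.
  apply: (@le_trans _ _ ((T + 1) * (e' / (T + 1)))); last first.
    by rewrite mulrC divfK// gt_eqF.
  apply: ler_pM; rewrite ?sqrtr_ge0// ?lerDl//.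
  have {}d0 : 0 <= e' / (T + 1) by rewrite divr_ge0 ?(ltW e0) ?(ltW T10).
  by rewrite -[leRHS](ger0_norm d0) -sqrtr_sqr ler_wsqrtr// HA.
have e20 : 0 < e / 2 by rewrite divr_gt0.
have hRe := @cvg_totally (fun j => complex.Re (a j * (phi (t - x j))%:C)) _ _ e20.
have hIm := @cvg_totally (fun j => complex.Im (a j * (phi (t - x j))%:C)) _ _ e20.
have ReB B A0 : \sum_(j <- enum_fset B) complex.Re (a j * (phi (t - x j))%:C) -
    \sum_(j <- enum_fset A0) complex.Re (a j * (phi (t - x j))%:C) =
    complex.Re (translates x phi B a t - translates x phi A0 a t).
  by rewrite /translates -!Re_sum;
    case: (\sum_(j <- _) _) (\sum_(j <- enum_fset A0) _) => [? ?] [].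
have ImB B A0 : \sum_(j <- enum_fset B) complex.Im (a j * (phi (t - x j))%:C) -
    \sum_(j <- enum_fset A0) complex.Im (a j * (phi (t - x j))%:C) =
    complex.Im (translates x phi B a t - translates x phi A0 a t).
  by rewrite /translates -!Im_sum;
    case: (\sum_(j <- _) _) (\sum_(j <- enum_fset A0) _) => [? ?] [].
have [|A1 _ h1] := hRe.
  move=> e' e'0; have [A0 HA] := H _ e'0; exists A0 => B AB.
  by rewrite ReB; apply: le_trans (Re_le_normc _) (HA _ AB).
have [|A2 _ h2] := hIm.
  move=> e' e'0; have [A0 HA] := H _ e'0; exists A0 => B AB.
  by rewrite ImB; apply: le_trans (Im_le_normc _) (HA _ AB).
exists (A1 `|` A2)%fset => // B; rewrite /= fsubUset => /andP[AB1 AB2].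
apply: le_trans (normc_ReIm _) _; rewrite [leRHS]splitr; apply: lerD.
  have := h1 _ AB1; rewrite /= -Re_sum; apply: le_trans; rewrite le_eqVlt; apply/orP; left.
  by rewrite /translates_sum /csum /translates; case: (\sum_(j <- _) _).
have := h2 _ AB2; rewrite /= -Im_sum; apply: le_trans; rewrite le_eqVlt; apply/orP; left.
by rewrite /translates_sum /csum /translates; case: (\sum_(j <- _) _).
Qed.

(** B is compared with a larger finite set B' on which the equations at the nodes of A' hold up to
    h. The difference between B' and B has small energy, which [sum_bound] turns into a bound
    uniform in A' and d; then h tends to 0. *)
Lemma near_interp_truncation a (e : R) : in_l2 a ->
  (forall n, translates_sum x phi a (x n) = f (x n)) -> 0 < e ->
  \forall B \near @summability.totally int, forall A' d,
    `|\sum_(n <- enum_fset A') dotc (f (x n) - translates x phi B a (x n)) (d n)|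
      <= e * Num.sqrt (energy A' d).
Proof.
move=> la fa e0; have [M HM] := energy_le_l2 la.
have Q10 : 0 < Q + 1 by rewrite ltr_wpDl.
have d0 : 0 < (e / (Q + 1)) ^+ 2 by rewrite exprn_gt0// divr_gt0.
have [A0 HA] := energy_tail HM d0.
apply: (@near_totally A0) => B AB A' d.
have HB B' : (B `<=` B')%fset -> Q * Num.sqrt (energy (B' `\` B)%fset a) <= e.
  move=> BB'; have {}d0 : 0 <= e / (Q + 1) by rewrite divr_ge0 ?(ltW e0) ?(ltW Q10).
  apply: (@le_trans _ _ ((Q + 1) * (e / (Q + 1)))); last first.
    by rewrite mulrC divfK// gt_eqF.
  apply: ler_pM; rewrite ?sqrtr_ge0// ?lerDl//.
  rewrite -[leRHS](ger0_norm d0) -sqrtr_sqr ler_wsqrtr//.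
  apply: le_trans (HA B' (fsubset_trans AB BB')); apply: energyS.
  exact: fsetDS.
pose D := \sum_(n <- enum_fset A') normc (d n).
have D0 : 0 <= D by apply: sumr_ge0 => n _; exact: normc_nonneg.
apply/ler_addgt0Pr => h h0.
have hD : 0 < h / (D + 1) by rewrite divr_gt0// ltr_wpDl.
have near1 : \forall B' \near @summability.totally int, forall n, n \in enum_fset A' ->
    normc (translates x phi B' a (x n) - f (x n)) <= h / (D + 1).
  apply: near_all_seq => n; have := cvg_translates (x n) la hD; rewrite fa; exact.
have [A1 _ h1] := near1.
(* B' depends on A', d and h, but the bound [HB] does not. *)
pose B' := (B `|` A1)%fset.
have BB' : (B `<=` B')%fset by exact: fsubsetUl.
have {}h1 := h1 B' (fsubsetUr _ _).
have -> : \sum_(n <- enum_fset A') dotc (f (x n) - translates x phi B a (x n)) (d n) =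
   \sum_(n <- enum_fset A') dotc (translates x phi (B' `\` B)%fset a (x n)) (d n) -
   \sum_(n <- enum_fset A') dotc (translates x phi B' a (x n) - f (x n)) (d n).
  rewrite -sumrB; apply: eq_bigr => n _; rewrite -dotcBl; congr dotc.
  by rewrite (translatesD _ _ _ _ BB'); ring.
rewrite (le_trans (ler_normB _ _))//; apply: lerD.
  by rewrite (le_trans (sum_bound _ _ _ _))// ler_wpM2r ?sqrtr_ge0// HB.
apply: (@le_trans _ _ (\sum_(n <- enum_fset A') (h / (D + 1) * normc (d n)))).
  rewrite (le_trans (ler_norm_sum _ _ _))// big_seq [leRHS]big_seq; apply: ler_sum => n nA.
  rewrite (le_trans (dotc_le_normc _ _))// ler_wpM2r ?normc_nonneg//.
  exact: h1.
rewrite -mulr_sumr -/D mulrAC ler_pdivrMr ?ltr_wpDl// ler_pM2l// lerDl//.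
Qed.

(** With the row itself as coefficients, the value at x n is the energy E of the row, so E <= T
    sqrt(E). *)
Lemma row_energy n A : energy A (fun j => (phi (x n - x j))%:C) <= T ^+ 2.
Proof.
set r := fun j => _; have := translates_bound A r (x n).
have -> : translates x phi A r (x n) = (energy A r)%:C.
  rewrite /translates /energy rmorph_sum; apply: eq_bigr => j _.
  by rewrite sqc_real expr2 rmorphM.
rewrite normc_sqrt sqc_real sqrtr_sqr ger0_norm ?energy_ge0// => h.
have E0 := energy_ge0 A r.
have := sqrtr_ge0 (energy A r); rewrite le_eqVlt => /orP[/eqP E|s0].
  by have /eqP := esym E; rewrite sqrtr_eq0 => E1; rewrite (le_trans E1)// sqr_ge0.
rewrite -[X in X <= _]sqr_sqrtr// ler_pXn2r ?nnegrE ?sqrtr_ge0//.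
by rewrite -(ler_pM2r s0) -expr2 sqr_sqrtr.
Qed.

Lemma normc_sum_le I (s : seq I) (F : I -> R[i]) :
  normc (\sum_(i <- s) F i) <= \sum_(i <- s) normc (F i).
Proof.
elim: s => [|i s IH]; first by rewrite !big_nil normc0.
by rewrite !big_cons (le_trans (le_normcD _ _))// lerD2l.
Qed.

(* Limit along an ultrafilter of the solutions of the finite sections: these are
   bounded in l2, and the row j |-> phi (x n - x j) is in l2, so the nth equation
   passes to the limit. *)
Lemma exists_interp : exists a, in_l2 a /\ forall n, translates_sum x phi a (x n) = f (x n).
Proof.
have [cA HcA] := choice finite_sol.
(* U refines [totally], so its sets eventually contain any given finite set. *)
have [U [UU sU]] := ultraFilterLemma (@summability.totally_filter int).
pose b A := fset_restr A (cA A).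
have energy_cA A : energy A (cA A) <= N ^+ 2.
  rewrite -[leLHS]sqr_sqrtr ?energy_ge0// ler_pXn2r ?nnegrE ?sqrtr_ge0//.
  by have [] := HcA A.
have energy_b A B : energy B (b A) <= N ^+ 2.
  apply: le_trans (energy_cA A); apply: le_trans (energyS _ (fsubsetUr A B)) _.
  rewrite le_eqVlt; apply/orP; left; apply/eqP.
  rewrite /energy -(big_fset_supp (fun j => sqc (cA A j)) (fsubsetUl A B)).
  by apply: eq_bigr => j _; rewrite /b /fset_restr; case: ifP => // _; rewrite sqc0.
have b_le A j : normc (b A j) <= N.
  rewrite -(@ler_pXn2r _ 2)// ?nnegrE ?normc_nonneg// -sqcE.
  by have := energy_b A [fset j]%fset; rewrite /energy big_seq_fset1.
have cR j : exists p : R, complex.Re (b A j) @[A --> U] --> p.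
  apply: (ultra_bounded_cvg UU (N := N)) => A.
  exact: le_trans (Re_le_normc _) (b_le _ _).
have cI j : exists p : R, complex.Im (b A j) @[A --> U] --> p.
  apply: (ultra_bounded_cvg UU (N := N)) => A.
  exact: le_trans (Im_le_normc _) (b_le _ _).
have [ar har] := choice cR; have [ai hai] := choice cI.
pose a j := ar j +i* ai j.
have conv j (e : R) : 0 < e -> \forall A \near U, normc (b A j - a j) <= e.
  move=> e0; have e20 : 0 < e / 2 by rewrite divr_gt0.
  have /cvgrPdist_le /(_ _ e20) h1 := har j; have /cvgrPdist_le /(_ _ e20) h2 := hai j.
  apply: filterS2 h1 h2 => A h1 h2; apply: le_trans (normc_ReIm _) _.
  have -> : complex.Re (b A j - a j) = complex.Re (b A j) - ar j by case: (b A j).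
  have -> : complex.Im (b A j - a j) = complex.Im (b A j) - ai j by case: (b A j).
  by rewrite [leRHS]splitr; apply: lerD; rewrite distrC.
have energy_a B : energy B a <= N ^+ 2.
  have C : energy B (b A) @[A --> U] --> energy B a.
    rewrite /energy; elim: (enum_fset B) => [|j s IH].
      by under eq_fun do rewrite big_nil; rewrite big_nil; exact: cvg_cst.
    under eq_fun do rewrite big_cons; rewrite big_cons; apply: cvgD => //.
    by rewrite /sqc /dotc; apply: cvgD; apply: cvgM; exact: har || exact: hai.
  rewrite -(cvg_lim (@Rhausdorff R) C); apply: limr_le; first by apply/cvg_ex; eexists; exact: C.
  by apply: nearW => A; exact: energy_b.
have la : in_l2 a by exact: in_l2_energy energy_a.
exists a; split => // n.
pose r j := (phi (x n - x j))%:C : R[i].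
apply/eqP; rewrite -subr_eq0; apply/eqP; apply: eq0_normc; apply/eqP.
rewrite eq_le normc_nonneg andbT; apply/ler_addgt0Pr => e e0; rewrite add0r.
(* The weight in |u v| <= eta |u|^2 + |v|^2 / eta: eta times the energy bound is at most e / 4, and
   the tail of the row is made smaller than eta * e / 4. *)
pose eta := e / 4 / (N ^+ 2 + 1).
have N21 : 0 < N ^+ 2 + 1 by rewrite ltr_wpDl// sqr_ge0.
have eta0 : 0 < eta by rewrite !divr_gt0.
have e40 : 0 < e / 4 by rewrite divr_gt0.
have tail0 : 0 < e / 4 * eta by rewrite mulr_gt0.
have [A1 HA1] := energy_tail (row_energy n) tail0.
have [A2 _ HA2] := cvg_translates (x n) la e40.
(* The singleton puts n in every A that contains A0, so that the nth equation holds for [cA A]. *)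
pose A0 := (A1 `|` A2 `|` [fset n])%fset.
have A10 : (A1 `<=` A0)%fset by rewrite /A0 -fsetUA fsubsetUl.
have A20 : (A2 `<=` A0)%fset by rewrite /A0 fsetUAC fsubsetUr.
have nA0 : n \in A0 by rewrite !inE eqxx orbT.
pose R0 := \sum_(j <- enum_fset A0) normc (r j).
have R00 : 0 <= R0 by apply: sumr_ge0 => j _; exact: normc_nonneg.
have d0 : 0 < e / 4 / (R0 + 1) by rewrite divr_gt0// ltr_wpDl.
have nearA : \forall A \near U, (A0 `<=` A)%fset /\
    forall j, j \in enum_fset A0 -> normc (b A j - a j) <= e / 4 / (R0 + 1).
  apply: filterI; first by apply: sU; exists A0.
  elim: (enum_fset A0) => [|j s IH]; first by apply: nearW.
  apply: filterS2 (conv j _ d0) IH => A h1 h2 i.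
  by rewrite inE => /orP[/eqP ->|/h2].
have [A [AA hA]] := filter_ex nearA.
have [fA _] := HcA A.
(* Three errors: the truncation of a, the finitely many coefficients in A0 (convergence along U),
   and the tail of the finite solution (small row tail). *)
have -> : translates_sum x phi a (x n) - f (x n) =
  - (translates x phi A0 a (x n) - translates_sum x phi a (x n)) +
  - (translates x phi A0 (fun j => cA A j - a j) (x n)) + - translates x phi (A `\` A0)%fset (cA
    A) (x n).
  rewrite -fA; last exact: (fsubsetP AA).
  by rewrite (translatesD _ _ _ _ AA) -translatesB; ring.
have h1 : normc (translates x phi A0 a (x n) - translates_sum x phi a (x n)) <= e / 4 by exact:
  HA2.
have h2 : normc (translates x phi A0 (fun j => cA A j - a j) (x n)) <= e / 4.
  apply: (@le_trans _ _ (\sum_(j <- enum_fset A0) (e / 4 / (R0 + 1) * normc (r j)))).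
    rewrite (le_trans (normc_sum_le _ _))// big_seq [leRHS]big_seq; apply: ler_sum => j jA0.
    rewrite normcM ler_wpM2r ?normc_nonneg//; have := hA j jA0.
    by rewrite /b /fset_restr (fsubsetP AA).
  by rewrite -mulr_sumr -/R0 mulrAC ler_pdivrMr ?ltr_wpDl// ler_pM2l// lerDl.
have h3 : normc (translates x phi (A `\` A0)%fset (cA A) (x n)) <= e / 4 + e / 4.
  apply: (@le_trans _ _ (\sum_(j <- enum_fset (A `\` A0)%fset) (eta * sqc (cA A j) + eta^-1 *
    sqc (r j)))).
    rewrite (le_trans (normc_sum_le _ _))//; apply: ler_sum => j _.
    rewrite normcM !sqcE; move: (normc (cA A j)) (normc (r j)) => u v.
    have i0 : 0 < eta^-1 by rewrite invr_gt0.
    rewrite -subr_ge0 (_ : _ - _ = eta^-1 * ((eta * u - v / 2) ^+ 2 + 3 / 4 * v ^+ 2)).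
      by rewrite mulr_ge0 ?(ltW i0)// addr_ge0 ?sqr_ge0// mulr_ge0 ?sqr_ge0// divr_ge0.
    by field; rewrite gt_eqF.
  rewrite big_split /= -!mulr_sumr; apply: lerD.
    apply: (@le_trans _ _ (eta * (N ^+ 2 + 1))); last by rewrite /eta divfK// gt_eqF.
    rewrite ler_pM2l//; apply: (@le_trans _ _ (N ^+ 2)); last by rewrite lerDl.
    by apply: le_trans (energy_cA A); apply: energyS; exact: fsubsetDl.
  rewrite mulrC ler_pdivrMr//; apply: le_trans (HA1 A _); last exact: fsubset_trans A10 AA.
  by apply: energyS; exact: fsetDS.
rewrite (le_trans (le_normcD _ _))// (le_trans (lerD (le_normcD _ _) (lexx _)))// !normcN.
by move: h1 h2 h3; lra.
Qed.

End limits.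

End square_summable.

(** * The uniform error bound and the limit for a regular family *)

Section regular_interpolator.
Variable R : realType.
Notation mu := (@lebesgue_measure R).
Notation ID := (\1_(Ipi R) : R -> R).

Lemma mphi_le (phi : R -> R) : A2 phi ->
  0 < mphi phi /\ forall xi, Ipi R xi -> mphi phi <= phi_hat phi xi.
Proof.
move=> [p0 [delta d0 pd]].
have pd' xi : Ipi R xi -> delta <= phi_hat phi xi.
  by move=> /pd; rewrite rfourierE// lecR.
have D0 : Ipi R 0 by rewrite /Ipi /= in_itv /= oppr_le0 pi_ge0.
split.
  apply: (lt_le_trans d0); apply: lb_le_inf; first by exists (phi_hat phi 0), 0.
  by move=> _ [xi Dxi <-]; exact: pd'.
move=> xi Dxi; apply: ge_inf; last by exists xi.
by exists delta => _ [y Dy <-]; exact: pd'.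
Qed.

Lemma L2norm_Tmul (phi : R -> R) (fhat : R -> R[i]) : A1 phi -> A2 phi -> L2w ID fhat ->
  L2norm (Ipi R) (Tmul phi fhat) = (nrm ID (damped phi (mphi phi) fhat))%:E.
Proof.
move=> phi1 phi2 Lf; have [m0 mle] := mphi_le phi2; have [p0 _] := phi2.
rewrite (@L2norm_eq _ _ _ (damped phi (mphi phi) fhat)).
  by rewrite L2norm_nrm//; [exact: measurable_Ipi|exact: L2w_damping].
move=> xi Dxi; rewrite /Tmul /damped /damping max_l ?mle// rfourierE//; congr (_ * _).
by rewrite rmorphM fmorphV.
Qed.

(** The coefficient of tau in [translates_error]. It involves only the Riesz constant C and the
    constant B of (H2), hence is uniform in alpha. *)
Definition error_const (C B : R) : R := (2 * B * C ^+ 4 + 2 * B * C ^+ 2) * (2 + 2 * B * C ^+ 4).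

Lemma interpolant_error (x : int -> R) (C B : R) (phi : R -> R) (f fhat : R -> R[i]) (t : R) :
  CIS x -> 0 < C -> (forall A c,
    nrm ID (tsum x A c) <= C * Num.sqrt (energy A c) /\
    Num.sqrt (energy A c) <= C * nrm ID (tsum x A c)) ->
  A1 phi -> A2 phi -> 0 <= B ->
  (\esum_(j in [set j : int | (j != 0)%R]) Mj phi j <= (B * mphi phi)%:E)%E ->
  PW f -> is_fourier_L2 f fhat ->
  normc (f t - interpolant x phi f t) <=
    error_const C B * nrm ID (damped phi (mphi phi) fhat).
Proof.
move=> xC C0 frame phi1 phi2 B0 sumM PWf Ff.
have [m0 mle] := mphi_le phi2; have [p0 _] := phi2.
set m := mphi phi in m0 mle sumM *; set tau := nrm ID _.
have k0 := kappa_gt0 R.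
have Lf : L2w ID fhat by have [_ L _] := Ff; apply: in_L2_L2w => //; exact: measurable_Ipi.
have f_inv d u := PW_inversion d u PWf Ff.
have [T [T0 HT]] : exists T : R, 0 <= T /\ forall A c u,
    normc (translates x phi A c u) <= T * Num.sqrt (energy A c).
  eexists; split; last exact: (translates_le C0 frame phi1 p0 m0 B0 sumM).
  by rewrite !mulr_ge0 ?sqrtr_ge0// ltW.
have [Q [Q0 HQ]] : exists Q : R, 0 <= Q /\ forall A c A' d,
    `|\sum_(n <- enum_fset A') dotc (translates x phi A c (x n)) (d n)| <=
      Q * Num.sqrt (energy A c) * Num.sqrt (energy A' d).
  eexists; split; last exact: (sum_translates_le C0 frame phi1 p0 m0 B0 sumM).
  apply: mulr_ge0; first exact: ltW.
  apply: mulr_ge0; last exact: sqr_ge0.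
  apply: addr_ge0; last exact: outer_const_ge0.
  by apply: addr_ge0 => //; apply: mulr_ge0 => //; exact: sqr_ge0.
have Hsol (A : {fset int}) : exists c, (forall n, n \in A -> translates x phi A c (x n) = f (x
  n)) /\
    Num.sqrt (energy A c) <= C * (nrm ID fhat / m).
  have [c Hc] := finite_interp frame phi1 p0 m0 mle A (fun n => f (x n)).
  exists c; split => //.
  exact: (finite_interp_energy C0 frame phi1 p0 m0 mle Lf f_inv Hc).
have N0 : 0 <= C * (nrm ID fhat / m).
  by apply: mulr_ge0; [exact: ltW|apply: divr_ge0; [exact: nrm_ge0|exact: ltW]].
(* A solution exists, so [xget] returns one and not its default value. *)
have [la fa] : in_l2 (interp_coef x phi f) /\
    forall n, translates_sum x phi (interp_coef x phi f) (x n) = f (x n).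
  exact: xgetPex (exists_interp T0 N0 HT Hsol).
rewrite /interpolant; move: (interp_coef x phi f) la fa => a la fa.
pose K' := 2 * B * C ^+ 4 + 2 * B * C ^+ 2.
have K'0 : 0 <= K'.
  have B2 : 0 <= 2 * B by exact: mulr_ge0.
  by apply: addr_ge0; apply: mulr_ge0 => //; apply: exprn_ge0; exact: ltW.
(* The coefficient of eps in [translates_error]. *)
pose K2 := (kappa R)^-1 * C * (1 + 2 * K').
have K20 : 0 <= K2.
  apply: mulr_ge0; last by apply: addr_ge0 => //; exact: mulr_ge0.
  by apply: mulr_ge0; [rewrite invr_ge0|]; exact: ltW.
apply/ler_addgt0Pr => e e0.
have e20 : 0 < e / 2 by rewrite divr_gt0.
have d0 : 0 < e / 2 / (K2 + 1) by rewrite divr_gt0// ltr_wpDl.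
have [A _ hA] := near_totallyI (cvg_translates T0 HT t la e20)
  (near_interp_truncation T0 Q0 HT HQ la fa d0).
have [h1 h2] := hA A (fsubset_refl A).
have h3 := translates_error C0 frame phi1 p0 m0 mle B0 sumM Lf f_inv (ltW d0) h2
  (fun g e' Lg e'0 => CIS_dense xC Lg e'0) t.
have -> : f t - translates_sum x phi a t =
    (f t - translates x phi A a t) + (translates x phi A a t - translates_sum x phi a t).
  by rewrite addrA subrK.
rewrite (le_trans (le_normcD _ _))// (splitr e) addrA; apply: lerD => //.
apply: le_trans h3 _; rewrite -/tau /error_const -/K'.
set ep := e / 2 / (K2 + 1).
rewrite [leLHS](_ : _ = K' * (2 + 2 * B * C ^+ 4) * tau + K2 * ep); last by rewrite /K2 /K'; ring.
rewrite lerD2l /ep mulrCA ler_piMr ?(ltW e20)// ler_pdivrMr ?ltr_wpDl//.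
by rewrite mul1r lerDl.
Qed.

Lemma error_const_ge0 (C B : R) : 0 < C -> 0 <= B -> 0 <= error_const C B.
Proof.
move=> C0 B0; have B2 : 0 <= 2 * B by exact: mulr_ge0.
have h n : 0 <= 2 * B * C ^+ n by apply: mulr_ge0 => //; apply: exprn_ge0; exact: ltW.
by apply: mulr_ge0; apply: addr_ge0.
Qed.

(** The squared multiplier is at most 1, so |fhat|^2 on [-pi, pi] dominates, and (H3) gives
    pointwise convergence almost everywhere. The limit is taken along a sequence in Lambda because
    dominated convergence is. *)
Lemma damped_cvg0 (phi : R -> R -> R) (Lambda : set R) (fhat : R -> R[i]) (al : nat -> R) :
  (forall alpha, Lambda alpha -> A1 (phi alpha) /\ A2 (phi alpha)) ->
  {ae mu, forall xi : R, Ipi R xi ->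
     mphi (phi alpha) / complex.Re (rfourier (phi alpha) xi)
       @[alpha --> within Lambda (pinfty_nbhs R)] --> (0 : R)} ->
  (forall n, Lambda (al n)) -> (forall n, n%:R < al n) -> L2w ID fhat ->
  ip ID (damped (phi (al n)) (mphi (phi (al n))) fhat)
        (damped (phi (al n)) (mphi (phi (al n))) fhat) @[n --> \oo] --> 0.
Proof.
move=> H12 H3 Lal al_n Lf.
have al_cvg : al n @[n --> \oo] --> within Lambda (pinfty_nbhs R).
  move=> P [M [Mr HM]].
  have : \forall n \near \oo, M < n%:R.
    have := @cvgr_idn R; move/cvgryPgt => /(_ M); exact.
  by apply: filterS => n Mn; apply: HM => //; exact: lt_trans Mn (al_n n).
pose q n xi := damping (phi (al n)) (mphi (phi (al n))) xi.
have E n : ip ID (damped (phi (al n)) (mphi (phi (al n))) fhat)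
    (damped (phi (al n)) (mphi (phi (al n))) fhat) =
    \int[mu]_xi (ID xi * (q n xi) ^+ 2 * sqc (fhat xi)).
  by apply: eq_Rintegral => xi _; rewrite /damped dotcM sqc_real mulrA.
rewrite (funext E).
have [mD _] := weight_Ipi R; have [mf If] := Lf.
have mph n : 0 < mphi (phi (al n)).
  by have [_ a2] := H12 _ (Lal n); have [] := mphi_le a2.
have q0 n xi : 0 <= q n xi by exact/ltW/damping_gt0.
have q1 n xi : q n xi <= 1 by exact: damping_le1.
have mq n : measurable_fun setT (q n).
  have [a1 [a2 _]] := H12 _ (Lal n); exact: measurable_damping.
rewrite (_ : 0 = \int[mu]_xi (ID xi * 0 ^+ 2 * sqc (fhat xi))); last first.
  under eq_Rintegral do rewrite expr0n mulr0 mul0r.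
  by rewrite /Rintegral integral0.
apply: (@dominated_cvg_R _ _ _ (fun xi => ID xi * sqc (fhat xi))) => //.
- move=> n; apply: measurable_funM; last exact: measurable_dotc.
  by apply: measurable_funM => //; exact: measurable_funX.
- by under eq_fun do rewrite expr0n mulr0 mul0r; exact: measurable_cst.
- apply: ae_imp H3 => xi Hxi; apply: cvgM; last exact: cvg_cst.
  rewrite indicE; case: (boolP (xi \in Ipi R)) => [/set_mem Dxi|_]; last first.
    by under eq_fun do rewrite mul0r; rewrite mul0r; exact: cvg_cst.
  apply: cvgM; first exact: cvg_cst.
  have C1 : q n xi @[n --> \oo] --> 0.
    have qE : (fun n => q n xi) = (fun n => mphi (phi (al n)) / complex.Re (rfourier (phi (al
      n)) xi)).
      apply/funext => n; rewrite /q /damping max_l//.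
      by have [_ a2] := H12 _ (Lal n); have [_ h] := mphi_le a2; exact: h.
    by rewrite qE; exact: (cvg_comp _ _ al_cvg (Hxi Dxi)).
  by rewrite expr2; under eq_fun do rewrite expr2; exact: cvgM.
- move=> n xi; have D0 : 0 <= ID xi by rewrite indicE.
  have Q0 : 0 <= q n xi ^+ 2 by exact: sqr_ge0.
  have S0 := sqc_ge0 (fhat xi).
  rewrite ger0_norm; last by apply: mulr_ge0 => //; exact: mulr_ge0.
  by apply: ler_wpM2r => //; apply: ler_piMr => //; rewrite expr_le1.
Qed.

End regular_interpolator.

Theorem theorem2 (R : realType) (x : int -> R) (Lambda : set R)
    (phi : R -> R -> R)
    (x_CIS : CIS x)
    (Lambda_pos : forall alpha, Lambda alpha -> 0 < alpha)
    (Lambda_unbounded : forall b : R, exists2 alpha, Lambda alpha & b < alpha)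
    (phi_regular : regular_family Lambda phi) :
  (exists C : R, forall f fhat : R -> R[i], PW f -> is_fourier_L2 f fhat ->
     forall alpha : R, Lambda alpha -> forall t : R,
       ((normc (f t - interpolant x (phi alpha) f t)%R)%:E
          <= C%:E * L2norm (Ipi R) (Tmul (phi alpha) fhat))%E)
  /\
  (forall f : R -> R[i], PW f -> forall eps : R, 0 < eps ->
     \forall alpha \near within Lambda (pinfty_nbhs R),
       forall t : R, normc (f t - interpolant x (phi alpha) f t) < eps).
Proof.
have [H1 [B0 H2] H3] := phi_regular.
have [C C0 frame] := CIS_frame x_CIS.
have mD := @measurable_Ipi R.
(* (H2) does not give its constant a sign; the absolute value is still admissible as m is
   positive. *)
pose B := `|B0|; have B_ge0 : 0 <= B by exact: normr_ge0.
have H12 alpha : Lambda alpha -> A1 (phi alpha) /\ A2 (phi alpha).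
  by move=> /H1[].
have sumM alpha : Lambda alpha ->
    (\esum_(j in [set j : int | (j != 0)%R]) Mj (phi alpha) j <= (B * mphi (phi alpha))%:E)%E.
  move=> La; apply: le_trans (H2 _ La) _; rewrite lee_fin.
  have [_ a2] := H12 _ La; have [m0 _] := mphi_le a2.
  by rewrite ler_pM2r// ler_norm.
have Lf f fhat : is_fourier_L2 f fhat -> L2w (\1_(Ipi R) : R -> R) fhat.
  by move=> [_ L _]; exact: in_L2_L2w.
pose K := error_const C B.
have K0 : 0 <= K by exact: error_const_ge0.
have err f fhat alpha t : PW f -> is_fourier_L2 f fhat -> Lambda alpha ->
    normc (f t - interpolant x (phi alpha) f t) <=
    K * nrm (\1_(Ipi R) : R -> R) (damped (phi alpha) (mphi (phi alpha)) fhat).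
  move=> PWf Ff La; have [a1 a2] := H12 _ La.
  exact: interpolant_error (sumM _ La) PWf Ff.
split.
  exists K => f fhat PWf Ff alpha La t; have [a1 a2] := H12 _ La.
  by rewrite (L2norm_Tmul a1 a2 (Lf _ _ Ff)) -EFinM lee_fin err.
move=> f PWf eps eps0; have [_ _ [fhat Ff _]] := PWf.
(* If the bound fails near infinity, there is a bad alpha in Lambda above every n; [damped_cvg0]
   applies to a sequence of these. *)
apply: contrapT => nnear.
have bad (n : nat) : exists alpha, [/\ Lambda alpha, n%:R < alpha &
    ~ forall t, normc (f t - interpolant x (phi alpha) f t) < eps].
  apply: contrapT => H; apply: nnear; exists n%:R; split; first exact: num_real.
  move=> alpha na La; apply: contrapT => nt; apply: H; exists alpha; split => //.
have [al hal] := choice bad.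
have Lal n : Lambda (al n) by have [] := hal n.
have al_n n : n%:R < al n by have [] := hal n.
have := damped_cvg0 H12 H3 Lal al_n (Lf _ _ Ff).
have K10 : 0 < K + 1 by rewrite ltr_wpDl.
have d0 : 0 < (eps / (K + 1)) ^+ 2 by rewrite exprn_gt0// divr_gt0.
(* A single index n from the tail already contradicts its choice, since the error bound does not
   involve t. *)
move=> /cvgrPdist_lt /(_ _ d0) [n _ /(_ n (leqnn n))] /=.
have [_ _] := hal n; set g := damped _ _ _ => bt.
have wD := weight_Ipi R.
rewrite sub0r normrN ger0_norm ?ip_ge0// -sqr_nrm// => small; apply: bt => t.
have e0 : 0 <= eps / (K + 1) by rewrite divr_ge0 ?ltW.
have {}small : nrm (\1_(Ipi R) : R -> R) g < eps / (K + 1).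
  by move: small; rewrite ltr_pXn2r ?nnegrE ?nrm_ge0.
apply: le_lt_trans (err _ _ _ t PWf Ff (Lal n)) _; rewrite -/g.
apply: (@le_lt_trans _ _ ((K + 1) * nrm (\1_(Ipi R) : R -> R) g)).
  by rewrite ler_wpM2r ?nrm_ge0// lerDl.
by rewrite mulrC -ltr_pdivlMr.
Qed.
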